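(* Let $\mathcal{M}_L=\{T\in\mathcal{S}'_2:T\times f\in\mathcal{S}_2\ \text{for all } f\in\mathcal{S}_2\}$ and $\mathcal{M}_R=\{T\in\mathcal{S}'_2:f\times T\in\mathcal{S}_2\ \text{for all } f\in\mathcal{S}_2\}$, where $\times$ is the twisted product, and let $\mathcal{G}_{s,t}\subset\mathcal{S}'_2$ ($s,t\in\mathbb{R}$) be the Hilbert spaces obtained by completing $\mathcal{S}_2$ in the norms $\|\cdot\|_{st}$. Then, as subspaces of $\mathcal{S}'_2$, $$\mathcal{M}_L=\bigcap_{s\in\mathbb{R}}\bigcup_{t\in\mathbb{R}}\mathcal{G}_{s,t},\qquad \mathcal{M}_R=\bigcap_{t\in\mathbb{R}}\bigcup_{s\in\mathbb{R}}\mathcal{G}_{s,t}.$$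
   Context: Notation. $\mathcal{S}_2=\mathcal{S}(\mathbb{R}^2)$ is the Schwartz space of complex-valued functions of $(q,p)$ and $\mathcal{S}'_2$ its dual. The bilinear pairing is normalized so that functions embed in $\mathcal{S}'_2$ by $\langle f,g\rangle=(2\pi)^{-1}\int_{\mathbb{R}^2}fg\,dq\,dp$. $f^*$ is the complex conjugate. $\mathbb{N}=\{0,1,2,\dots\}$. Twisted product: for $f,g\in\mathcal{S}_2$, $$(f\times g)(u)=\frac{1}{4\pi^2}\int_{\mathbb{R}^2}\int_{\mathbb{R}^2}f(v)g(w)\,e^{i(u'Jv+v'Jw+w'Ju)}\,dv\,dw,\qquad J=\begin{pmatrix}0&1\\-1&0\end{pmatrix},$$ where $u'Jv$ denotes transpose$(u)Jv$; $\times$ is an associative continuous product on $\mathcal{S}_2$. For $T\in\mathcal{S}'_2$, $f\in\mathcal{S}_2$, the distributions $T\times f,\ f\times T\in\mathcal{S}'_2$ are defined by $\langle T\times f,h\rangle:=\langle T,f\times h\rangle$ and $\langle f\times T,h\rangle:=\langle T,h\times f\rangle$ for $h\in\mathcal{S}_2$. Twisted Hermite basis: for $m\ge n$ in $\mathbb{N}$, $$f_{mn}(q,p)=2(-1)^n\sqrt{\tfrac{n!}{m!}}\,(q-ip)^{m-n}L_n^{m-n}(q^2+p^2)\,e^{-(q^2+p^2)/2},$$ with $L_n^{\alpha}$ the associated Laguerre polynomials, and $f_{mn}:=f_{nm}^*$ for $m<n$. These form an orthonormal basis of $L^2(\mathbb{R}^2,(4\pi)^{-1}dq\,dp)$ and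 satisfy $f_{mn}\times f_{kl}=\delta_{nk}f_{ml}$. Every $T\in\mathcal{S}'_2$ has a unique expansion $T=\sum_{m,n}c_{mn}f_{mn}$ converging in $\mathcal{S}'_2$, with $c_{mn}=\frac12\langle T,f_{mn}^*\rangle$. Hilbert spaces: $\mathcal{G}_{s,t}$ is the completion of $\mathcal{S}_2$ in the norm $$\Bigl\|\sum_{m,n=0}^\infty c_{mn}f_{mn}\Bigr\|_{st}^2:=\sum_{m,n=0}^\infty(2m+1)^s(2n+1)^t|c_{mn}|^2;$$ it is identified with the space of those $T=\sum c_{mn}f_{mn}\in\mathcal{S}'_2$ for which this sum is finite. *)

(* Defs.v *)
From HB Require Import structures.
From mathcomp Require Import all_boot all_order all_algebra.
From mathcomp Require Import complex.
From mathcomp Require Import all_classical all_reals all_analysis.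

Set Implicit Arguments.
Unset Strict Implicit.
Unset Printing Implicit Defensive.

Import Order.TTheory GRing.Theory Num.Theory.
Import numFieldNormedType.Exports.

Local Open Scope classical_set_scope.
Local Open Scope ring_scope.
Local Open Scope complex_scope.

Notation plane R := (R * R)%type (only parsing).

Section SchwartzFunctions.
Context {R : realType}.
Implicit Types (f g : plane R -> R[i]) (u : plane R) (s : seq bool).

(* A word over [bool] is an iterated partial derivative: [false] stands for
   d/dq and [true] for d/dp. *)
Definition basis_vec (i : bool) : plane R := if i then (0, 1) else (1, 0).

(* MathComp-Analysis puts no real normed-module structure on [R[i]], so
   complex-valued functions are differentiated and integrated through their
   real and imaginary parts. *)
Definition re_part f : plane R -> R := fun u => complex.Re (f u).
Definition im_part f : plane R -> R := fun u => complex.Im (f u).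

Definition partial (i : bool) f : plane R -> R[i] :=
  fun u => 'D_(basis_vec i) (re_part f) u +i* 'D_(basis_vec i) (im_part f) u.

Definition partials s f : plane R -> R[i] := foldr partial f s.

(* All partial derivatives of all orders, taken in any order, exist and are
   continuous. *)
Definition smooth f := forall s,
  [/\ continuous (re_part (partials s f)),
      continuous (im_part (partials s f)) &
      forall i u, derivable (re_part (partials s f)) u (basis_vec i) /\
                  derivable (im_part (partials s f)) u (basis_vec i)].

Definition cnorm (z : R[i]) : R := ComplexField.Normc.normc z.

(* |q^a p^b (d/dq)^c (d/dp)^d f(q,p)| *)
Definition weighted_partial (a b c d : nat) f u : R :=
  `|u.1 ^+ a * u.2 ^+ b|
  * cnorm (partials (nseq c false ++ nseq d true) f u).

Definition is_schwartz f := smooth f /\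
  forall a b c d, has_ubound (range (weighted_partial a b c d f)).

Definition schwartz : {pred plane R -> R[i]} := fun f => `[< is_schwartz f >].

Definition seminorm (a b c d : nat) f : R :=
  sup (range (weighted_partial a b c d f)).

Let re_lin (a : R[i]) f g : re_part (a *: f + g) =
  complex.Re a *: re_part f - complex.Im a *: im_part f + re_part g.
Proof.
apply/funext => u; rewrite /re_part /im_part !fctE /=.
by case: (f u) (g u) a => [? ?] [? ?] [? ?].
Qed.

Let im_lin (a : R[i]) f g : im_part (a *: f + g) =
  complex.Re a *: im_part f + complex.Im a *: re_part f + im_part g.
Proof.
apply/funext => u; rewrite /re_part /im_part !fctE /=.
by case: (f u) (g u) a => [? ?] [? ?] [? ?].
Qed.

Lemma partials_lin s (a : R[i]) f g : smooth f -> smooth g ->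
  partials s (a *: f + g) = a *: partials s f + partials s g.
Proof.
move=> sf sg; elim: s => [//|i s IHs] /=; rewrite {}IHs.
have [_ _ df] := sf s; have [_ _ dg] := sg s.
apply/funext => u; have [df1 df2] := df i u; have [dg1 dg2] := dg i u.
have dlin (x y : R) (h1 h2 h3 : plane R -> R) :
    derivable h1 u (basis_vec i) -> derivable h2 u (basis_vec i) ->
    derivable h3 u (basis_vec i) ->
    'D_(basis_vec i) (x *: h1 + y *: h2 + h3) u =
    x * 'D_(basis_vec i) h1 u + y * 'D_(basis_vec i) h2 u
    + 'D_(basis_vec i) h3 u.
  move=> d1 d2 d3.
  have d1x : derivable (x *: h1) u (basis_vec i) by exact: derivableZ.
  have d2y : derivable (y *: h2) u (basis_vec i) by exact: derivableZ.
  rewrite (deriveD (derivableD d1x d2y) d3) (deriveD d1x d2y).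
  by rewrite (deriveZ _ d1) (deriveZ _ d2).
rewrite /partial re_lin im_lin -scaleNr.
rewrite (dlin _ _ _ _ _ df1 df2 dg1) (dlin _ _ _ _ _ df2 df1 dg2) mulNr.
by rewrite !fctE /=; case: a => x y.
Qed.

Lemma smooth_lin (a : R[i]) f g : smooth f -> smooth g -> smooth (a *: f + g).
Proof.
move=> sf sg s; have [f1 f2 df] := sf s; have [g1 g2 dg] := sg s.
rewrite (partials_lin s a sf sg) re_lin im_lin; split.
- move=> u; apply: continuousD; last exact: g1.
  by apply: continuousB; apply: continuousZr; [exact: f1|exact: f2].
- move=> u; apply: continuousD; last exact: g2.
  by apply: continuousD; apply: continuousZr; [exact: f2|exact: f1].
move=> i u; have [df1 df2] := df i u; have [dg1 dg2] := dg i u.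
have dlin (x y : R) (h1 h2 h3 : plane R -> R) :
    derivable h1 u (basis_vec i) -> derivable h2 u (basis_vec i) ->
    derivable h3 u (basis_vec i) ->
    derivable (x *: h1 + y *: h2 + h3) u (basis_vec i).
  move=> d1 d2 d3.
  have d1x : derivable (x *: h1) u (basis_vec i) by exact: derivableZ.
  have d2y : derivable (y *: h2) u (basis_vec i) by exact: derivableZ.
  exact: derivableD (derivableD d1x d2y) d3.
rewrite -scaleNr; split; first exact: dlin _ _ _ _ _ df1 df2 dg1.
exact: dlin _ _ _ _ _ df2 df1 dg2.
Qed.

Lemma partials0 s : partials s (0 : plane R -> R[i]) = 0.
Proof.
elim: s => [//|i s /= ->]; apply/funext => u.
have E (h : plane R -> R) : h = cst 0 -> 'D_(basis_vec i) h u = 0.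
  by move=> ->; exact: derive_cst.
by rewrite /partial !E.
Qed.

Lemma smooth0 : smooth (0 : plane R -> R[i]).
Proof.
move=> s; rewrite partials0.
have E1 : re_part 0 = cst 0 by [].
have E2 : im_part 0 = cst 0 by [].
rewrite E1 E2; split; [exact: cst_continuous|exact: cst_continuous|].
by move=> i u; split; exact: derivable_cst.
Qed.

Lemma schwartz_submod_closed : submod_closed schwartz.
Proof.
split=> [|a f g]; rewrite !unfold_in.
  apply/asboolP; split; first exact: smooth0.
  move=> a b c d; exists 0 => _ [u _ <-].
  by rewrite /weighted_partial partials0 /cnorm ComplexField.Normc.normc0 mulr0.
move=> /asboolP[sf bf] /asboolP[sg bg]; apply/asboolP.
split; first exact: smooth_lin.
move=> k l c d; have [M fM] := bf k l c d; have [N gN] := bg k l c d.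
exists (cnorm a * M + N) => _ [u _ <-].
rewrite /weighted_partial partials_lin // !fctE.
apply: (@le_trans _ _ (cnorm a * weighted_partial k l c d f u
  + weighted_partial k l c d g u)); last first.
  apply: lerD; last by apply: gN; exists u.
  apply: ler_wpM2l; last by apply: fM; exists u.
  by rewrite /cnorm; case: (a) => x y; exact: sqrtr_ge0.
rewrite /weighted_partial mulrCA -mulrDr; apply: ler_wpM2l => //.
rewrite /cnorm -ComplexField.Normc.normcM.
exact: (@ler_normD _ (Rcomplex R)).
Qed.

HB.instance Definition _ :=
  GRing.isSubmodClosed.Build R[i] (plane R -> R[i]) schwartz
    schwartz_submod_closed.

End SchwartzFunctions.

Record schwartz_space (R : realType) := SchwartzFun {
  schwartz_fun :> plane R -> R[i];
  schwartz_funP : schwartz_fun \in schwartz }.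

Section SchwartzSpace.
Variable R : realType.
HB.instance Definition _ := [isSub for @schwartz_fun R].
HB.instance Definition _ := [Choice of schwartz_space R by <:].
HB.instance Definition _ :=
  [SubChoice_isSubLmodule of schwartz_space R by <:].
End SchwartzSpace.

Section TwistedProduct.
Context {R : realType}.
Local Notation C := R[i].
Local Notation S2 := (schwartz_space R).

(* The given function as an element of the Schwartz space.  It is only used
   below for functions that are indeed Schwartz (a twisted product of Schwartz
   functions and the conjugates of the twisted Hermite functions); the default
   value 0 only makes the operation total. *)
Definition to_schwartz (f : plane R -> C) : S2 := insubd (0 : S2) f.

Local Notation lebesgue2 := (lebesgue_measure \x lebesgue_measure)%E.

Definition cintegral (f : plane R -> C) : C :=
  (\int[lebesgue2]_(u in setT) re_part f u)
  +i* (\int[lebesgue2]_(u in setT) im_part f u).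

Definition cexpi (theta : R) : C := cos theta +i* sin theta.

(* [symp u v] is u'Jv with J = (0 1; -1 0). *)
Definition symp (u v : plane R) : R := u.1 * v.2 - u.2 * v.1.

Definition twisted_fun (f g : plane R -> C) (u : plane R) : C :=
  (4 * pi ^+ 2)^-1%:C *
  cintegral (fun v => cintegral (fun w =>
    f v * g w * cexpi (symp u v + symp v w + symp w u))).

Definition twisted (f g : S2) : S2 := to_schwartz (twisted_fun f g).

Definition tempered_distribution (T : S2 -> C) :=
  (forall (a : C) (f g : S2), T (a *: f + g) = a * T f + T g) /\
  exists (N : nat) (K : R), forall f : S2,
    cnorm (T f) <=
      K * \sum_(a < N) \sum_(b < N) \sum_(c < N) \sum_(d < N)
            seminorm a b c d f.

Definition embed (g : S2) : S2 -> C :=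
  fun h => (2 * pi)^-1%:C * cintegral (fun u => g u * h u).

Definition in_schwartz (T : S2 -> C) := exists g : S2, T = embed g.

Definition dist_twisted (T : S2 -> C) (f : S2) : S2 -> C :=
  fun h => T (twisted f h).

Definition twisted_dist (f : S2) (T : S2 -> C) : S2 -> C :=
  fun h => T (twisted h f).

Definition left_multipliers : set (S2 -> C) :=
  [set T | tempered_distribution T /\ forall f, in_schwartz (dist_twisted T f)].

Definition right_multipliers : set (S2 -> C) :=
  [set T | tempered_distribution T /\ forall f, in_schwartz (twisted_dist f T)].

(* L_n^k for a natural number k. *)
Definition laguerre (n k : nat) (x : R) : R :=
  \sum_(i < n.+1) (-1) ^+ i * 'C(n + k, n - i)%:R / i`!%:R * x ^+ i.

(* f_{mn} for n <= m. *)
Definition hermite_lower (m n : nat) (u : plane R) : C :=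
  (2 * (-1) ^+ n * Num.sqrt (n`!%:R / m`!%:R))%:C
  * (u.1 -i* u.2) ^+ (m - n)
  * (laguerre n (m - n) (u.1 ^+ 2 + u.2 ^+ 2)
     * expR (- ((u.1 ^+ 2 + u.2 ^+ 2) / 2)))%:C.

Definition twisted_hermite (m n : nat) (u : plane R) : C :=
  if (n <= m)%N then hermite_lower m n u else (hermite_lower n m u)^*.

Definition hermite_coef (T : S2 -> C) (m n : nat) : C :=
  2^-1 * T (to_schwartz (fun u => (twisted_hermite m n u)^*)).

(* The completion of the Schwartz space in the norm |.|_{st}, realized inside
   the tempered distributions through the expansion in twisted Hermite
   functions. *)
Definition G_space (s t : R) : set (S2 -> C) :=
  [set T | tempered_distribution T /\
    (\esum_(k in [set: nat * nat])
      ((2 * k.1%:R + 1) `^ s * (2 * k.2%:R + 1) `^ t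
       * cnorm (hermite_coef T k.1 k.2) ^+ 2)%:E < +oo)%E].

End TwistedProduct.

Arguments left_multipliers R : clear implicits.
Arguments right_multipliers R : clear implicits.

(* Main.v *)
(* In the twisted Hermite basis the twisted product is matrix multiplication,
   Schwartz functions are exactly the rapidly decreasing matrices, and tempered
   distributions have polynomially bounded matrices.  Hence T with matrix c is a
   left multiplier iff c a is rapidly decreasing for every rapidly decreasing a,
   and membership in the intersection of the unions of the G_{s,t} says that for
   each k some power of n+1 bounds (m+1)^k |c_mn|.  The latter clearly implies
   the former; conversely, if it fails for some k, a gliding hump produces a
   rapidly decreasing column vector y for which c y is not rapidly decreasing.
   The right-hand case is the same statement for the transposed matrix.

   For the dictionary, the ladder relations satisfied by the f_mn (their
   products with q and p and their partial derivatives) reduce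
   f_mn x f_kl = delta_nk f_ml to f_00 x f_00 = f_00, a Gaussian integral, and
   bound all Schwartz seminorms of f_mn polynomially.  A Schwartz function
   orthogonal to all f_mn is orthogonal to polynomials times the Gaussian f_00,
   hence to arbitrarily narrow Gaussians around any point, so it vanishes. *)
From mathcomp Require Import all_boot all_order all_algebra.
From mathcomp Require Import complex ring lra zify.
From mathcomp Require Import all_classical all_reals all_analysis measurable_realfun.
Require Import Defs.

Set Implicit Arguments.
Unset Strict Implicit.
Unset Printing Implicit Defensive.

Import Order.TTheory GRing.Theory Num.Theory.
Import numFieldNormedType.Exports.

Local Open Scope classical_set_scope.
Local Open Scope ring_scope.
Local Open Scope complex_scope.

(** * Complex numbers and series *)

(** The distributions T x f and f x T are defined through [to_schwartz] of a twisted product, so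
    nothing can be said about them before f x g is known to be a Schwartz function. This is drawn
    from the matrix picture, not from the integral: at a fixed point u the value (f x g)(u) is
    continuous in each factor, so both factors may be expanded, and the product formula turns the
    value into a Hermite series whose matrix ab is again rapidly decreasing. The polynomial bounds
    behind such series start from one sup bound on f_mn, obtained from f_mn = f_m0 x f_0n and an
    elementary estimate of twisted products by weighted sup norms; only the monomial case n = 0 is
    estimated by hand. All limits carry explicit errors: quadratic Taylor remainders for
    differentiation of integrals and series, and domination by (m+1)^-2 (n+1)^-2 for sums. In the
    converse half each single column of c is automatically under control, by testing on unit
    vectors; only a polynomial dependence on n can fail, and the hump vector is supported on columns
    where it does. *)

Section ComplexModulus.
Context {R : realType}.
Implicit Types (z w : R[i]) (a : R).

Lemma cnorm_ge0 z : 0 <= cnorm z.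
Proof. by case: z => a b; exact: sqrtr_ge0. Qed.

Lemma cnormD z w : cnorm (z + w) <= cnorm z + cnorm w.
Proof. exact: (@ler_normD _ (Rcomplex R)). Qed.

Lemma cnormM z w : cnorm (z * w) = cnorm z * cnorm w.
Proof. exact: ComplexField.Normc.normcM. Qed.

Lemma cnormN z : cnorm (- z) = cnorm z.
Proof. exact: (@normrN _ (Rcomplex R)). Qed.

Lemma cnormB z w : cnorm (z - w) <= cnorm z + cnorm w.
Proof. by rewrite -(cnormN w) cnormD. Qed.

Lemma cnorm0 : cnorm (0 : R[i]) = 0.
Proof. exact: ComplexField.Normc.normc0. Qed.

Lemma cnorm1 : cnorm (1 : R[i]) = 1.
Proof. exact: ComplexField.Normc.normc1. Qed.

Lemma cnorm_eq0 z : cnorm z = 0 -> z = 0.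
Proof. exact: ComplexField.Normc.eq0_normc. Qed.

Lemma cnormV z : cnorm z^-1 = (cnorm z)^-1.
Proof. exact: ComplexField.Normc.normcV. Qed.

Lemma cnormX z n : cnorm (z ^+ n) = cnorm z ^+ n.
Proof. by elim: n => [|n IH]; rewrite ?cnorm1// !exprS cnormM IH. Qed.

Lemma cnormR a : cnorm a%:C = `|a|.
Proof. by rewrite /cnorm /= expr0n /= addr0 sqrtr_sqr. Qed.

Lemma cnorm_nat n : cnorm (n%:R : R[i]) = n%:R.
Proof. by rewrite -(rmorph_nat (real_complex R)) cnormR normr_nat. Qed.

Lemma cnormC z : cnorm z^* = cnorm z.
Proof. by case: z => a b; rewrite /cnorm /= sqrrN. Qed.

Lemma cnorm_Re z : `|complex.Re z| <= cnorm z.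
Proof.
by case: z => a b; rewrite -sqrtr_sqr /= ler_wsqrtr// lerDl sqr_ge0.
Qed.

Lemma cnorm_Im z : `|complex.Im z| <= cnorm z.
Proof.
by case: z => a b; rewrite -sqrtr_sqr /= ler_wsqrtr// lerDr sqr_ge0.
Qed.

Lemma cnorm_i a : cnorm (0 +i* a) = `|a|.
Proof. by rewrite /cnorm /= expr0n add0r sqrtr_sqr. Qed.

Lemma cReM z w : complex.Re (z * w) =
  complex.Re z * complex.Re w - complex.Im z * complex.Im w.
Proof. by case: z w => [a b] [c d]. Qed.

Lemma cImM z w : complex.Im (z * w) =
  complex.Re z * complex.Im w + complex.Im z * complex.Re w.
Proof. by case: z w => [a b] [c d]. Qed.

Lemma cReD z w : complex.Re (z + w) = complex.Re z + complex.Re w.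
Proof. by case: z w => [a b] [c d]. Qed.

Lemma cImD z w : complex.Im (z + w) = complex.Im z + complex.Im w.
Proof. by case: z w => [a b] [c d]. Qed.

Lemma cReN z : complex.Re (- z) = - complex.Re z.
Proof. by case: z. Qed.

Lemma cImN z : complex.Im (- z) = - complex.Im z.
Proof. by case: z. Qed.

Lemma cReB z w : complex.Re (z - w) = complex.Re z - complex.Re w.
Proof. by rewrite cReD cReN. Qed.

Lemma cImB z w : complex.Im (z - w) = complex.Im z - complex.Im w.
Proof. by rewrite cImD cImN. Qed.

Lemma complexP z w : complex.Re z = complex.Re w ->
  complex.Im z = complex.Im w -> z = w.
Proof. by case: z w => [a b] [c d] /= -> ->. Qed.

Lemma cnorm_ReIm z : cnorm z <= `|complex.Re z| + `|complex.Im z|.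
Proof.
have {1}-> : z = (complex.Re z)%:C + (0 +i* complex.Im z).
  by apply/eqP; rewrite eq_complex cReD cImD /= addr0 add0r !eqxx.
by rewrite (le_trans (cnormD _ _))// cnormR cnorm_i.
Qed.

Lemma cnorm_sum (I : Type) (r : seq I) (P : pred I) (F : I -> R[i]) :
  cnorm (\sum_(i <- r | P i) F i) <= \sum_(i <- r | P i) cnorm (F i).
Proof.
elim/big_rec2 : _ => [|i x y _ H]; first by rewrite cnorm0.
by rewrite (le_trans (cnormD _ _))// lerD2l.
Qed.

Lemma cnorm_cexpi a : cnorm (cexpi a) = 1.
Proof. by rewrite /cnorm /cexpi /= cos2Dsin2 sqrtr1. Qed.

Lemma cexpiD a b : cexpi (a + b) = cexpi a * cexpi b :> R[i].
Proof.
by apply/eqP; rewrite eq_complex /= cosD sinD eqxx /= addrC.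
Qed.

Lemma cexpi0 : cexpi 0 = 1 :> R[i].
Proof. by rewrite /cexpi cos0 sin0. Qed.

Lemma rcM a b : (a * b)%:C = a%:C * b%:C :> R[i].
Proof. exact: rmorphM. Qed.

Lemma rcD a b : (a + b)%:C = a%:C + b%:C :> R[i].
Proof. exact: rmorphD. Qed.

Lemma rcN a : (- a)%:C = - a%:C :> R[i].
Proof. exact: rmorphN. Qed.

Lemma rcX a n : (a ^+ n)%:C = a%:C ^+ n :> R[i].
Proof. exact: rmorphXn. Qed.

Lemma rc_nat n : (n%:R)%:C = n%:R :> R[i].
Proof. exact: rmorph_nat. Qed.

Lemma rc_sum (I : Type) (r : seq I) (F : I -> R) :
  (\sum_(i <- r) F i)%:C = \sum_(i <- r) (F i)%:C :> R[i].
Proof. exact: rmorph_sum. Qed.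

End ComplexModulus.

(* Limits are handled through the explicit rate 1/(N+1); every series below
   converges at least that fast. *)
Section RatedLimits.
Context {R : realType}.
Implicit Types (s : nat -> R[i]) (z w : R[i]).

Definition clim s z := exists K : R, forall N, cnorm (z - s N) <= K / N.+1%:R.

Lemma le0_of_rate (x K : R) : (forall N, x <= K / N.+1%:R) -> x <= 0.
Proof.
move=> H; rewrite leNgt; apply/negP => x0.
have K0 : 0 < K by rewrite -(divr1 K); exact: lt_le_trans x0 (H 0%N).
have := archi_boundP (ltW (divr_gt0 K0 x0)); set n := Num.bound _ => nP.
have := H n; rewrite ler_pdivlMr// leNgt => /negP; apply.
by rewrite -ltr_pdivrMl// mulrC (lt_trans nP)// ltr_nat.
Qed.

Lemma clim_le s z K (B : R) : (forall N, cnorm (s N) <= B + K / N.+1%:R) ->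
  clim s z -> cnorm z <= B.
Proof.
move=> H [K' zs]; rewrite -subr_le0; apply: (@le0_of_rate _ (K + K')) => N.
have -> : z = (z - s N) + s N by rewrite subrK.
have := cnormD (z - s N) (s N); have := H N; have := zs N.
by set i := _.+1%:R^-1 => h1 h2 h3; rewrite lerBlDr; lra.
Qed.

Lemma clim_unique s z w : clim s z -> clim s w -> z = w.
Proof.
move=> [K sz] [K' sw]; apply/eqP; rewrite -subr_eq0; apply/eqP/cnorm_eq0.
apply/eqP; rewrite eq_le cnorm_ge0 andbT.
apply: (@le0_of_rate _ (K + K')) => N.
have -> : z - w = (z - s N) - (w - s N) by rewrite opprB addrA subrK.
rewrite mulrDl (le_trans (cnormB _ _))// lerD//.
Qed.

Lemma climD s s' z z' : clim s z -> clim s' z' ->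
  clim (fun N => s N + s' N) (z + z').
Proof.
move=> [K sz] [K' sz']; exists (K + K') => N.
by rewrite opprD addrACA mulrDl (le_trans (cnormD _ _))// lerD.
Qed.

Lemma climZ s z w : clim s z -> clim (fun N => w * s N) (w * z).
Proof.
move=> [K sz]; exists (cnorm w * K) => N.
by rewrite -mulrBr cnormM -mulrA ler_wpM2l// cnorm_ge0.
Qed.

Lemma clim_cst z : clim (fun=> z) z.
Proof. by exists 0 => N; rewrite subrr cnorm0 mul0r. Qed.

Lemma eq_clim s s' z : s =1 s' -> clim s z -> clim s' z.
Proof. by move=> /funext ->. Qed.

Lemma clim_sub s s' z K : (forall N, cnorm (s N - s' N) <= K / N.+1%:R) ->
  clim s z -> clim s' z.
Proof.
move=> H [K' sz]; exists (K + K') => N.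
have -> : z - s' N = (s N - s' N) + (z - s N) by ring.
by rewrite mulrDl (le_trans (cnormD _ _))// lerD.
Qed.

(** The limit is the supremum of the lower bounds [s N - K / N.+1%:R]. Each of them lies below every
    upper bound [s M + K / M.+1%:R], which gives existence and the rate at once. *)
Lemma rcvg_rate (s : nat -> R) (K : R) :
  (forall N M, (N <= M)%N -> `|s M - s N| <= K / N.+1%:R) ->
  exists l : R, forall N, `|l - s N| <= K / N.+1%:R.
Proof.
move=> H.
have lo N M : s N - K / N.+1%:R <= s M + K / M.+1%:R.
  have [NM|/ltnW MN] := leqP N M.
    have := H _ _ NM; rewrite ler_norml => /andP[+ _].
    have : 0 <= K / M.+1%:R by apply: le_trans (H M M _).
    set i := _^-1; set j := _^-1 => h1 h2; lra.
  have := H _ _ MN; rewrite ler_norml => /andP[_].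
  have : 0 <= K / N.+1%:R by apply: le_trans (H N N _).
  set i := _^-1; set j := _^-1 => h1 h2; lra.
pose A := [set s N - K / N.+1%:R | N in [set: nat]].
have A0 : A !=set0 by exists (s 0%N - K / 1%:R); exists 0%N.
exists (sup A) => N; rewrite ler_norml; apply/andP; split.
  rewrite lerBrDl; apply: ub_le_sup; last by exists N.
  by exists (s 0%N + K / 1%:R) => _ [M _ <-]; exact: lo.
by rewrite lerBlDl; apply: ge_sup => // _ [M _ <-]; exact: lo.
Qed.

Lemma clim_exists s (K : R) :
  (forall N M, (N <= M)%N -> cnorm (s M - s N) <= K / N.+1%:R) ->
  exists2 z, clim s z & forall N, cnorm (z - s N) <= (K + K) / N.+1%:R.
Proof.
move=> H.
have [x xP] : exists l : R, forall N, `|l - complex.Re (s N)| <= K / N.+1%:R.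
  apply: rcvg_rate => N M NM; apply: le_trans (H _ _ NM).
  by rewrite -raddfB cnorm_Re.
have [y yP] : exists l : R, forall N, `|l - complex.Im (s N)| <= K / N.+1%:R.
  apply: rcvg_rate => N M NM; apply: le_trans (H _ _ NM).
  by rewrite -raddfB cnorm_Im.
have B N : cnorm (x +i* y - s N) <= (K + K) / N.+1%:R.
  rewrite mulrDl (le_trans (cnorm_ReIm _))// lerD// ?cReB ?cImB; [exact: xP|exact: yP].
by exists (x +i* y) => //; exists (K + K).
Qed.

End RatedLimits.

(** * Double series dominated by inverse squares *)

Section BoxSums.
Context {R : realType}.
Implicit Types (x : nat -> nat -> R[i]).

(** Standard majorant of the series below: its tails are at most [2 / N.+1%:R], the rate that [clim]
    asks for, and its full sum is at most 2, the source of most factors 2 and 4 in later bounds. *)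
Definition wt (n : nat) : R := (n.+1%:R ^+ 2)^-1.

Lemma wt_ge0 n : 0 <= wt n.
Proof. by rewrite invr_ge0 exprn_ge0. Qed.

Lemma wt_tail N M : (N <= M)%N -> \sum_(N <= i < M) wt i <= 2 / N.+1%:R.
Proof.
(* Comparison with a telescoping sum: 1/(M+1)^2 is at most 2/(M+1) - 2/(M+2). *)
move=> NM; suff : \sum_(N <= i < M) wt i <= 2 / N.+1%:R - 2 / M.+1%:R.
  by move/le_trans; apply; rewrite gerBl divr_ge0.
elim: M NM => [|M IH]; first by rewrite leqn0 => /eqP ->; rewrite big_geq// subrr.
rewrite leq_eqVlt => /orP[/eqP ->|]; first by rewrite big_geq// subrr.
rewrite ltnS => NM; rewrite big_nat_recr//=.
have := IH NM; set S := \sum_(_ <= _ < _) _; move=> H.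
have -> : 2 / N.+1%:R - 2 / M.+2%:R = (2 / N.+1%:R - 2 / M.+1%:R) + (2 / M.+1%:R - 2 / M.+2%:R) :> R by ring.
rewrite lerD// /wt.
have h : (0 : R) < M.+1%:R by [].
have h2 : (0 : R) < M.+2%:R by [].
have h3 : (M.+2%:R : R) = M.+1%:R + 1 by rewrite -natr1.
have -> : 2 / M.+1%:R - 2 / M.+2%:R = 2 / (M.+1%:R * M.+2%:R) :> R.
  by rewrite h3; field; rewrite -?h3 !gt_eqF.
rewrite -[leLHS]mul1r ler_pdivrMr ?exprn_gt0// mulrAC ler_pdivlMr ?mulr_gt0//.
have h4 : (1 : R) <= M.+1%:R by rewrite ler1n.
rewrite h3; nra.
Qed.

Lemma wt_sum M : \sum_(i < M) wt i <= 2.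
Proof. by rewrite -(big_mkord predT) (le_trans (wt_tail _))// divr1. Qed.

Definition boxsum x N : R[i] := \sum_(m < N) \sum_(n < N) x m n.

Lemma boxsum_shell x K N M : (N <= M)%N ->
  (forall m n, cnorm (x m n) <= K * wt m * wt n) ->
  cnorm (boxsum x M - boxsum x N) <= 8 * K / N.+1%:R.
Proof.
move=> NM xK.
have K0 : 0 <= K.
  have := le_trans (cnorm_ge0 _) (xK 0%N 0%N).
  by rewrite /wt expr1n invr1 !mulr1.
have -> : boxsum x N = \sum_(m < M) \sum_(n < M)
    (if (m < N)%N && (n < N)%N then x m n else 0).
  rewrite /boxsum (big_ord_widen M (fun m => \sum_(n < N) x m n) NM) big_mkcond.
  apply: eq_bigr => m _; case: ifP => mN /=; last by rewrite big1.
  by rewrite (big_ord_widen M (x m) NM) big_mkcond.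
rewrite -sumrB; under eq_bigr do rewrite -sumrB.
(* An index pair outside the smaller box has m or n at least N. Each case gives K times a tail times
   a full sum, at most 4 K / (N+1); the two cases add up to the factor 8. *)
apply: (@le_trans _ _ (\sum_(m < M) \sum_(n < M)
  (K * ((N <= m)%N%:R * wt m) * wt n + K * wt m * ((N <= n)%N%:R * wt n)))).
  rewrite (le_trans (cnorm_sum _ _ _))// ler_sum// => m _.
  rewrite (le_trans (cnorm_sum _ _ _))// ler_sum// => n _.
  have p1 := mulr_ge0 (mulr_ge0 K0 (wt_ge0 m)) (wt_ge0 n).
  have := xK m n; rewrite !(leqNgt N).
  case: (ltnP m N) => mN; case: (ltnP n N) => nN /=; rewrite ?subrr ?subr0 ?cnorm0 ?mul0r ?mulr0 ?mul1r ?addr0 ?add0r ?mul0r// => h; lra.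
under eq_bigr do rewrite big_split /=.
rewrite big_split /=.
under eq_bigr do rewrite -mulr_sumr.
under [X in _ + X]eq_bigr do rewrite -mulr_sumr.
rewrite -!mulr_suml -!mulr_sumr.
have -> : \sum_(i < M) (N <= i)%N%:R * wt i = \sum_(N <= i < M) wt i.
  rewrite (@big_nat_widenl _ _ _ N 0)// big_mkord [RHS]big_mkcond.
  by apply: eq_bigr => i _; case: (N <= i)%N; rewrite ?mul1r ?mul0r.
have h1 := wt_tail NM; have h2 := wt_sum M.
have h3 : 0 <= \sum_(N <= i < M) wt i by apply: sumr_ge0 => i _; exact: wt_ge0.
have h4 : 0 <= \sum_(i < M) wt i by apply: sumr_ge0 => i _; exact: wt_ge0.
move: h1 h2 h3 h4; set a := \sum_(_ <= _ < _) _; set b := \sum_(_ < _) _.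
set c := 2 / _ => h1 h2 h3 h4.
have -> : 8 * K / N.+1%:R = 4 * (K * c) by rewrite /c; ring.
have : a * b <= c * 2 by exact: ler_pM.
move=> /(ler_wpM2l K0) h5; lra.
Qed.

Lemma boxsum_clim x K : (forall m n, cnorm (x m n) <= K * wt m * wt n) ->
  exists2 z, clim (boxsum x) z &
    forall N, cnorm (z - boxsum x N) <= (8 * K + 8 * K) / N.+1%:R.
Proof.
by move=> H; apply: clim_exists => N M NM; exact: boxsum_shell.
Qed.

Lemma sum_clim (x : nat -> R[i]) K : (forall n, cnorm (x n) <= K * wt n) ->
  exists2 z, clim (fun N => \sum_(n < N) x n) z &
    forall N, cnorm (z - \sum_(n < N) x n) <= (2 * K + 2 * K) / N.+1%:R.
Proof.
move=> H; apply: clim_exists => N M NM.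
have K0 : 0 <= K.
  by have := le_trans (cnorm_ge0 _) (H 0%N); rewrite /wt expr1n invr1 !mulr1.
rewrite -!(big_mkord xpredT) (big_cat_nat (leq0n N) NM) addrAC subrr add0r.
rewrite (le_trans (cnorm_sum _ _ _))//.
apply: (@le_trans _ _ (\sum_(N <= i < M) K * wt i)); first exact: ler_sum.
by rewrite -mulr_sumr (mulrC 2) -mulrA ler_wpM2l// wt_tail.
Qed.

End BoxSums.

(** * Calculus and integration on the plane *)

Section PlaneCalculus.
Context {R : realType}.
Implicit Types (f g : plane R -> R) (u v : plane R) (i : bool).

Definition rder i f g := forall u, is_derive u (basis_vec i) f (g u).

Lemma rderD i f1 f2 g1 g2 : rder i f1 g1 -> rder i f2 g2 ->
  rder i (fun u => f1 u + f2 u) (fun u => g1 u + g2 u).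
Proof. by move=> d1 d2 u; exact: is_deriveD (d1 u) (d2 u). Qed.

Lemma rderB i f1 f2 g1 g2 : rder i f1 g1 -> rder i f2 g2 ->
  rder i (fun u => f1 u - f2 u) (fun u => g1 u - g2 u).
Proof. by move=> d1 d2 u; exact: is_deriveB (d1 u) (d2 u). Qed.

Lemma rderN i f g : rder i f g -> rder i (fun u => - f u) (fun u => - g u).
Proof. by move=> d u; exact: is_deriveN (d u). Qed.

Lemma rder_cst i (c : R) : rder i (fun=> c) (fun=> 0).
Proof. by move=> u; exact: is_derive_cst. Qed.

Lemma rderM i f1 f2 g1 g2 : rder i f1 g1 -> rder i f2 g2 ->
  rder i (fun u => f1 u * f2 u) (fun u => g1 u * f2 u + f1 u * g2 u).
Proof.
move=> d1 d2 u; have := is_deriveM (d1 u) (d2 u).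
by rewrite addrC [f2 u *: _]mulrC.
Qed.

Lemma rder_ext i f g g' : g =1 g' -> rder i f g -> rder i f g'.
Proof. by move=> /funext ->. Qed.

(** Identifies the directional difference quotient with a one-variable one, so that the mean value
    theorem on the line applies along coordinate directions. *)
Lemma line_quotient i f u (t : R) :
  (fun h : R => h^-1 *: (((fun t => f (u + t *: basis_vec i)) \o shift t) (h *: 1)
    - f (u + t *: basis_vec i))) =
  (fun h : R => h^-1 *: ((f \o shift (u + t *: basis_vec i)) (h *: basis_vec i)
    - f (u + t *: basis_vec i))).
Proof.
apply/funext => h /=; congr (_ *: (f _ - _)).
by rewrite scalerDl addrCA /GRing.scale/= mulr1.
Qed.

Lemma is_derive_line i f u (t d : R) :
  is_derive (u + t *: basis_vec i) (basis_vec i) f d <->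
  is_derive t 1 (fun t => f (u + t *: basis_vec i)) d.
Proof.
split=> -[d1 d2]; split.
- by rewrite /derivable line_quotient.
- by rewrite /derive line_quotient.
- by move: d1; rewrite /derivable line_quotient.
- by move: d2; rewrite /derive line_quotient.
Qed.

Lemma rder_line i f g u (t : R) : rder i f g ->
  is_derive t 1 (fun t => f (u + t *: basis_vec i)) (g (u + t *: basis_vec i)).
Proof. by move=> d; apply/is_derive_line. Qed.

Lemma is_derive_continuous (f : R -> R) (x d : R) : is_derive x 1 f d ->
  {for x, continuous f}.
Proof. by case=> /derivable1_diffP /differentiable_continuous. Qed.

Lemma mvt_line i f g u (h : R) : rder i f g ->
  exists2 t, `|t| <= `|h| &
  f (u + h *: basis_vec i) - f u = h * g (u + t *: basis_vec i).
Proof.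
move=> d.
have cont a b : {within `[a, b], continuous (fun t => f (u + t *: basis_vec i))}.
  apply: continuous_subspaceT => x.
  exact: is_derive_continuous (rder_line u x d).
have E0 : f u = (fun t => f (u + t *: basis_vec i)) 0 by rewrite /= scale0r addr0.
have [h0|h0|->] := ltgtP h 0; last by exists 0 => //; rewrite scale0r addr0 subrr mul0r.
- have [c + e] := MVT h0 (fun x _ => rder_line u x d) (cont h 0).
  rewrite in_itv/= => /andP[hc c0]; exists c.
    by rewrite !ltr0_norm// lerN2 ltW.
  by rewrite E0 -[LHS]opprB e sub0r mulrN opprK mulrC.
- have [c + e] := MVT h0 (fun x _ => rder_line u x d) (cont 0 h).
  rewrite in_itv/= => /andP[hc c0]; exists c; first by rewrite !gtr0_norm// ltW.
  by rewrite E0 e subr0 mulrC.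
Qed.

Lemma lipschitz_line i f g (M : R) u (h : R) : rder i f g ->
  (forall v, `|g v| <= M) -> `|f (u + h *: basis_vec i) - f u| <= M * `|h|.
Proof.
by move=> d gM; have [t _ ->] := mvt_line u h d; rewrite normrM mulrC ler_wpM2r.
Qed.

Lemma taylor_line i f g k (M : R) u (h : R) : rder i f g -> rder i g k ->
  (forall v, `|k v| <= M) ->
  `|f (u + h *: basis_vec i) - f u - h * g u| <= M * `|h| ^+ 2.
Proof.
move=> d1 d2 kM; have [t th ->] := mvt_line u h d1.
rewrite -mulrBr normrM expr2 mulrA mulrC ler_wpM2r//.
rewrite (le_trans (lipschitz_line u t d2 kM))// ler_wpM2l//.
exact: le_trans (kM u).
Qed.

(** A quadratic remainder determines the derivative. Differentiation under an integral sign and term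
    by term both end here, once Taylor remainders have been integrated or summed. *)
Lemma is_derive_quad i f u (d M : R) :
  (forall h : R, `|h| <= 1 ->
    `|f (u + h *: basis_vec i) - f u - h * d| <= M * `|h| ^+ 2) ->
  is_derive u (basis_vec i) f d.
Proof.
move=> H.
suff : (fun h : R => h^-1 *: ((f \o shift u) (h *: basis_vec i) - f u)) @ 0^' --> d.
  by move=> c; split; [apply/cvg_ex; exists d|exact: cvg_lim].
have M0 : 0 <= M by have := H 1; rewrite normr1 expr1n mulr1 => /(_ (lexx _)); exact: le_trans.
apply/cvgrPdist_le => e e0.
have e1 : 0 < e / (M + 1) by rewrite divr_gt0// ltr_wpDl.
near=> h => /=.
have h0 : h != 0 by near: h; exact: nbhs_dnbhs_neq.
have hn : 0 < `|h| by rewrite normr_gt0.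
have h1 : `|h| <= 1.
  by near: h; apply: dnbhs0_le.
have he : `|h| <= e / (M + 1).
  by near: h; apply: dnbhs0_le.
have -> : d - h^-1 *: (f (h *: basis_vec i + u) - f u) =
   - (h^-1 * (f (u + h *: basis_vec i) - f u - h * d)).
  by rewrite (addrC u) /GRing.scale/=; field.
rewrite normrN normrM normfV mulrC ler_pdivrMr// (le_trans (H _ h1))//.
rewrite expr2 mulrA ler_wpM2r//.
move: he; rewrite ler_pdivlMr ?ltr_wpDl// => he.
by rewrite (le_trans _ he)// mulrC ler_wpM2l// lerDl.
Unshelve. all: by end_near. Qed.

Lemma plane_split u v : v = u + (v.1 - u.1) *: basis_vec false + (v.2 - u.2) *: basis_vec true.
Proof.
by case: u v => [a b] [c d]; apply/pair_equal_spec; rewrite /= /GRing.scale/= !(mulr0,mulr1,addr0); split; ring.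
Qed.

Lemma rder_lipschitz f g0 g1 (M : R) : rder false f g0 -> rder true f g1 ->
  (forall u, `|g0 u| <= M) -> (forall u, `|g1 u| <= M) ->
  forall u v, `|f v - f u| <= M * (`|v.1 - u.1| + `|v.2 - u.2|).
Proof.
move=> d0 d1 M0 M1 u v; rewrite [in f v](plane_split u v).
set w := u + _.
rewrite -[_ - f u](subrKA (f w)) mulrDr (le_trans (ler_normD _ _))//.
rewrite addrC lerD//; first exact: lipschitz_line d0 M0.
exact: lipschitz_line d1 M1.
Qed.

Lemma lipschitz_continuous f (M : R) :
  (forall u v, `|f v - f u| <= M * (`|v.1 - u.1| + `|v.2 - u.2|)) -> continuous f.
Proof.
move=> H u; apply/cvgrPdist_le => e e0.
have N0 : 0 < `|M| + 1 by rewrite ltr_wpDl.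
have d0 : 0 < e / (2 * (`|M| + 1)) by rewrite divr_gt0// mulr_gt0.
set r := e / _ in d0 *.
exists (ball u.1 r, ball u.2 r) => [|v [] /=].
  by split; apply: nbhsx_ballx.
rewrite /ball/= => h1 h2; rewrite distrC in h1; rewrite distrC in h2.
rewrite distrC.
rewrite (le_trans (H u v))//.
apply: (@le_trans _ _ ((`|M| + 1) * (`|v.1 - u.1| + `|v.2 - u.2|))).
  rewrite ler_wpM2r ?addr_ge0//; have := ler_norm M; lra.
rewrite mulrC -ler_pdivlMr//.
have -> : e / (`|M| + 1) = r + r.
  by rewrite /r; field; rewrite gt_eqF.
by rewrite lerD// ltW.
Qed.

Lemma rder0_cst f : rder false f (fun=> 0) -> rder true f (fun=> 0) ->
  forall u v, f u = f v.
Proof.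
move=> d0 d1 u v; apply/eqP; rewrite -subr_eq0 -normr_le0.
by rewrite (le_trans (rder_lipschitz (M := 0) d0 d1 _ _ v u)) ?mul0r// => w; rewrite normr0.
Qed.

Lemma rder_shift i f g w : rder i f g ->
  rder i (fun v => f (v + w)) (fun v => g (v + w)).
Proof.
move=> d v; have [d1 d2] := d (v + w).
have E : (fun h : R => h^-1 *: (((fun v => f (v + w)) \o shift v) (h *: basis_vec i)
    - f (v + w))) =
  (fun h : R => h^-1 *: ((f \o shift (v + w)) (h *: basis_vec i) - f (v + w))).
  by apply/funext => h /=; rewrite addrA.
by split; [rewrite /derivable E|rewrite /derive E].
Qed.

Lemma continuous_plane f u (e : R) : {for u, continuous f} -> 0 < e ->
  exists2 d, 0 < d & forall v, `|v.1 - u.1| < d -> `|v.2 - u.2| < d ->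
    `|f v - f u| < e.
Proof.
move=> /cvgrPdist_lt fc e0; have [[A B] /= [/nbhs_ballP[r1 /= r10 H1] /nbhs_ballP[r2 /= r20 H2]] H] := fc e e0.
exists (Num.min r1 r2); first by rewrite lt_min r10 r20.
move=> v; rewrite !lt_min => /andP[v1 _] /andP[_ v2]; rewrite distrC.
by apply: H; split=> /=; [apply: H1|apply: H2]; rewrite /ball/= distrC.
Qed.

Lemma continuous_plane_line f u (e : R) : {for u, continuous f} -> 0 < e ->
  exists2 d, 0 < d & forall s t, `|s| < d -> `|t| < d ->
    `|f (u + s *: basis_vec false + t *: basis_vec true) - f u| < e.
Proof.
move=> fc /(continuous_plane fc)[d d0 H]; exists d => // s t sd td.
case: u H {fc} => a b /= H; apply: H => /=; rewrite /GRing.scale/= !(mulr0, mulr1, addr0).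
  by rewrite addrAC subrr add0r.
by rewrite addrAC subrr add0r.
Qed.

(* Clairaut's theorem: both mixed partials are limits of the same second
   difference quotient. *)
Lemma rder_comm f f0 f1 f01 f10 : rder false f f0 -> rder true f f1 ->
  rder true f0 f01 -> rder false f1 f10 ->
  continuous f01 -> continuous f10 -> f01 = f10.
Proof.
move=> d0 d1 d01 d10 c01 c10; apply/funext => u.
pose e0 : plane R := basis_vec false; pose e1 : plane R := basis_vec true.
pose D h := f (u + h *: e0 + h *: e1) - f (u + h *: e0) - (f (u + h *: e1) - f u).
have A (h : R) : exists s t, [/\ `|s| <= `|h|, `|t| <= `|h| &
    D h = h * h * f01 (u + s *: e0 + t *: e1)].
  have dF := rderB (rder_shift (h *: e1) d0) d0.
  have [s sh es] := mvt_line u h dF.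
  have [t th et] := mvt_line (u + s *: e0) h d01.
  by exists s, t; split=> //; rewrite /D -mulrA -et -es.
have B (h : R) : exists s t, [/\ `|s| <= `|h|, `|t| <= `|h| &
    D h = h * h * f10 (u + s *: e0 + t *: e1)].
  have dF := rderB (rder_shift (h *: e0) d1) d1.
  have [t th et] := mvt_line u h dF.
  have [s sh es] := mvt_line (u + t *: e1) h d10.
  exists s, t; split=> //; rewrite [u + _ + _]addrAC -mulrA -es -et /D.
  by rewrite [u + h *: e1 + _]addrAC; ring.
apply/eqP; rewrite -subr_eq0 -normr_le0 leNgt; apply/negP => dif.
set e := `|_| in dif; have e2 : 0 < e / 2 by rewrite divr_gt0.
have [r1 r10 H1] := continuous_plane_line (c01 u) e2.
have [r2 r20 H2] := continuous_plane_line (c10 u) e2.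
pose h := Num.min r1 r2 / 2.
have m0 : 0 < Num.min r1 r2 by rewrite lt_min r10 r20.
have h0 : 0 < h by rewrite divr_gt0.
have [hr1 hr2] : h < r1 /\ h < r2.
  by apply/andP; rewrite -lt_min /h; set m := Num.min _ _ in m0 *; lra.
have [s [t [sh th E1]]] := A h.
have [s' [t' [sh' th' E2]]] := B h.
move: sh th sh' th'; rewrite (gtr0_norm h0) => sh th sh' th'.
have K1 := H1 _ _ (le_lt_trans sh hr1) (le_lt_trans th hr1).
have K2 := H2 _ _ (le_lt_trans sh' hr2) (le_lt_trans th' hr2).
have E : f01 (u + s *: e0 + t *: e1) = f10 (u + s' *: e0 + t' *: e1).
  have hh : h * h != 0 by rewrite mulf_neq0 ?gt_eqF.
  by apply: (mulfI hh); rewrite -E1 -E2.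
have : e < e / 2 + e / 2.
  apply: le_lt_trans (ltrD K1 K2).
  rewrite /e -(subrKA (f01 (u + s *: e0 + t *: e1))) {2}E.
  by rewrite (le_trans (ler_normD _ _))// lerD// distrC.
by rewrite -splitr ltxx.
Qed.

End PlaneCalculus.

(** * Integration on the plane by domination *)

Section PlaneIntegral.
Context {R : realType}.
Implicit Types (f g h : plane R -> R) (u v : plane R) (i : bool).
Local Notation mu := (@lebesgue_measure R).
Local Notation mu2 := (lebesgue_measure \x lebesgue_measure)%E.

Lemma continuous_plane_measurable f : continuous f -> measurable_fun setT f.
Proof.
move=> cf; apply: (measurability _ (RGenOpens.measurableE R)).
move=> _ [_ [a [b ->] <-]]; rewrite setTI.
set A := f @^-1` _.
have Aball u : A u -> exists2 d, 0 < d & forall v, `|v.1 - u.1| < d ->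
    `|v.2 - u.2| < d -> A v.
  rewrite /A /= in_itv/= => /andP[au ub].
  have e0 : 0 < Num.min (f u - a) (b - f u) by rewrite lt_min !subr_gt0 au ub.
  have [d d0 H] := continuous_plane (cf u) e0.
  exists d => // v v1 v2; rewrite in_itv/=; have := H v v1 v2.
  rewrite lt_min !ltr_norml => /andP[/andP[h1 h2] /andP[h3 h4]].
  by apply/andP; split; lra.
(* Measurable sets of the plane are those generated by products, so the open set [A] is written as a
   countable union of rational squares. A square not contained in [A] is replaced by the empty set,
   so that the union may range over all rational parameters. *)
pose rect (a b r : rat) : set (plane R) :=
  ball (ratr a : R) (ratr r : R) `*` ball (ratr b : R) (ratr r : R).
pose F a b r := if `[< rect a b r `<=` A >] then rect a b r else set0.
have -> : A = \bigcup_a \bigcup_b \bigcup_r F a b r.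
  apply/seteqP; split=> [u Au|u [a' _ [b' _ [r' _]]]]; last first.
    by rewrite /F; case: asboolP => // H; exact: H.
  have [d d0 H] := Aball _ Au.
  have d2 : 0 < d / 2 by rewrite divr_gt0.
  have [r] := rat_in_itvoo d2; rewrite in_itv/= => /andP[r0 rd].
  have h1 : u.1 - ratr r < u.1 + ratr r by lra.
  have [p] := rat_in_itvoo h1; rewrite in_itv/= => /andP[p1 p2].
  have h2 : u.2 - ratr r < u.2 + ratr r by lra.
  have [q] := rat_in_itvoo h2; rewrite in_itv/= => /andP[q1 q2].
  exists p => //; exists q => //; exists r => //.
  rewrite /F; case: asboolP => [_|].
    by split; rewrite /ball/= ltr_norml; apply/andP; split; lra.
  case=> v [+ +]; rewrite /ball/= !ltr_norml => /andP[v1 v2] /andP[v3 v4].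
  by apply: H; rewrite ltr_norml; apply/andP; split; lra.
apply: bigcupT_measurable_rat => p; apply: bigcupT_measurable_rat => q.
apply: bigcupT_measurable_rat => r; rewrite /F; case: asboolP => // _.
by apply: measurableX; rewrite ball_itv; exact: measurable_itv.
Qed.

(** Integrable majorant in one variable: its primitive is arctan and its integral is pi, which
    explains the powers of pi in the bounds on integrals. *)
Definition lorentz (x : R) : R := (1 + x ^+ 2)^-1.

Lemma lorentz_ge0 x : 0 <= lorentz x.
Proof. by rewrite invr_ge0 addr_ge0// sqr_ge0. Qed.

Lemma continuous_lorentz : continuous lorentz.
Proof. exact: continuous_oneDsqrV. Qed.

(* Adding a multiple of arctan makes the integrand nonnegative, so that the
   nonnegative improper fundamental theorem of calculus applies. *)
Lemma integral_shifted_derivative (F F' : R -> R) (K : R) :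
  (forall x : R, is_derive x 1 F (F' x)) -> continuous F' ->
  (forall x, `|F x| <= K * lorentz x) -> (forall x, `|F' x| <= K * lorentz x) ->
  (\int[mu]_x (F' x + K * lorentz x)%:E = (K * pi)%:E)%E.
Proof.
move=> dF cF' bF bF'.
have cF : continuous F by move=> x; exact: is_derive_continuous (dF x).
pose p x := F' x + K * lorentz x.
have p0 x : 0 <= p x by have := bF' x; rewrite ler_norml => /andP[h _]; rewrite /p; lra.
have cp : continuous p.
  move=> x; apply: cvgD; first exact: cF'.
  by apply: cvgMr; exact: continuous_lorentz.
have mp : measurable_fun [set: R] p by exact: continuous_measurable_fun.
have K0 : 0 <= K.
  have := le_trans (normr_ge0 _) (bF 0).
  by rewrite /lorentz expr0n addr0 invr1 mulr1.
have Fy : F x @[x --> +oo] --> 0.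
  apply/cvgrPdist_le => e e0; near=> x.
  rewrite sub0r normrN (le_trans (bF x))//.
  have x1 : 1 <= x by near: x; exact: nbhs_pinfty_ge.
  have xe : K / e <= x by near: x; apply: nbhs_pinfty_ge; exact: num_real.
  rewrite /lorentz ler_pdivrMr; last by rewrite ltr_wpDr// sqr_ge0.
  move: xe; rewrite ler_pdivrMr// => xe; nra.
have FNy : F (- x) @[x --> +oo] --> 0.
  apply/cvgrPdist_le => e e0; near=> x.
  rewrite sub0r normrN (le_trans (bF _))//.
  have x1 : 1 <= x by near: x; exact: nbhs_pinfty_ge.
  have xe : K / e <= x by near: x; apply: nbhs_pinfty_ge; exact: num_real.
  rewrite /lorentz sqrrN ler_pdivrMr; last by rewrite ltr_wpDr// sqr_ge0.
  move: xe; rewrite ler_pdivrMr// => xe; nra.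
have Hp : (\int[mu]_(x in `[0%R, +oo[) (p x)%:E = (K * (pi / 2) - F 0)%:E)%E.
  pose P x := F x + K * atan x.
  have dP (x : R) : is_derive x 1 P (p x).
    by apply: is_deriveD; apply: is_deriveZ.
  rewrite (@ge0_continuous_FTC2y _ p P 0 (K * (pi / 2))).
  - by rewrite /P atan0 mulr0 addr0.
  - by move=> x _.
  - exact: continuous_subspaceT.
  - rewrite -[K * _]add0r; apply: cvgD => //; apply: cvgMr; exact: cvgy_atan.
  - by move=> x _; case: (dP x).
  - apply: cvg_at_right_filter; exact: is_derive_continuous (dP 0).
  - by move=> x _; rewrite derive1E; case: (dP x).
(* The negative half line is reflected onto the positive one; the boundary term [F 0] cancels the
   one in [Hp]. *)
have Hn : (\int[mu]_(x in `[0%R, +oo[) (p (- x))%:E = (K * (pi / 2) + F 0)%:E)%E.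
  pose P x := - F (- x) + K * atan x.
  have dP (x : R) : is_derive x 1 P (p (- x)).
    have -> : p (- x) = - (F' (- x) * -1) + K * lorentz x.
      by rewrite /p /lorentz sqrrN; ring.
    have d1 : is_derive x 1 (F \o -%R) (F' (- x) * -1).
      exact: is_derive1_comp.
    exact: is_deriveD (is_deriveN d1) (is_deriveZ K (is_derive1_atan x)).
  rewrite (@ge0_continuous_FTC2y _ (p \o -%R) P 0 (K * (pi / 2))).
  - by rewrite /P atan0 mulr0 addr0 oppr0 -EFinB opprK.
  - by move=> x _ /=.
  - apply: continuous_subspaceT => x; apply: continuous_comp; last exact: cp.
    exact: opp_continuous.
  - rewrite -[K * _]add0r -[X in X + _]oppr0; apply: cvgD; first exact: cvgN.
    by apply: cvgMr; exact: cvgy_atan.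
  - by move=> x _; case: (dP x).
  - apply: cvg_at_right_filter; exact: is_derive_continuous (dP 0).
  - by move=> x _; rewrite derive1E; case: (dP x).
have -> : [set: R] = `]-oo, (0:R)] `|` `]0, +oo[.
  apply/seteqP; split=> // x _ /=; rewrite !in_itv/= andbT.
  by case: (leP x 0) => _; [left|right].
rewrite ge0_integral_setU//=; last 3 first.
- by apply/measurable_EFinP/measurable_funTS.
- by move=> x _; rewrite lee_fin; exact: p0.
- apply/disj_setPS => x /= []; rewrite !in_itv/= andbT => x0 /lt_le_trans/(_ x0).
  by rewrite ltxx.
rewrite -{1}oppr0 ge0_integration_by_substitutionNy; last 2 first.
- exact: continuous_subspaceT.
- by move=> x _; exact: p0.
rewrite /= Hn integral_itv_obnd_cbnd; last by apply/measurable_EFinP/measurable_funTS.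
by rewrite Hp -EFinD; congr EFin; field.
Unshelve. all: by end_near. Qed.

Lemma integral_lorentz : (\int[mu]_x (lorentz x)%:E = pi%:E)%E.
Proof.
have := @integral_shifted_derivative (fun=> 0) (fun=> 0) 1 _ _ _ _.
under eq_integral do rewrite add0r mul1r.
rewrite mul1r; apply=> [|x|x].
- exact: cst_continuous.
- by rewrite normr0 mul1r lorentz_ge0.
- by rewrite normr0 mul1r lorentz_ge0.
Qed.

Lemma integrable_lorentz : mu.-integrable setT (EFin \o lorentz).
Proof.
have m : measurable_fun setT (EFin \o lorentz).
  apply/measurable_EFinP; apply: continuous_measurable_fun.
  exact: continuous_lorentz.
apply/integrableP; split => //; apply/abse_integralP => //.
by rewrite integral_lorentz ltry.
Qed.

Lemma integral_derivative0 (F F' : R -> R) (K : R) :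
  (forall x : R, is_derive x 1 F (F' x)) -> continuous F' ->
  (forall x, `|F x| <= K * lorentz x) -> (forall x, `|F' x| <= K * lorentz x) ->
  (\int[mu]_x (F' x)%:E = 0)%E.
Proof.
move=> dF cF' bF bF'.
have iF' : mu.-integrable setT (EFin \o F').
  apply: (@le_integrable _ _ _ mu _ measurableT _ (EFin \o (fun x => K * lorentz x))).
  - by apply/measurable_EFinP; exact: continuous_measurable_fun.
  - move=> x _ /=; rewrite lee_fin (le_trans (bF' x))// ler_norm//.
  - have := integrableZl measurableT K integrable_lorentz.
    by apply: eq_integrable => // x _ /=; rewrite EFinM.
have iK : mu.-integrable setT (EFin \o (fun x => K * lorentz x)).
  have := integrableZl measurableT K integrable_lorentz.
  by apply: eq_integrable => // x _ /=; rewrite EFinM.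
have := integral_shifted_derivative dF cF' bF bF'.
rewrite integralD_EFin//.
have -> : (\int[mu]_x (K * lorentz x)%:E = (K * pi)%:E)%E.
  under eq_integral do rewrite EFinM.
  by rewrite integralZl//; [rewrite integral_lorentz|exact: integrable_lorentz].
rewrite -[X in (X + _)%E]fineK; last exact: integrable_fin_num.
rewrite -EFinD => -[] /(congr1 (fun x => x - K * pi)); rewrite subrr addrK => E.
rewrite -[LHS]fineK ?(integrable_fin_num measurableT iF')//; congr EFin; exact: E.
Qed.

Definition plorentz u := lorentz u.1 * lorentz u.2.

Lemma plorentz_ge0 u : 0 <= plorentz u.
Proof. by rewrite mulr_ge0 ?lorentz_ge0. Qed.

Lemma continuous_fst_comp (a : R -> R) : continuous a -> continuous (fun u : plane R => a u.1).
Proof. by move=> ca u; apply: continuous_comp; [exact: cvg_fst|exact: ca]. Qed.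

Lemma continuous_snd_comp (a : R -> R) : continuous a -> continuous (fun u : plane R => a u.2).
Proof. by move=> ca u; apply: continuous_comp; [exact: cvg_snd|exact: ca]. Qed.

Lemma continuous_plorentz : continuous plorentz.
Proof.
move=> u; apply: cvgM.
  exact: continuous_fst_comp continuous_lorentz u.
exact: continuous_snd_comp continuous_lorentz u.
Qed.

Definition rdom h := continuous h /\ exists K, forall u, `|h u| <= K * plorentz u.

Definition rint h : R := \int[mu2]_(u in setT) h u.

Lemma integral_product (a b : R -> R) (x y : R) : continuous a -> continuous b ->
  (forall t, 0 <= a t) -> (forall t, 0 <= b t) ->
  (\int[mu]_t (a t)%:E = x%:E)%E -> (\int[mu]_t (b t)%:E = y%:E)%E ->
  (\int[mu2]_u (a u.1 * b u.2)%:E = (x * y)%:E)%E.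
Proof.
move=> ca cb a0 b0 ia ib.
have ma : measurable_fun setT (EFin \o a).
  by apply/measurable_EFinP; exact: continuous_measurable_fun.
have mb : measurable_fun setT (EFin \o b).
  by apply/measurable_EFinP; exact: continuous_measurable_fun.
rewrite (@fubini_tonelli1 _ _ _ _ _ mu mu (fun u : plane R => (a u.1 * b u.2)%:E)).
- have sc (c z : R) (f : R -> R) : measurable_fun setT (EFin \o f) ->
      (forall t, 0 <= f t) -> 0 <= c ->
      (\int[mu]_t (f t)%:E = z%:E)%E -> (\int[mu]_t (c * f t)%:E = (c * z)%:E)%E.
    move=> mf f0 c0 fz; under eq_integral do rewrite EFinM.
    by rewrite ge0_integralZl ?lee_fin//= ?fz// => t _; rewrite lee_fin.
  rewrite /fubini_F /=; under eq_integral => t _.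
    rewrite (sc _ y)// mulrC.
    over.
  rewrite (sc _ x)//; first by rewrite mulrC.
  by rewrite -lee_fin -ib; apply: integral_ge0 => t _; rewrite lee_fin.
- apply/measurable_EFinP; apply: continuous_plane_measurable => u.
  by apply: cvgM; [exact: continuous_fst_comp|exact: continuous_snd_comp].
- by move=> u; rewrite lee_fin mulr_ge0.
Qed.

Lemma integral_plorentz : (\int[mu2]_u (plorentz u)%:E = (pi ^+ 2)%:E)%E.
Proof.
rewrite expr2; apply: integral_product => //.
- exact: continuous_lorentz.
- exact: continuous_lorentz.
- exact: lorentz_ge0.
- exact: lorentz_ge0.
- exact: integral_lorentz.
- exact: integral_lorentz.
Qed.

Lemma integrable_plorentz : mu2.-integrable setT (EFin \o plorentz).
Proof.
have m : measurable_fun setT (EFin \o plorentz).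
  apply/measurable_EFinP; apply: continuous_plane_measurable.
  exact: continuous_plorentz.
apply/integrableP; split => //; apply/abse_integralP => //.
by rewrite integral_plorentz ltry.
Qed.

Lemma integrable_dominated h (K : R) : continuous h ->
  (forall u, `|h u| <= K * plorentz u) -> mu2.-integrable setT (EFin \o h).
Proof.
move=> ch hK.
apply: (@le_integrable _ _ _ mu2 _ measurableT _ (EFin \o (fun x => K * plorentz x))).
- by apply/measurable_EFinP; exact: continuous_plane_measurable.
- by move=> x _ /=; rewrite lee_fin (le_trans (hK x))// ler_norm.
- have := integrableZl measurableT K integrable_plorentz.
  by apply: eq_integrable => // x _ /=; rewrite EFinM.
Qed.

Lemma rdom_integrable h : rdom h -> mu2.-integrable setT (EFin \o h).
Proof. by case=> ch [K]; exact: integrable_dominated. Qed.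

Lemma rdomD f g : rdom f -> rdom g -> rdom (fun u => f u + g u).
Proof.
move=> [cf [K fK]] [cg [L gL]]; split; first by move=> u; apply: cvgD; [exact: cf|exact: cg].
by exists (K + L) => u; rewrite mulrDl (le_trans (ler_normD _ _))// lerD.
Qed.

Lemma rdomZ (a : R) f : rdom f -> rdom (fun u => a * f u).
Proof.
move=> [cf [K fK]]; split; first by move=> u; apply: cvgMr; exact: cf.
by exists (`|a| * K) => u; rewrite normrM -mulrA ler_wpM2l.
Qed.

Lemma rintD f g : rdom f -> rdom g -> rint (fun u => f u + g u) = rint f + rint g.
Proof. by move=> /rdom_integrable df /rdom_integrable dg; rewrite /rint RintegralD. Qed.

Lemma rintZ (a : R) f : rdom f -> rint (fun u => a * f u) = a * rint f.
Proof. by move=> /rdom_integrable df; rewrite /rint RintegralZl. Qed.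

Lemma rint_le f g : rdom f -> rdom g -> (forall u, f u <= g u) -> rint f <= rint g.
Proof.
by move=> /rdom_integrable df /rdom_integrable dg fg; rewrite /rint le_Rintegral.
Qed.

Lemma rdom_plorentz : rdom plorentz.
Proof.
split; first exact: continuous_plorentz.
by exists 1 => u; rewrite mul1r ger0_norm// plorentz_ge0.
Qed.

Lemma rint_plorentz : rint plorentz = pi ^+ 2.
Proof. by rewrite /rint /Rintegral integral_plorentz. Qed.

Lemma rint_bound h K : continuous h -> (forall u, `|h u| <= K * plorentz u) ->
  `|rint h| <= K * pi ^+ 2.
Proof.
move=> ch hK; have dh : rdom h by split => //; exists K.
have dK := rdomZ K rdom_plorentz.
rewrite -rint_plorentz -(rintZ _ rdom_plorentz) ler_norml -mulN1r -rintZ//.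
apply/andP; split; apply: rint_le => //; first exact: rdomZ.
  by move=> u; have := hK u; rewrite ler_norml => /andP[+ _]; rewrite mulN1r.
by move=> u; have := hK u; rewrite ler_norml => /andP[].
Qed.

Lemma rint_product (a b : R -> R) (x y : R) : continuous a -> continuous b ->
  (forall t, 0 <= a t) -> (forall t, 0 <= b t) ->
  (\int[mu]_t (a t)%:E = x%:E)%E -> (\int[mu]_t (b t)%:E = y%:E)%E ->
  rint (fun u => a u.1 * b u.2) = x * y.
Proof. by move=> *; rewrite /rint /Rintegral (@integral_product a b x y). Qed.

Lemma lorentz_le1 x : lorentz x <= 1.
Proof. exact: oneDsqrV_le1. Qed.

Lemma continuous_row g (x : R) : continuous g -> continuous (fun t : R => g (x, t)).
Proof.
move=> cg t; apply/cvgrPdist_lt => e e0.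
have [d d0 H] := continuous_plane (cg (x, t)) e0.
apply/nbhs_ballP; exists d => //= s; rewrite /ball/= => st.
by rewrite distrC; apply: H => /=; rewrite ?subrr ?normr0// distrC.
Qed.

Lemma continuous_column g (x : R) : continuous g -> continuous (fun t : R => g (t, x)).
Proof.
move=> cg t; apply/cvgrPdist_lt => e e0.
have [d d0 H] := continuous_plane (cg (t, x)) e0.
apply/nbhs_ballP; exists d => //= s; rewrite /ball/= => st.
by rewrite distrC; apply: H => /=; rewrite ?subrr ?normr0// distrC.
Qed.

(** Fubini, with the inner integral along direction [i]: on each line the integrand is the
    derivative of a function vanishing at infinity. Since [lorentz] is at most 1, the single
    constant [K + L] dominates both functions on every line. *)
Lemma rint_derivative i f g : rder i f g -> rdom f -> rdom g -> rint g = 0.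
Proof.
move=> d [cf [K fK]] dg; have [cg [L gL]] := dg.
have mg := rdom_integrable dg.
have bnd (h : plane R -> R) M : (forall u, `|h u| <= M * plorentz u) ->
    0 <= M.
  move=> H; have := le_trans (normr_ge0 _) (H (0, 0)).
  by rewrite /plorentz /lorentz /= expr0n addr0 invr1 !mulr1.
have K0 := bnd _ _ fK; have L0 := bnd _ _ gL.
have KL0 : 0 <= K + L by rewrite addr_ge0.
have KL x t : K * (lorentz x * lorentz t) <= (K + L) * lorentz t.
  rewrite mulrCA; apply: (@le_trans _ _ (1 * (K * lorentz t))).
    by rewrite ler_wpM2r ?lorentz_le1// mulr_ge0 ?lorentz_ge0.
  by rewrite mul1r ler_wpM2r ?lorentz_ge0// lerDl.
have LK x t : L * (lorentz x * lorentz t) <= (K + L) * lorentz t.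
  rewrite mulrCA; apply: (@le_trans _ _ (1 * (L * lorentz t))).
    by rewrite ler_wpM2r ?lorentz_le1// mulr_ge0 ?lorentz_ge0.
  by rewrite mul1r ler_wpM2r ?lorentz_ge0// lerDr.
rewrite /rint /Rintegral; case: i d => d.
- rewrite -(@integral12_prod_meas1 _ _ _ _ _ mu mu (EFin \o g))// /fubini_F /=.
  rewrite (_ : (fun x => _) = cst 0%E) ?integral_cst// ?mul0e//.
  apply/funext => x.
  have E t : (x, t) = (x, 0) + t *: basis_vec true :> plane R.
    by apply/pair_equal_spec; rewrite /= /GRing.scale/= mulr0 mulr1 addr0 add0r.
  apply: (@integral_derivative0 (fun t => f (x, t)) _ (K + L)).
  + move=> t; rewrite E; under eq_fun do rewrite E; exact: rder_line.
  + exact: continuous_row.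
  + by move=> t; exact: le_trans (fK _) (KL _ _).
  + by move=> t; exact: le_trans (gL _) (LK _ _).
- rewrite -(@integral21_prod_meas1 _ _ _ _ _ mu mu (EFin \o g))// /fubini_G /=.
  rewrite (_ : (fun x => _) = cst 0%E) ?integral_cst// ?mul0e//.
  apply/funext => x.
  have E t : (t, x) = (0, x) + t *: basis_vec false :> plane R.
    by apply/pair_equal_spec; rewrite /= /GRing.scale/= mulr0 mulr1 addr0 add0r.
  apply: (@integral_derivative0 (fun t => f (t, x)) _ (K + L)).
  + move=> t; rewrite E; under eq_fun do rewrite E; exact: rder_line.
  + exact: continuous_column.
  + by move=> t; apply: le_trans (fK _) _; rewrite /plorentz/= (mulrC (lorentz t)) KL.
  + by move=> t; apply: le_trans (gL _) _; rewrite /plorentz/= (mulrC (lorentz t)) LK.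
Qed.

End PlaneIntegral.

(** * Complex-valued derivatives and integrals *)

Section ComplexCalculus.
Context {R : realType}.
Implicit Types (f g h : plane R -> R[i]) (u v : plane R) (i : bool).

Definition cder i f g :=
  rder i (re_part f) (re_part g) /\ rder i (im_part f) (im_part g).

Definition ccont f := continuous (re_part f) /\ continuous (im_part f).

Lemma re_partD f g : re_part (fun u => f u + g u) = fun u => re_part f u + re_part g u.
Proof. by apply/funext => u; rewrite /re_part cReD. Qed.

Lemma im_partD f g : im_part (fun u => f u + g u) = fun u => im_part f u + im_part g u.
Proof. by apply/funext => u; rewrite /im_part cImD. Qed.

Lemma re_partM f g : re_part (fun u => f u * g u) =
  fun u => re_part f u * re_part g u - im_part f u * im_part g u.
Proof. by apply/funext => u; rewrite /re_part cReM. Qed.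

Lemma im_partM f g : im_part (fun u => f u * g u) =
  fun u => re_part f u * im_part g u + im_part f u * re_part g u.
Proof. by apply/funext => u; rewrite /im_part cImM. Qed.

Lemma cder_ext i f f' g g' : f =1 f' -> g =1 g' -> cder i f g -> cder i f' g'.
Proof. by move=> /funext -> /funext ->. Qed.

Lemma cderD i f1 f2 g1 g2 : cder i f1 g1 -> cder i f2 g2 ->
  cder i (fun u => f1 u + f2 u) (fun u => g1 u + g2 u).
Proof.
move=> [a1 b1] [a2 b2]; rewrite /cder !re_partD !im_partD.
by split; exact: rderD.
Qed.

Lemma cder_cst i (c : R[i]) : cder i (fun=> c) (fun=> 0).
Proof. by split; exact: rder_cst. Qed.

Lemma cderM i f1 f2 g1 g2 : cder i f1 g1 -> cder i f2 g2 ->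
  cder i (fun u => f1 u * f2 u) (fun u => g1 u * f2 u + f1 u * g2 u).
Proof.
move=> [a1 b1] [a2 b2]; split.
  rewrite re_partM.
  apply: rder_ext (rderB (rderM a1 a2) (rderM b1 b2)) => u.
  by rewrite re_partD !re_partM; ring.
rewrite im_partM.
apply: rder_ext (rderD (rderM a1 b2) (rderM b1 a2)) => u.
by rewrite im_partD !im_partM; ring.
Qed.

Lemma cderZ i (c : R[i]) f g : cder i f g ->
  cder i (fun u => c * f u) (fun u => c * g u).
Proof.
move=> d; apply: cder_ext (cderM (cder_cst i c) d) => // u.
by rewrite mul0r add0r.
Qed.

Lemma cderN i f g : cder i f g -> cder i (fun u => - f u) (fun u => - g u).
Proof. by move/(cderZ (-1)); apply: cder_ext => u; rewrite mulN1r. Qed.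

Lemma cderB i f1 f2 g1 g2 : cder i f1 g1 -> cder i f2 g2 ->
  cder i (fun u => f1 u - f2 u) (fun u => g1 u - g2 u).
Proof. by move=> d1 /cderN d2; exact: cderD. Qed.

Lemma cder_partial i f g : cder i f g -> partial i f = g.
Proof.
move=> [a b]; apply/funext => u; rewrite /partial.
have [_ ->] := a u; have [_ ->] := b u.
by rewrite /re_part /im_part; case: (g u).
Qed.

Lemma ccontD f g : ccont f -> ccont g -> ccont (fun u => f u + g u).
Proof.
move=> [a b] [c d]; split.
  by rewrite re_partD; move=> u; apply: cvgD; [exact: a|exact: c].
by rewrite im_partD; move=> u; apply: cvgD; [exact: b|exact: d].
Qed.

Lemma ccontM f g : ccont f -> ccont g -> ccont (fun u => f u * g u).
Proof.
move=> [a b] [c d]; split.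
  rewrite re_partM.
  by move=> u; apply: cvgB; apply: cvgM; [exact: a|exact: c|exact: b|exact: d].
rewrite im_partM.
by move=> u; apply: cvgD; apply: cvgM; [exact: a|exact: d|exact: b|exact: c].
Qed.

Lemma ccont_cst (c : R[i]) : ccont (fun=> c).
Proof. by split; exact: cst_continuous. Qed.

Lemma ccont_real (a : plane R -> R) : continuous a -> ccont (fun u => (a u)%:C).
Proof. by move=> ca; split; [exact: ca|exact: cst_continuous]. Qed.

Lemma cder_taylor i f g k (M : R) u (t : R) : cder i f g -> cder i g k ->
  (forall v, cnorm (k v) <= M) ->
  cnorm (f (u + t *: basis_vec i) - f u - t%:C * g u) <= (M + M) * `|t| ^+ 2.
Proof.
move=> [a1 b1] [a2 b2] kM; rewrite (le_trans (cnorm_ReIm _))// mulrDl.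
rewrite !cReB !cImB cReM cImM /= !mul0r subr0 addr0 lerD//.
  by apply: (taylor_line u t a1 a2) => v; rewrite (le_trans (cnorm_Re _)).
by apply: (taylor_line u t b1 b2) => v; rewrite (le_trans (cnorm_Im _)).
Qed.

Lemma cder_quad i f g (M : plane R -> R) :
  (forall u (t : R), `|t| <= 1 ->
   cnorm (f (u + t *: basis_vec i) - f u - t%:C * g u) <= M u * `|t| ^+ 2) ->
  cder i f g.
Proof.
move=> H; split=> u; apply: (@is_derive_quad _ _ _ _ _ (M u)) => t t1.
  apply: le_trans (H u t t1); apply: le_trans (cnorm_Re _).
  by rewrite !cReB cReM /= mul0r subr0.
apply: le_trans (H u t t1); apply: le_trans (cnorm_Im _).
by rewrite !cImB cImM /= mul0r addr0.
Qed.

Lemma cder_ccont f g0 g1 (M : R) : cder false f g0 -> cder true f g1 ->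
  (forall u, cnorm (g0 u) <= M) -> (forall u, cnorm (g1 u) <= M) -> ccont f.
Proof.
move=> [a0 b0] [a1 b1] M0 M1; split; apply: (@lipschitz_continuous _ _ M).
  by apply: (rder_lipschitz a0 a1) => u; rewrite (le_trans (cnorm_Re _)).
by apply: (rder_lipschitz b0 b1) => u; rewrite (le_trans (cnorm_Im _)).
Qed.

Lemma cder0_cst f : cder false f (fun=> 0) -> cder true f (fun=> 0) ->
  forall u v, f u = f v.
Proof.
move=> [a0 b0] [a1 b1] u v; apply: complexP.
  exact: (rder0_cst a0 a1).
exact: (rder0_cst b0 b1).
Qed.

(** The inverse of the integrable majorant [plorentz]. It is at least 1 and dominates both
    coordinates, so its powers can replace the monomials in q and p. *)
Definition bracket u : R := (1 + u.1 ^+ 2) * (1 + u.2 ^+ 2).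

Lemma bracket_ge1 u : 1 <= bracket u.
Proof. by rewrite mulr_ege1// lerDl sqr_ge0. Qed.

Lemma bracket_gt0 u : 0 < bracket u.
Proof. exact: lt_le_trans ltr01 (bracket_ge1 u). Qed.
Hint Resolve bracket_gt0 : core.

Lemma bracket_ge0 u : 0 <= bracket u.
Proof. exact: ltW. Qed.

Lemma bracketX_ge0 u k : 0 <= bracket u ^+ k.
Proof. by rewrite exprn_ge0// ltW. Qed.

Lemma plorentzE u : plorentz u = (bracket u)^-1.
Proof. by rewrite /plorentz /lorentz /bracket invfM. Qed.

Lemma bracket_fst u : `|u.1| <= bracket u.
Proof.
have h1 := sqr_ge0 (`|u.1| - 1); have h2 := real_normK (num_real u.1).
have h3 := sqr_ge0 u.1; have h4 := sqr_ge0 u.2.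
apply: (@le_trans _ _ ((1 + u.1 ^+ 2) * 1)).
  by move: h1; rewrite sqrrB1 h2 => h1; lra.
by rewrite ler_wpM2l ?addr_ge0// lerDl.
Qed.

Lemma bracket_snd u : `|u.2| <= bracket u.
Proof.
have := bracket_fst (u.2, u.1); rewrite /bracket /= mulrC.
exact: le_trans.
Qed.

Definition cdom f := ccont f /\ exists K, forall u, bracket u * cnorm (f u) <= K.

Lemma bracket_bound (a K : R) u : bracket u * a <= K -> a <= K * plorentz u.
Proof. by rewrite plorentzE ler_pdivlMr// mulrC. Qed.

Lemma cdom_re f : cdom f -> rdom (re_part f).
Proof.
move=> [[c _] [K fK]]; split => //; exists K => u.
by apply: bracket_bound; rewrite (le_trans _ (fK u))// ler_wpM2l ?cnorm_Re// ltW.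
Qed.

Lemma cdom_im f : cdom f -> rdom (im_part f).
Proof.
move=> [[_ c] [K fK]]; split => //; exists K => u.
by apply: bracket_bound; rewrite (le_trans _ (fK u))// ler_wpM2l ?cnorm_Im// ltW.
Qed.

Lemma cdomD f g : cdom f -> cdom g -> cdom (fun u => f u + g u).
Proof.
move=> [cf [K fK]] [cg [L gL]]; split; first exact: ccontD.
exists (K + L) => u; rewrite (le_trans _ (lerD (fK u) (gL u)))// -mulrDr.
by rewrite ler_wpM2l ?cnormD// ltW.
Qed.

Lemma cdomMb f g (M : R) : ccont g -> (forall u, cnorm (g u) <= M) -> cdom f ->
  cdom (fun u => g u * f u).
Proof.
move=> cg gM [cf [K fK]]; split; first exact: ccontM.
exists (M * K) => u; rewrite cnormM mulrCA ler_pM//.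
  exact: cnorm_ge0.
by rewrite mulr_ge0 ?cnorm_ge0// ltW.
Qed.

Lemma cdomZ (c : R[i]) f : cdom f -> cdom (fun u => c * f u).
Proof. exact: (cdomMb (ccont_cst c)). Qed.

Lemma cdomN f : cdom f -> cdom (fun u => - f u).
Proof. by move/(cdomZ (-1)); under eq_fun do rewrite mulN1r. Qed.

Lemma cdomB f g : cdom f -> cdom g -> cdom (fun u => f u - g u).
Proof. by move=> df /cdomN dg; exact: cdomD. Qed.

Lemma cintegralE f : cintegral f = rint (re_part f) +i* rint (im_part f).
Proof. by []. Qed.

Lemma cintegral_ext f g : f =1 g -> cintegral f = cintegral g.
Proof. by move=> /funext ->. Qed.

Lemma cintegralD f g : cdom f -> cdom g ->
  cintegral (fun u => f u + g u) = cintegral f + cintegral g.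
Proof.
move=> df dg; apply: complexP; rewrite ?cReD ?cImD !cintegralE /=.
  rewrite -rintD; [|exact: cdom_re|exact: cdom_re].
  by congr rint; apply/funext => u; rewrite /re_part cReD.
rewrite -rintD; [|exact: cdom_im|exact: cdom_im].
by congr rint; apply/funext => u; rewrite /im_part cImD.
Qed.

Lemma cintegralZ (c : R[i]) f : cdom f ->
  cintegral (fun u => c * f u) = c * cintegral f.
Proof.
move=> df; have dr := cdom_re df; have di := cdom_im df.
apply: complexP; rewrite ?cReM ?cImM !cintegralE /= -!rintZ//.
  rewrite -mulN1r -rintZ; last exact: rdomZ.
  rewrite -rintD; [|exact: rdomZ|by do 2 apply: rdomZ].
  by congr rint; apply/funext => u; rewrite /re_part cReM mulN1r.
rewrite -rintD; [|exact: rdomZ|exact: rdomZ].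
by congr rint; apply/funext => u; rewrite /im_part cImM.
Qed.

Lemma cintegralN f : cdom f -> cintegral (fun u => - f u) = - cintegral f.
Proof.
by move=> df; rewrite -mulN1r -cintegralZ//; apply: cintegral_ext => u; rewrite mulN1r.
Qed.

Lemma cintegralB f g : cdom f -> cdom g ->
  cintegral (fun u => f u - g u) = cintegral f - cintegral g.
Proof. by move=> df dg; rewrite cintegralD ?cintegralN//; exact: cdomN. Qed.

Lemma cintegral_bound f K : ccont f -> (forall u, bracket u * cnorm (f u) <= K) ->
  cnorm (cintegral f) <= 2 * pi ^+ 2 * K.
Proof.
move=> [cr ci] fK; rewrite (le_trans (cnorm_ReIm _))//=.
rewrite -mulrA mulr_natl mulr2n (mulrC _ K) lerD//.
  by apply: rint_bound => // u; apply: bracket_bound;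
    rewrite (le_trans _ (fK u))// ler_wpM2l ?cnorm_Re// ltW.
by apply: rint_bound => // u; apply: bracket_bound;
  rewrite (le_trans _ (fK u))// ler_wpM2l ?cnorm_Im// ltW.
Qed.

Lemma cintegral_derivative i f g : cder i f g -> cdom f -> cdom g ->
  cintegral g = 0.
Proof.
move=> [a b] df dg; apply: complexP => /=.
  by apply: (rint_derivative a); exact: cdom_re.
by apply: (rint_derivative b); exact: cdom_im.
Qed.

Lemma cintegral_by_parts i f f' g g' : cder i f f' -> cder i g g' ->
  cdom (fun u => f u * g u) -> cdom (fun u => f' u * g u) ->
  cdom (fun u => f u * g' u) ->
  cintegral (fun u => f' u * g u) = - cintegral (fun u => f u * g' u).
Proof.
move=> df dg d1 d2 d3; apply/eqP; rewrite -addr_eq0 -cintegralD//; apply/eqP.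
by apply: (cintegral_derivative (cderM df dg)) => //; exact: cdomD.
Qed.

(** The bound on [E2], uniform in the parameter, makes the Taylor remainder of the integrand at most
    t^2 times an integrable function; its integral is the quadratic remainder that [cder_quad]
    expects. *)
Lemma cintegral_param i (E E1 E2 : plane R -> plane R -> R[i]) (K : R) :
  (forall w, cder i (E^~ w) (E1^~ w)) -> (forall w, cder i (E1^~ w) (E2^~ w)) ->
  (forall x, cdom (E x)) -> (forall x, cdom (E1 x)) ->
  (forall x w, bracket w * cnorm (E2 x w) <= K) ->
  cder i (fun x => cintegral (E x)) (fun x => cintegral (E1 x)).
Proof.
move=> d1 d2 dE dE1 bE2.
apply: (@cder_quad _ _ _ (fun=> 2 * pi ^+ 2 * (K + K))) => x t t1.
rewrite -cintegralZ// -!cintegralB//; [|exact: cdomB|exact: cdomZ].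
rewrite -mulrA; apply: cintegral_bound.
  have : cdom (fun u => E (x + t *: basis_vec i) u - E x u - t%:C * E1 x u).
    by apply: cdomB; [exact: cdomB|exact: cdomZ].
  by case.
move=> w; have h w' : cnorm (E2 w' w) <= K / bracket w.
  by rewrite ler_pdivlMr// mulrC.
have := cder_taylor x t (d1 w) (d2 w) h.
move=> /(ler_wpM2l (ltW (bracket_gt0 w))) /le_trans; apply.
by rewrite -mulrDl mulrA [bracket w * _]mulrC divfK ?gt_eqF.
Qed.

End ComplexCalculus.
#[global] Hint Resolve bracket_gt0 : core.

(** * Schwartz functions *)

Section SchwartzClass.
Context {R : realType}.
Implicit Types (f g h : plane R -> R[i]) (u v : plane R) (i : bool).

Definition rapid f := forall k, exists K, forall u, bracket u ^+ k * cnorm (f u) <= K.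

Lemma rapidD f g : rapid f -> rapid g -> rapid (fun u => f u + g u).
Proof.
move=> rf rg k; have [K fK] := rf k; have [L gL] := rg k.
exists (K + L) => u; rewrite (le_trans _ (lerD (fK u) (gL u)))// -mulrDr.
by rewrite ler_wpM2l ?cnormD ?bracketX_ge0.
Qed.

Lemma rapidMb f g n (M : R) : (forall u, cnorm (g u) <= M * bracket u ^+ n) -> rapid f ->
  rapid (fun u => g u * f u).
Proof.
move=> gM rf k; have [K fK] := rf (k + n)%N; exists (M * K) => u.
have p0 := exprn_gt0 n (bracket_gt0 u).
have M0 : 0 <= M by rewrite -(pmulr_lge0 _ p0); exact: le_trans (cnorm_ge0 _) (gM u).
rewrite cnormM mulrCA; apply: (@le_trans _ _ (M * bracket u ^+ n * (bracket u ^+ k * cnorm (f u)))).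
  by rewrite ler_wpM2r// mulr_ge0 ?cnorm_ge0 ?bracketX_ge0.
by rewrite -mulrA ler_wpM2l// mulrA -exprD addnC.
Qed.

Lemma rapidZ (c : R[i]) f : rapid f -> rapid (fun u => c * f u).
Proof.
by apply: (rapidMb (n := 0) (M := cnorm c)) => u; rewrite expr0 mulr1.
Qed.

Lemma rapid_cdom f : ccont f -> rapid f -> cdom f.
Proof. by move=> cf rf; split => //; have [K] := rf 1%N; exists K. Qed.

Lemma rapid_bounded f : rapid f -> exists M, forall u, cnorm (f u) <= M.
Proof. by move=> rf; have [K fK] := rf 0%N; exists K => u; have := fK u; rewrite mul1r. Qed.

Lemma rapid_cdomM f g : ccont f -> rapid f -> ccont g -> rapid g ->
  cdom (fun u => f u * g u).
Proof.
move=> cf rf cg rg; have [M fM] := rapid_bounded rf.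
by apply: (cdomMb _ fM) => //; exact: rapid_cdom.
Qed.

(** Stability of [P] under derivatives puts every iterated derivative back into [P], where
    continuity and decay are known. Later uses only exhibit a suitable class, such as combinations
    of Hermite functions or termwise derivatives of one series. *)
Lemma is_schwartz_coind (P : (plane R -> R[i]) -> Prop) f :
  (forall g, P g -> [/\ ccont g, rapid g & forall i, exists2 g', P g' & cder i g g']) ->
  P f -> is_schwartz f.
Proof.
move=> H Pf.
have Hp s : P (partials s f).
  elim: s => [//|i s IH] /=; have [_ _ /(_ i)[g' Pg' d]] := H _ IH.
  by rewrite (cder_partial d).
split.
  move=> s; have [[c1 c2] _ d] := H _ (Hp s); split=> // i u.
  have [g' _ [d1 d2]] := d i; split; [by case: (d1 u)|by case: (d2 u)].
move=> a b c d.
have [_ rg _] := H _ (Hp (nseq c false ++ nseq d true)).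
have [K gK] := rg (a + b)%N.
exists K => _ [u _ <-]; rewrite /weighted_partial; apply: le_trans (gK u).
rewrite ler_wpM2r ?cnorm_ge0// normrM !normrX exprD ler_pM ?exprn_ge0//.
  by rewrite lerXn2r ?nnegrE ?bracket_fst ?bracket_ge0.
by rewrite lerXn2r ?nnegrE ?bracket_snd ?bracket_ge0.
Qed.

Lemma smooth_cder f s i : smooth f -> cder i (partials s f) (partials (i :: s) f).
Proof.
move=> sf; have [_ _ d] := sf s.
by split=> u; have [d1 d2] := d i u; split.
Qed.

Lemma smooth_ccont f s : smooth f -> ccont (partials s f).
Proof. by move=> sf; have [c1 c2 _] := sf s. Qed.

Lemma partials_rcons s i f : partials s (partial i f) = partials (rcons s i) f.
Proof. by rewrite /partials foldr_rcons. Qed.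

Lemma smooth_partial i f : smooth f -> smooth (partial i f).
Proof. by move=> sf s; rewrite partials_rcons; exact: sf. Qed.

Lemma smooth_partialC f : smooth f ->
  partial true (partial false f) = partial false (partial true f).
Proof.
move=> sf; have [a0 b0] := smooth_cder [::] false sf.
have [a1 b1] := smooth_cder [::] true sf.
have [a01 b01] := smooth_cder [:: false] true sf.
have [a10 b10] := smooth_cder [:: true] false sf.
have [c01 d01] := smooth_ccont [:: true; false] sf.
have [c10 d10] := smooth_ccont [:: false; true] sf.
apply/funext => u; apply: complexP.
  by have /(congr1 (@^~ u)) := rder_comm a0 a1 a01 a10 c01 c10.
by have /(congr1 (@^~ u)) := rder_comm b0 b1 b01 b10 d01 d10.
Qed.

Lemma partials_true_false d f : smooth f ->
  partials (nseq d true) (partial false f) = partial false (partials (nseq d true) f).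
Proof.
move=> sf; elim: d => [//|d IH] /=; rewrite IH smooth_partialC//.
by move=> s; have := sf (s ++ nseq d true); rewrite /partials foldr_cat.
Qed.

(** The seminorms only see derivatives with every d/dq outside every d/dp. An extra innermost d/dp
    extends such a word, while an innermost d/dq must first be moved outwards by the symmetry of
    second derivatives. *)
Lemma is_schwartz_partial i f : is_schwartz f -> is_schwartz (partial i f).
Proof.
move=> [sf bf]; split; first exact: smooth_partial.
move=> a b c d; rewrite /weighted_partial; case: i.
  have [K fK] := bf a b c d.+1; exists K => _ [u _ <-]; apply: fK; exists u => //.
  rewrite /weighted_partial partials_rcons; congr (_ * cnorm (partials _ _ _)).
  by rewrite rcons_cat; congr (_ ++ _); elim: d => [//|d /= <-].
have [K fK] := bf a b c.+1 d; exists K => _ [u _ <-]; apply: fK; exists u => //.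
rewrite /weighted_partial; congr (_ * cnorm (_ u)).
rewrite /partials !foldr_cat -!/(partials _ _) partials_true_false//.
rewrite -/(partials (nseq c false) _) partials_rcons -/(partials _ _).
by congr (partials _ _); elim: c => [//|c /= <-].
Qed.

Lemma expr1D_le (x : R) k : 0 <= x -> (1 + x) ^+ k <= 2 ^+ k * (1 + x ^+ k).
Proof.
move=> x0; have [x1|/ltW x1] := leP x 1.
  apply: (@le_trans _ _ (2 ^+ k)); first by rewrite lerXn2r ?nnegrE ?addr_ge0//; lra.
  by rewrite ler_peMr ?exprn_ge0// lerDl exprn_ge0.
apply: (@le_trans _ _ ((2 * x) ^+ k)).
  by rewrite lerXn2r ?nnegrE ?addr_ge0 ?mulr_ge0//; lra.
by rewrite exprMn ler_wpM2l ?exprn_ge0// lerDr.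
Qed.

(** From (1 + x)^k <= 2^k (1 + x^k) with x = q^2 and x = p^2: the product of the right-hand sides
    expands into four weights, each controlled by a seminorm without derivatives. *)
Lemma is_schwartz_rapid f : is_schwartz f -> rapid f.
Proof.
move=> [_ bf] k.
have [K1 H1] := bf 0%N 0%N 0%N 0%N; have [K2 H2] := bf (2 * k)%N 0%N 0%N 0%N.
have [K3 H3] := bf 0%N (2 * k)%N 0%N 0%N; have [K4 H4] := bf (2 * k)%N (2 * k)%N 0%N 0%N.
exists (4 ^+ k * (K1 + K2 + K3 + K4)) => u.
have := H1 _ (imageT _ u); have := H2 _ (imageT _ u).
have := H3 _ (imageT _ u); have := H4 _ (imageT _ u).
rewrite /weighted_partial /= !mulr1 !mul1r normr1 mul1r normrM !normrX.
have E (x : R) : `|x| ^+ (2 * k) = (x ^+ 2) ^+ k by rewrite exprM real_normK ?num_real.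
rewrite !E.
set n := cnorm (f u); set a := (u.1 ^+ 2) ^+ k; set b := (u.2 ^+ 2) ^+ k => h4 h3 h2 h1.
have n0 : 0 <= n := cnorm_ge0 _.
apply: (@le_trans _ _ (4 ^+ k * ((1 + a) * (1 + b)) * n)).
  rewrite ler_wpM2r// /bracket exprMn (_ : 4 = 2 * 2) ?exprMn -?natrM//.
  rewrite mulrACA ler_pM ?exprn_ge0 ?addr_ge0 ?sqr_ge0// expr1D_le ?sqr_ge0//.
rewrite -mulrA ler_wpM2l ?exprn_ge0//; lra.
Qed.

Lemma is_schwartz_elim f : is_schwartz f ->
  [/\ ccont f, rapid f & forall i, is_schwartz (partial i f) /\ cder i f (partial i f)].
Proof.
move=> sf; split; first exact: (smooth_ccont [::] sf.1).
- exact: is_schwartz_rapid.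
- move=> i; split; first exact: is_schwartz_partial.
  exact: (smooth_cder [::] i sf.1).
Qed.

Lemma is_schwartz_lin (a : R[i]) f g : is_schwartz f -> is_schwartz g ->
  is_schwartz (fun u => a * f u + g u).
Proof.
move=> /asboolP sf /asboolP sg; apply/asboolP.
exact: (schwartz_submod_closed.2 a _ _ sf sg).
Qed.

Lemma is_schwartz0 : is_schwartz (fun _ : plane R => 0 : R[i]).
Proof. by apply/asboolP; exact: schwartz_submod_closed.1. Qed.

Lemma is_schwartzZ (a : R[i]) f : is_schwartz f -> is_schwartz (fun u => a * f u).
Proof.
move=> sf; have := is_schwartz_lin a sf is_schwartz0.
by congr is_schwartz; apply/funext => u; rewrite addr0.
Qed.

Lemma is_schwartzB f g : is_schwartz f -> is_schwartz g ->
  is_schwartz (fun u => f u - g u).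
Proof.
move=> sf sg; have := is_schwartz_lin (-1) sg sf.
by congr is_schwartz; apply/funext => u; rewrite mulN1r addrC.
Qed.

Definition crd i u : R[i] := (if i then u.2 else u.1)%:C.

Lemma ccont_crd i : ccont (crd i).
Proof.
apply: ccont_real => u; case: i; [exact: cvg_snd|exact: cvg_fst].
Qed.

Lemma cnorm_crd i u : cnorm (crd i u) <= bracket u.
Proof. by rewrite /crd cnormR; case: i; [exact: bracket_snd|exact: bracket_fst]. Qed.

Lemma cder_crd i j : cder i (crd j) (fun=> (i == j)%:R).
Proof.
apply: (@cder_quad _ _ _ _ (fun=> 0)) => u t _; rewrite mul0r.
rewrite (_ : _ - _ - _ = 0) ?cnorm0//.
rewrite /crd; case: i; case: j; rewrite /= /GRing.scale/= ?(mulr0, mulr1, addr0, subr0);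
  apply: complexP; rewrite ?(cReB, cImB, cReM, cImM) /=; ring.
Qed.

Lemma is_schwartz_crd i f : is_schwartz f -> is_schwartz (fun u => crd i u * f u).
Proof.
move=> sf.
(* The class has a second summand because the Leibniz rule adds a multiple of [f1] to the derivative
   of the product. *)
apply: (@is_schwartz_coind (fun g => exists f1 f2, [/\ is_schwartz f1, is_schwartz f2
    & g = fun u => crd i u * f1 u + f2 u])); last first.
  exists f, (fun=> 0); split => //; first exact: is_schwartz0.
  by apply/funext => u; rewrite addr0.
move=> _ [f1 [f2 [s1 s2 ->]]].
have [c1 r1 d1] := is_schwartz_elim s1; have [c2 r2 d2] := is_schwartz_elim s2.
split.
- by apply: ccontD => //; apply: ccontM => //; exact: ccont_crd.
- apply: rapidD => //; apply: (rapidMb (n := 1) (M := 1)) => // u.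
  by rewrite mul1r expr1 cnorm_crd.
- move=> j; have [p1 e1] := d1 j; have [p2 e2] := d2 j.
  exists (fun u => crd i u * partial j f1 u + ((j == i)%:R * f1 u + partial j f2 u)).
    exists (partial j f1), (fun u => (j == i)%:R * f1 u + partial j f2 u).
    by split => //; apply: is_schwartz_lin.
  apply: cder_ext (cderD (cderM (cder_crd j i) e1) e2) => // u.
  by rewrite addrA [crd i u * _ + _]addrC.
Qed.

(** Letters of mixed words: first component [true] marks a derivative, [false] a multiplication by a
    coordinate. Sup norms of such words control the Schwartz seminorms, and one more operator is
    just one more letter. *)
Definition sop (o : bool * bool) f : plane R -> R[i] :=
  if o.1 then partial o.2 f else fun u => crd o.2 u * f u.

Definition sops (s : seq (bool * bool)) f := foldr sop f s.

Lemma is_schwartz_sops s f : is_schwartz f -> is_schwartz (sops s f).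
Proof.
move=> sf; elim: s => [//|[[] i] s IH] /=; first exact: is_schwartz_partial.
exact: is_schwartz_crd.
Qed.

Lemma sops_lin s (a : R[i]) f g : is_schwartz f -> is_schwartz g ->
  sops s (fun u => a * f u + g u) = fun u => a * sops s f u + sops s g u.
Proof.
move=> sf sg; elim: s => [//|[[] i] s IH] /=; rewrite IH /sop /=.
  apply: cder_partial.
  have [_ _ /(_ i)[_ d1]] := is_schwartz_elim (is_schwartz_sops s sf).
  have [_ _ /(_ i)[_ d2]] := is_schwartz_elim (is_schwartz_sops s sg).
  exact: cderD (cderZ a d1) d2.
by apply/funext => u; ring.
Qed.

End SchwartzClass.

(** * Twisted Hermite functions and their products *)

Section ComplexHermitePolynomials.
Context {A : comRingType}.
Implicit Types (m n k : nat) (z w : A).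

(** Term of the complex Hermite polynomial H_mn, symmetric under exchanging m with n and w with z,
    unlike the Laguerre form with its case n <= m. For k beyond m or n a binomial coefficient
    vanishes, so truncated exponents do no harm and [chp_wide] can change the range. *)
Definition chp_term m n z w k : A :=
  (-1) ^+ k * (k`! * 'C(m, k) * 'C(n, k))%:R * w ^+ (m - k) * z ^+ (n - k).

Definition chp m n z w : A := \sum_(k < (m + n).+1) chp_term m n z w k.

Lemma chp_wide N m n z w : (minn m n <= N)%N ->
  \sum_(k < N.+1) chp_term m n z w k = chp m n z w.
Proof.
suff H M : (minn m n <= M)%N ->
    \sum_(k < M.+1) chp_term m n z w k = \sum_(k < (minn m n).+1) chp_term m n z w k.
  by move=> mN; rewrite H// /chp H// (leq_trans (geq_minl _ _))// leq_addr.
move=> mM; rewrite -!(big_mkord xpredT) (big_cat_nat (n := (minn m n).+1))//=.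
rewrite [X in _ + X]big_nat_cond [X in _ + X]big1 ?addr0// => k.
rewrite andbT => /andP[+ _]; rewrite gtn_min /chp_term => /orP[h|h].
  by rewrite (bin_small h) muln0 mul0n mulr0 !mul0r.
by rewrite (bin_small h) muln0 mulr0 !mul0r.
Qed.

Lemma chpC m n z w : chp m n z w = chp n m w z.
Proof.
rewrite /chp addnC; apply: eq_bigr => k _; rewrite /chp_term.
by rewrite mulnAC -!mulrA [w ^+ _ * _]mulrC.
Qed.

Lemma chp0n n z w : chp 0 n z w = z ^+ n.
Proof.
rewrite -(@chp_wide 0) ?min0n// big_ord1 /chp_term.
by rewrite fact0 !bin0 expr0 !mul1r subn0.
Qed.

Lemma chpn0 n z w : chp n 0 z w = w ^+ n.
Proof. by rewrite chpC chp0n. Qed.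

(** Pascal's rule splits the binomial of m+1, and (k+1) C(n,k+1) = n C(n-1,k) recognises the second
    part as a lowered polynomial. At n = 0 the coefficient kills the term at [n.-1], so this
    relation and the ladder relations drawn from it hold for all indices. *)
Lemma chpSl m n z w : chp m.+1 n z w = w * chp m n z w - n%:R * chp m n.-1 z w.
Proof.
pose N := (m + n).+1.
have hN a b : (a <= m.+1)%N -> (minn a b <= N)%N.
  by move=> h; rewrite geq_min (leq_trans h)// ltnS leq_addr.
rewrite -(@chp_wide N) ?hN// -(@chp_wide N m n) ?hN//.
rewrite -(@chp_wide (m + n) m n.-1); last first.
  by rewrite geq_min leq_addr.
rewrite big_ord_recl [X in w * X]big_ord_recl /=.
rewrite mulrDr -addrA; congr (_ + _).
  rewrite /chp_term fact0 !bin0 expr0 !mul1r !subn0 exprS; ring.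
rewrite !mulr_sumr -sumrB; apply: eq_bigr => k _.
rewrite /bump /= add1n /chp_term binS mulnDr mulnDl natrD exprS.
have E1 : n%:R * ((k`! * 'C(m, k) * 'C(n.-1, k))%:R : A) =
    ((k.+1)`! * 'C(m, k) * 'C(n, k.+1))%:R.
  rewrite -natrM; congr (_%:R); rewrite factS.
  transitivity (k`! * 'C(m, k) * (n * 'C(n.-1, k)))%N; first by rewrite mulnCA.
  by rewrite mul_bin_diag mulnCA !mulnA.
have -> : (n.-1 - k = n - k.+1)%N by lia.
rewrite subSS.
have E2 : ('C(m, k.+1))%:R * w ^+ (m - k) = w * (('C(m, k.+1))%:R * w ^+ (m - k.+1)) :> A.
  have [h|h] := ltnP k m; last by rewrite bin_small// !mul0r mulr0.
  by rewrite (_ : (m - k = (m - k.+1).+1)%N) ?exprS; [ring|lia].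
have -> : n%:R * ((-1) ^+ k * (k`! * 'C(m, k) * 'C(n.-1, k))%:R * w ^+ (m - k) * z ^+ (n - k.+1)) =
  (-1) ^+ k * (n%:R * (k`! * 'C(m, k) * 'C(n.-1, k))%:R) * w ^+ (m - k) * z ^+ (n - k.+1) by ring.
rewrite {}E1; move: (k.+1)`! => F; rewrite !natrM.
set x := w ^+ (m - k) in E2 *; set y := w ^+ (m - k.+1) in E2 *.
set zz := z ^+ _; set f := F%:R; set a := ('C(m, k.+1))%:R in E2 *.
set b := ('C(m, k))%:R; set c := ('C(n, k.+1))%:R; set s := (-1) ^+ k.
have -> : -1 * s * (f * a * c + f * b * c) * x * zz =
  - s * f * c * zz * (a * x) - s * f * b * c * x * zz by ring.
by rewrite E2; ring.
Qed.

Lemma chpSr m n z w : chp m n.+1 z w = z * chp m n z w - m%:R * chp m.-1 n z w.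
Proof. by rewrite chpC chpSl !(chpC n). Qed.

End ComplexHermitePolynomials.

(** * The functions f_mn: ladder relations, smoothness and decay *)

Section TwistedHermite.
Context {R : realType}.
Implicit Types (f g h : plane R -> R[i]) (u v : plane R) (i : bool) (m n : nat).

Definition zed u : R[i] := u.1 +i* u.2.
Definition zedb u : R[i] := u.1 -i* u.2.
Definition gauss u : R := expR (- ((u.1 ^+ 2 + u.2 ^+ 2) / 2)).

Definition hcoef m n : R := 2 / Num.sqrt (m`! * n`!)%:R.

(** In this symmetric form conjugation exchanges m and n, so each ladder relation gives a second one
    by conjugation. The normalisation 2 / sqrt(m! n!) is what remains of 2 sqrt(n! / m!) once a
    factor n! goes into the Laguerre sum. *)
Definition herm m n u : R[i] :=
  (hcoef m n)%:C * chp m n (zed u) (zedb u) * (gauss u)%:C.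

(* Conjugation with a fixed ring structure, so that it can be rewritten. *)
Definition cj (z : R[i]) : R[i] := conjc z.

Lemma cjM z w : cj (z * w) = cj z * cj w.
Proof. exact: rmorphM. Qed.

Lemma cjD z w : cj (z + w) = cj z + cj w.
Proof. exact: rmorphD. Qed.

Lemma cj_real (a : R) : cj a%:C = a%:C.
Proof. by apply: complexP; rewrite /= ?oppr0. Qed.

Lemma cjX z n : cj (z ^+ n) = cj z ^+ n.
Proof. exact: rmorphXn. Qed.

Lemma cjK z : cj (cj z) = z.
Proof. exact: conjcK. Qed.

Lemma cj_chp m n z w : cj (chp m n z w) = chp m n (cj z) (cj w).
Proof.
rewrite /chp [LHS]rmorph_sum; apply: eq_bigr => k _; rewrite /chp_term.
move: (k`! * _ * _)%N => c.
rewrite -[LHS]/(cj _) !cjM !cjX; congr (_ * _ * _ * _); last exact: rmorph_nat.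
by congr (_ ^+ _); exact: rmorphN1.
Qed.

Lemma cj_zed u : cj (zed u) = zedb u.
Proof. by []. Qed.

Lemma cj_zedb u : cj (zedb u) = zed u.
Proof. by rewrite -cj_zed cjK. Qed.

Lemma hcoefC m n : hcoef m n = hcoef n m.
Proof. by rewrite /hcoef mulnC. Qed.

Lemma cj_herm m n u : cj (herm m n u) = herm n m u.
Proof. by rewrite /herm !cjM !cj_real cj_chp chpC hcoefC cj_zed cj_zedb. Qed.

Lemma sqrt_fact_ratio m n :
  Num.sqrt (n`!%:R / m`!%:R) = n`!%:R / Num.sqrt (m`! * n`!)%:R :> R.
Proof.
have n0 : 0 < n`!%:R :> R by rewrite ltr0n fact_gt0.
have m0 : 0 < m`!%:R :> R by rewrite ltr0n fact_gt0.
rewrite natrM sqrtrM ?ltW// sqrtrM ?ltW// sqrtrV ?ltW//.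
have sn : Num.sqrt n`!%:R != 0 :> R by rewrite gt_eqF// sqrtr_gt0.
have sm : Num.sqrt m`!%:R != 0 :> R by rewrite gt_eqF// sqrtr_gt0.
rewrite -{2}(sqr_sqrtr (ltW n0)); field; by rewrite sn sm.
Qed.

Lemma hermite_lowerE m n u : (n <= m)%N -> hermite_lower m n u = herm m n u.
Proof.
move=> nm; rewrite /hermite_lower /herm -/(zedb u) -/(gauss u).
rewrite rcM mulrA; congr (_ * _).
rewrite sqrt_fact_ratio /hcoef -(@chp_wide _ n) ?geq_minr//.
(* The Laguerre sum ascends in powers of z zbar while [chp] descends; the reversal k to n - k
   matches them and accounts for the sign (-1)^n. *)
rewrite /laguerre (reindex_inj rev_ord_inj) /=.
have zz : zed u * zedb u = (u.1 ^+ 2 + u.2 ^+ 2)%:C.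
  by apply: complexP; rewrite ?cReM ?cImM /=; ring.
rewrite rc_sum !mulr_sumr; apply: eq_bigr => k _.
rewrite subSS /chp_term; have kn : (k <= n)%N by rewrite -ltnS.
rewrite subKn// subnKC//.
have -> : zedb u ^+ (m - k) = zedb u ^+ (m - n) * zedb u ^+ (n - k).
  by rewrite -exprD; congr (_ ^+ _); lia.
have E : ('C(m, k))%:R * (n`!%:R / (n - k)`!%:R) = (k`! * 'C(m, k) * 'C(n, k))%:R :> R.
  rewrite -(bin_fact kn) !natrM; field.
  by rewrite pnatr_eq0 -lt0n fact_gt0.
have E2 : (-1) ^+ n * (-1) ^+ (n - k) = (-1) ^+ k :> R.
  by rewrite -exprD -signr_odd oddD oddB// addbA addbb addFb signr_odd.
rewrite -rc_nat -E.
have -> : (-1) ^+ k = ((-1) ^+ k)%:C :> R[i] by rewrite rcX rcN.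
rewrite -E2 !rcM rcX -zz exprMn; ring.
Qed.

Lemma twisted_hermiteE m n u : twisted_hermite m n u = herm m n u.
Proof.
rewrite /twisted_hermite; case: leqP => h; first exact: hermite_lowerE.
rewrite (hermite_lowerE _ (ltnW h)); exact: cj_herm.
Qed.

Definition csqrt n : R[i] := (Num.sqrt n%:R)%:C.

Lemma csqrt_sqr n : csqrt n * csqrt n = n%:R.
Proof. by rewrite -rcM -expr2 sqr_sqrtr ?ler0n// rc_nat. Qed.

Lemma hcoefE m n : hcoef m n = 2 / (Num.sqrt m`!%:R * Num.sqrt n`!%:R).
Proof. by rewrite /hcoef natrM sqrtrM. Qed.

Lemma hcoefS m n : (hcoef m n)%:C = csqrt m.+1 * (hcoef m.+1 n)%:C.
Proof.
rewrite -rcM; congr (_%:C); rewrite !hcoefE factS (natrM _ m.+1) (sqrtrM _ (ler0n _ m.+1)).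
have h : Num.sqrt m.+1%:R != 0 :> R by rewrite gt_eqF// sqrtr_gt0.
have p k : Num.sqrt k`!%:R != 0 :> R by rewrite gt_eqF// sqrtr_gt0 ltr0n fact_gt0.
by field; rewrite h !p.
Qed.

Lemma hcoefP m n : (hcoef m n)%:C * n%:R = csqrt n * (hcoef m n.-1)%:C.
Proof.
case: n => [|n]; first by rewrite /csqrt sqrtr0 mulr0 mul0r.
by rewrite [n.+1.-1]/= (hcoefC m n) (hcoefC m n.+1) (hcoefS n m) mulrA csqrt_sqr mulrC.
Qed.

Lemma zedb_herm m n u : zedb u * herm m n u =
  csqrt m.+1 * herm m.+1 n u + csqrt n * herm m n.-1 u.
Proof.
rewrite /herm chpSl !mulrA -hcoefS -hcoefP; ring.
Qed.

Lemma zed_herm m n u : zed u * herm m n u =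
  csqrt n.+1 * herm m n.+1 u + csqrt m * herm m.-1 n u.
Proof.
have := congr1 cj (zedb_herm n m u).
rewrite cjD (cjM (zedb u)) (cjM (csqrt n.+1)) (cjM (csqrt m)) !cj_herm cj_zedb.
by rewrite /csqrt !cj_real.
Qed.

Lemma rder_comp (phi dphi : R -> R) i (f g : plane R -> R) :
  (forall x : R, is_derive x 1 phi (dphi x)) -> rder i f g ->
  rder i (fun u => phi (f u)) (fun u => dphi (f u) * g u).
Proof.
move=> dp df u; have e0 : u + (0 : R) *: basis_vec i = u by rewrite scale0r addr0.
rewrite -e0; apply/is_derive_line.
have := rder_line u 0 df => d1.
exact: (is_derive1_comp (dp _) d1).
Qed.

Definition dz i : R[i] := if i then 0 +i* 1 else 1.

Lemma zed_crd u : zed u = crd false u + (0 +i* 1) * crd true u.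
Proof. by apply: complexP; rewrite ?(cReD, cImD, cReM, cImM) /=; ring. Qed.

Lemma zedb_crd u : zedb u = crd false u - (0 +i* 1) * crd true u.
Proof. by apply: complexP; rewrite ?(cReB, cImB, cReM, cImM) /=; ring. Qed.

Lemma crd_zed i u : crd i u = 2^-1 * (cj (dz i) * zed u + dz i * zedb u).
Proof.
have h : (2^-1 : R[i]) = (2^-1)%:C by rewrite -[2](rc_nat 2); exact/esym/fmorphV.
rewrite h; case: i; apply: complexP;
  rewrite !(cReM, cImM, cReD, cImD) /=; by field.
Qed.

Lemma cder_zed i : cder i zed (fun=> dz i).
Proof.
apply: cder_ext (cderD (cder_crd i false) (cderZ (0 +i* 1) (cder_crd i true))).
  by move=> u; rewrite zed_crd.
by move=> u; case: i; rewrite /= ?mulr0 ?mulr1 ?add0r ?addr0.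
Qed.

Lemma cder_zedb i : cder i zedb (fun=> cj (dz i)).
Proof.
apply: cder_ext (cderB (cder_crd i false) (cderZ (0 +i* 1) (cder_crd i true))).
  by move=> u; rewrite zedb_crd.
by move=> u; apply: complexP; case: i; rewrite !(cReB, cImB, cReM, cImM) /=; ring.
Qed.

(** Chain rule through [zed] and [zedb], whose derivatives along [i] are [dz i] and its conjugate:
    d/dz of H_mn is n H_{m,n-1} and d/dzbar is m H_{m-1,n}, both obtained by induction along the
    recurrences. *)
Lemma cder_chp i m n :
  cder i (fun u => chp m n (zed u) (zedb u))
    (fun u => dz i * (n%:R * chp m n.-1 (zed u) (zedb u)) +
      cj (dz i) * (m%:R * chp m.-1 n (zed u) (zedb u))).
Proof.
elim: m n => [n|m IH n].
  elim: n => [|n IH].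
    apply: cder_ext (cder_cst i 1) => u; first by rewrite chp0n.
    by rewrite !mul0r !mulr0 addr0.
  apply: cder_ext (cderM (cder_zed i) IH) => u.
    by rewrite chpSr mul0r subr0.
  have E : n%:R * chp 0 n (zed u) (zedb u) = n%:R * (zed u * chp 0 n.-1 (zed u) (zedb u)).
    by case: n {IH} => [|n]; rewrite ?mul0r//= chpSr mul0r subr0.
  by rewrite [n.+1.-1]/= -natr1 (mulrDl n%:R) mul1r E; ring.
apply: cder_ext (cderB (cderM (cder_zedb i) (IH n)) (cderZ n%:R (IH n.-1))) => u.
  by rewrite chpSl.
set D := fun a b => chp a b (zed u) (zedb u).
have E : m%:R * D m n = m%:R * (zedb u * D m.-1 n - n%:R * D m.-1 n.-1).
  by case: m {IH} => [|m]; rewrite ?mul0r//= /D chpSl.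
have E2 : D m.+1 n.-1 = zedb u * D m n.-1 - (n.-1)%:R * D m n.-2 by rewrite /D chpSl.
rewrite /= -/(D m n) -/(D m n.-1) -/(D m.-1 n) -/(D m n.-2) -/(D m.-1 n.-1) -/(D m.+1 n.-1).
rewrite E2 -(natr1 m).
have -> : cj (dz i) * ((m%:R + 1) * D m n) = cj (dz i) * (m%:R * D m n) + cj (dz i) * D m n by ring.
by rewrite E; ring.
Qed.

Lemma cder_gauss i : cder i (fun u => (gauss u)%:C) (fun u => - crd i u * (gauss u)%:C).
Proof.
have sq j : rder i (fun u : plane R => (if j then u.2 else u.1) ^+ 2)
    (fun u => 2 * (i == j)%:R * (if j then u.2 else u.1)).
  have d := (@cder_crd R i j).1.
  apply: rder_ext (rderM d d) => u.
  by rewrite /re_part /=; case: (i == j) => /=; ring.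
have dg : rder i gauss (fun u => - (if i then u.2 else u.1) * gauss u).
  have h : rder i (fun u : plane R => - ((u.1 ^+ 2 + u.2 ^+ 2) / 2))
      (fun u => - (if i then u.2 else u.1)).
    apply: rder_ext (rderN (rderM (rderD (sq false) (sq true)) (rder_cst i 2^-1))) => u.
    by case: i {sq} => /=; field.
  apply: rder_ext (rder_comp (@is_derive_expR R) h) => u.
  by rewrite mulrC.
split.
  by apply: rder_ext dg => u; rewrite /re_part -rcN -rcM.
by apply: rder_ext (rder_cst i 0) => u; rewrite /im_part -rcN -rcM.
Qed.

Lemma cder_herm i m n : cder i (herm m n) (fun u =>
  2^-1 * (dz i * (csqrt n * herm m n.-1 u - csqrt m.+1 * herm m.+1 n u) +
    cj (dz i) * (csqrt m * herm m.-1 n u - csqrt n.+1 * herm m n.+1 u))).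
Proof.
apply: cder_ext (cderM (cderZ (hcoef m n)%:C (cder_chp i m n)) (cder_gauss i)) => // u.
have e1 := zedb_herm m n u; have e2 := zed_herm m n u.
have -> : csqrt m.+1 * herm m.+1 n u = zedb u * herm m n u - csqrt n * herm m n.-1 u.
  by rewrite e1 addrK.
have -> : csqrt n.+1 * herm m n.+1 u = zed u * herm m n u - csqrt m * herm m.-1 n u.
  by rewrite e2 addrK.
have -> : csqrt n * herm m n.-1 u = (hcoef m n)%:C * n%:R * chp m n.-1 (zed u) (zedb u) * (gauss u)%:C.
  by rewrite /herm hcoefP; ring.
have -> : csqrt m * herm m.-1 n u = (hcoef m n)%:C * m%:R * chp m.-1 n (zed u) (zedb u) * (gauss u)%:C.
  by rewrite /herm (hcoefC m n) hcoefP (hcoefC n); ring.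
by rewrite crd_zed /herm; field.
Qed.

Lemma crd_herm i m n u : crd i u * herm m n u =
  2^-1 * (dz i * (csqrt n * herm m n.-1 u + csqrt m.+1 * herm m.+1 n u) +
    cj (dz i) * (csqrt m * herm m.-1 n u + csqrt n.+1 * herm m n.+1 u)).
Proof.
rewrite crd_zed -mulrA mulrDl -!mulrA zedb_herm zed_herm; congr (_ * _); ring.
Qed.

Lemma rapid_gauss : rapid (fun u => (gauss u)%:C).
Proof.
(* The k-th power of y <= exp y at y = (1 + x) / (2 k). Used for q^2 and p^2, it leaves two factors
   exp(1/2), whence the constant [expR 1] below. *)
have H k (x : R) : 0 <= x -> (1 + x) ^+ k <= (2 * k%:R) ^+ k * expR ((1 + x) / 2).
  move=> x0; case: k => [|k]; first by rewrite !expr0 mul1r -expR0 ler_expR divr_ge0// addr_ge0.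
  have kp : 0 < k.+1%:R :> R by [].
  have -> : (1 + x) / 2 = k.+1%:R * ((1 + x) / (2 * k.+1%:R)) by field; rewrite gt_eqF.
  rewrite expRM_natl -exprMn lerXn2r ?nnegrE ?mulr_ge0 ?addr_ge0 ?expR_ge0//.
  rewrite -ler_pdivrMl ?mulr_gt0// mulrC (le_trans _ (expR_ge1Dx _))//.
  by rewrite lerDr.
move=> k; exists ((2 * k%:R) ^+ k * (2 * k%:R) ^+ k * expR 1) => u.
rewrite cnormR ger0_norm ?expR_ge0// /gauss.
have e1 : expR 1 * expR (- ((u.1 ^+ 2 + u.2 ^+ 2) / 2)) * (expR ((1 + u.1 ^+ 2) / 2) * expR ((1 + u.2 ^+ 2) / 2)) = expR 1 * expR 1.
  rewrite -!expRD; congr expR; by field.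
have := ler_pM _ _ (H k _ (sqr_ge0 u.1)) (H k _ (sqr_ge0 u.2)).
rewrite !exprn_ge0 ?addr_ge0 ?sqr_ge0// -exprMn => /(_ isT isT) h.
have g0 := expR_gt0 (- ((u.1 ^+ 2 + u.2 ^+ 2) / 2)).
have h2 := ler_wpM2r (ltW g0) h; apply: le_trans h2 _.
have p1 := expR_gt0 (1 : R).
rewrite -(ler_pM2l p1).
rewrite [leLHS](_ : _ = (2 * k%:R) ^+ k * (2 * k%:R) ^+ k * (expR 1 * expR (- ((u.1 ^+ 2 + u.2 ^+ 2) / 2)) * (expR ((1 + u.1 ^+ 2) / 2) * expR ((1 + u.2 ^+ 2) / 2)))); last by ring.
by rewrite e1 [leRHS](_ : _ = (2 * k%:R) ^+ k * (2 * k%:R) ^+ k * (expR 1 * expR 1)); last by ring.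
Qed.

Lemma ccont_gauss : ccont (fun u => (gauss u)%:C).
Proof.
have [K gK] := rapid_gauss 1%N.
apply: (cder_ccont (cder_gauss false) (cder_gauss true) (M := K)) => u;
  rewrite cnormM cnormN (le_trans _ (gK u))// ler_wpM2r ?cnorm_ge0//.
all: by rewrite expr1 cnorm_crd.
Qed.

Lemma ccont_zed : ccont zed.
Proof.
split; [exact: (ccont_crd false).1|exact: (ccont_crd true).1].
Qed.

Lemma ccont_zedb : ccont zedb.
Proof.
have h : zedb = fun u => crd false u + - (0 +i* 1) * crd true u.
  by apply/funext => u; rewrite zedb_crd mulNr.
by rewrite h; apply: ccontD; [|apply: ccontM; first exact: ccont_cst]; exact: ccont_crd.
Qed.

Lemma cnorm_zed u : cnorm (zed u) <= 2 * bracket u.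
Proof.
rewrite (le_trans (cnorm_ReIm _))//= mulr_natl mulr2n.
by rewrite lerD ?bracket_fst ?bracket_snd.
Qed.

Lemma cnorm_zedb u : cnorm (zedb u) <= 2 * bracket u.
Proof. by rewrite -cj_zed cnormC cnorm_zed. Qed.

Lemma herm_nice m n : ccont (herm m n) /\ rapid (herm m n).
Proof.
suff [c r] : ccont (fun u => chp m n (zed u) (zedb u) * (gauss u)%:C) /\
    rapid (fun u => chp m n (zed u) (zedb u) * (gauss u)%:C).
  have -> : herm m n = fun u => (hcoef m n)%:C * (chp m n (zed u) (zedb u) * (gauss u)%:C).
    by apply/funext => u; rewrite /herm mulrA.
  by split; [apply: ccontM => //; exact: ccont_cst|exact: rapidZ].
have zb1 f : rapid f -> rapid (fun u => zedb u * f u).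
  by apply: (rapidMb (n := 1) (M := 2)) => u; rewrite expr1 cnorm_zedb.
have z1 f : rapid f -> rapid (fun u => zed u * f u).
  by apply: (rapidMb (n := 1) (M := 2)) => u; rewrite expr1 cnorm_zed.
elim: m n => [|m IH] n.
  elim: n => [|n [c r]].
    by under eq_fun do rewrite chp0n mul1r; split; [exact: ccont_gauss|exact: rapid_gauss].
  have -> : (fun u => chp 0 n.+1 (zed u) (zedb u) * (gauss u)%:C) =
      fun u => zed u * (chp 0 n (zed u) (zedb u) * (gauss u)%:C).
    by apply/funext => u; rewrite chpSr mul0r subr0 mulrA.
  by split; [apply: ccontM => //; exact: ccont_zed|exact: z1].
have [c r] := IH n; have [c' r'] := IH n.-1.
have -> : (fun u => chp m.+1 n (zed u) (zedb u) * (gauss u)%:C) =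
  fun u => zedb u * (chp m n (zed u) (zedb u) * (gauss u)%:C) +
     (- n%:R) * (chp m n.-1 (zed u) (zedb u) * (gauss u)%:C).
  by apply/funext => u; rewrite chpSl; ring.
split; first by apply: ccontD; apply: ccontM => //; [exact: ccont_zedb|exact: ccont_cst].
by apply: rapidD; [exact: zb1|exact: rapidZ].
Qed.

(** Class for the coinduction of [is_schwartz_herm]: by [cder_herm] a derivative of f_mn is a
    combination of its neighbours. *)
Inductive herm_span : (plane R -> R[i]) -> Prop :=
| herm_span1 m n : herm_span (herm m n)
| herm_span_lin (a b : R[i]) f g : herm_span f -> herm_span g ->
    herm_span (fun u => a * f u + b * g u).

Lemma is_schwartz_herm m n : is_schwartz (herm m n).
Proof.
apply: (@is_schwartz_coind _ herm_span); last exact: herm_span1.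
move=> g; elim=> {m n g} [m n|a b f g sf [cf rf df] sg [cg rg dg]].
  have [c r] := herm_nice m n; split=> // i.
  eexists; last exact: cder_herm.
  have -> : (fun u => 2^-1 * (dz i * (csqrt n * herm m n.-1 u - csqrt m.+1 * herm m.+1 n u) +
     cj (dz i) * (csqrt m * herm m.-1 n u - csqrt n.+1 * herm m n.+1 u))) =
     fun u => 2^-1 * (dz i * csqrt n * herm m n.-1 u + - (dz i * csqrt m.+1) * herm m.+1 n u) +
       2^-1 * (cj (dz i) * csqrt m * herm m.-1 n u + - (cj (dz i) * csqrt n.+1) * herm m n.+1 u).
    by apply/funext => u; ring.
  have S a b k l k' l' := herm_span_lin a b (herm_span1 k l) (herm_span1 k' l').
  exact: herm_span_lin (S _ _ _ _ _ _) (S _ _ _ _ _ _).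
split.
- by apply: ccontD; apply: ccontM => //; exact: ccont_cst.
- by apply: rapidD; exact: rapidZ.
- move=> i; have [f' sf' df'] := df i; have [g' sg' dg'] := dg i.
  exists (fun u => a * f' u + b * g' u); first exact: herm_span_lin.
  by apply: cderD; exact: cderZ.
Qed.

End TwistedHermite.

(** * Gaussian integrals *)

Section GaussianIntegral.
Context {R : realType}.
Implicit Types (f g h : plane R -> R[i]) (u v w : plane R) (i : bool).
Local Notation mu := (@lebesgue_measure R).

Lemma continuous_expR_sqr (a x0 : R) :
  continuous (fun x : R => expR (- (a * (x - x0) ^+ 2))).
Proof.
move=> x; apply: (@continuous_comp _ _ _ (fun x : R => - (a * (x - x0) ^+ 2)) expR).
  have -> : (fun x : R => - (a * (x - x0) ^+ 2)) = fun x : R => - (a * ((x - x0) * (x - x0))).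
    by apply/funext => y; rewrite expr2.
  by apply: cvgN; apply: cvgMr; apply: cvgM; apply: cvgB => //; exact: cvg_cst.
exact: continuous_expR.
Qed.

Lemma integral_expR_sqr (a x0 : R) : 0 < a ->
  (\int[mu]_x (expR (- (a * (x - x0) ^+ 2)))%:E = (Num.sqrt (pi / a))%:E)%E.
Proof.
move=> a0; pose s : R := Num.sqrt (2 * a)^-1.
have s20 : 0 < (2 * a)^-1 by rewrite invr_gt0 mulr_gt0.
have s2 : s ^+ 2 = (2 * a)^-1 by rewrite sqr_sqrtr// ltW.
have s0 : s != 0 by rewrite gt_eqF// sqrtr_gt0.
have p0 := normal_peak_gt0 s0.
have := integral_normal_pdf x0 s.
under eq_integral => x _.
  rewrite normal_pdfE// /normal_fun s2.
  have -> : - (x - x0) ^+ 2 / ((2 * a)^-1 *+ 2) = - (a * (x - x0) ^+ 2).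
    rewrite -mulr_natr; field; by rewrite gt_eqF.
  rewrite EFinM; over.
rewrite ge0_integralZl//=; last 2 first.
- apply/measurable_EFinP; apply: continuous_measurable_fun.
  exact: continuous_expR_sqr.
- by rewrite lee_fin ltW.
have E : normal_peak s = (Num.sqrt (pi / a))^-1.
  rewrite /normal_peak s2; congr (Num.sqrt _)^-1.
  by rewrite -mulr_natr; field; rewrite gt_eqF.
have q0 : 0 < Num.sqrt (pi / a) by rewrite sqrtr_gt0 divr_gt0 ?pi_gt0.
rewrite E; set I := (\int[mu]_x _)%E.
move=> /(congr1 (fun z => (Num.sqrt (pi / a))%:E * z)%E).
by rewrite muleA -EFinM divff ?gt_eqF// mul1e mule1.
Qed.

Lemma rint_gaussian (a : R) u0 : 0 < a ->
  rint (fun u => expR (- (a * ((u.1 - u0.1) ^+ 2 + (u.2 - u0.2) ^+ 2)))) = pi / a.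
Proof.
move=> a0; have c x0 := @continuous_expR_sqr a x0.
have := rint_product (c u0.1) (c u0.2) (fun=> expR_ge0 _) (fun=> expR_ge0 _)
  (integral_expR_sqr u0.1 a0) (integral_expR_sqr u0.2 a0).
rewrite -expr2 sqr_sqrtr ?divr_ge0 ?pi_ge0 ?ltW// => <-; congr rint; apply/funext => u.
by rewrite -expRD; congr expR; ring.
Qed.

Lemma cintegral_real (h : plane R -> R) : cintegral (fun u => (h u)%:C) = (rint h)%:C.
Proof.
rewrite cintegralE /re_part /im_part /=; apply: complexP => //=.
rewrite -[RHS](mul0r (rint plorentz)) -rintZ; last exact: rdom_plorentz.
by congr rint; apply/funext => u; rewrite mul0r.
Qed.

Lemma cintegral_gauss : cintegral (fun u : plane R => (gauss u)%:C) = (2 * pi)%:C.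
Proof.
rewrite cintegral_real; congr (_%:C).
have h : 0 < 2^-1 :> R by rewrite invr_gt0.
have := rint_gaussian (0, 0) h; rewrite invrK mulrC => <-; congr rint.
by apply/funext => u; rewrite /gauss /= !subr0; congr expR; ring.
Qed.

Lemma cintegral_gauss2 :
  cintegral (fun u : plane R => (gauss u)%:C * (gauss u)%:C) = pi%:C.
Proof.
have -> : (fun u : plane R => (gauss u)%:C * (gauss u)%:C) =
    fun u => (gauss u * gauss u)%:C by apply/funext => u; rewrite rcM.
rewrite cintegral_real; congr (_%:C).
have := rint_gaussian (0, 0) (@ltr01 R); rewrite divr1 => <-; congr rint.
apply/funext => u; rewrite /gauss /= !subr0 -expRD; congr expR.
by rewrite -opprD mul1r -splitr.
Qed.

(* [J] times the inverse Gaussian has vanishing derivatives. *)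
Lemma gaussian_ode (J : plane R -> R[i]) :
  (forall i, cder i J (fun u => - crd i u * J u)) ->
  forall u, J u = J (0, 0) * (gauss u)%:C.
Proof.
move=> dJ; pose ig u : R := expR ((u.1 ^+ 2 + u.2 ^+ 2) / 2).
have sq i j : rder i (fun u : plane R => (if j then u.2 else u.1) ^+ 2)
    (fun u => 2 * (i == j)%:R * (if j then u.2 else u.1)).
  have d := (@cder_crd R i j).1.
  apply: rder_ext (rderM d d) => u.
  by rewrite /re_part /=; case: (i == j) => /=; ring.
have dig i : cder i (fun u => (ig u)%:C) (fun u => crd i u * (ig u)%:C).
  have h : rder i (fun u : plane R => (u.1 ^+ 2 + u.2 ^+ 2) / 2)
      (fun u => if i then u.2 else u.1).
    apply: rder_ext (rderM (rderD (sq i false) (sq i true)) (rder_cst i 2^-1)) => u.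
    by case: i {sq} => /=; field.
  have h2 := rder_comp (@is_derive_expR R) h.
  split; first by apply: rder_ext h2 => u; rewrite /re_part -rcM mulrC.
  by apply: rder_ext (rder_cst i 0) => u; rewrite /im_part -rcM.
have d0 i : cder i (fun u => J u * (ig u)%:C) (fun=> 0).
  by apply: cder_ext (cderM (dJ i) (dig i)) => // u; ring.
move=> u; have := cder0_cst (d0 false) (d0 true) u (0, 0).
rewrite {2}/ig /= expr0n addr0 mul0r expR0 mulr1 => <-.
by rewrite -mulrA -rcM /ig /gauss -expRD subrr expR0 mulr1.
Qed.
End GaussianIntegral.

(** * Phases and the symplectic Fourier transform *)

Section TwistedHermiteProducts.
Context {R : realType}.
Implicit Types (f g h : plane R -> R[i]) (u v w x : plane R) (i : bool).
Local Notation ii := (0 +i* 1 : R[i]).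

Lemma ii_sqr : ii * ii = -1.
Proof. by apply: complexP; rewrite !(cReM, cImM) /=; ring. Qed.

Definition symp_coef i u : R[i] := if i then crd false u else - crd true u.

Lemma sympC (u v : plane R) : symp u v = - symp v u.
Proof. by rewrite /symp; ring. Qed.

Lemma symp_crd i w : (symp w (basis_vec i))%:C = symp_coef i w :> R[i].
Proof.
rewrite /symp_coef /crd /symp; case: i => /=; rewrite -?rcN; congr (_%:C); ring.
Qed.

Lemma rder_symp i u : rder i (symp u) (fun w => symp u (basis_vec i)).
Proof.
move=> w; apply: (@is_derive_quad _ _ _ _ _ 0) => t _; rewrite mul0r.
rewrite (_ : _ - _ = 0) ?normr0// /symp; case: i; rewrite /= /GRing.scale/=; ring.
Qed.

Lemma rder_cexpi i (t dt : plane R -> R) : rder i t dt ->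
  cder i (fun u => cexpi (t u)) (fun u => ii * (dt u)%:C * cexpi (t u)).
Proof.
move=> dt1; split.
  apply: rder_ext (rder_comp (@is_derive_cos R) dt1) => u.
  by rewrite /re_part !(cReM, cImM) /=; ring.
apply: rder_ext (rder_comp (@is_derive_sin R) dt1) => u.
by rewrite /im_part !(cReM, cImM) /=; ring.
Qed.

(* d/dw exp(i u'Jw), with u'J e_i = symp_coef i u *)
Lemma cder_phase i u : cder i (fun w => cexpi (symp u w))
  (fun w => ii * symp_coef i u * cexpi (symp u w)).
Proof.
apply: cder_ext (rder_cexpi (rder_symp i u)) => // w.
by rewrite symp_crd.
Qed.

Lemma cder_phasel i w : cder i (fun u => cexpi (symp u w))
  (fun u => - (ii * symp_coef i w) * cexpi (symp u w)).
Proof.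
have -> : (fun u => cexpi (symp u w)) = fun u => cexpi (- symp w u).
  by apply/funext => u; rewrite sympC.
apply: cder_ext (rder_cexpi (rderN (rder_symp i w))) => // u.
by rewrite -(sympC u w) rcN symp_crd mulrN.
Qed.

Lemma ccont_cexpi (t dt0 dt1 : plane R -> R) (M : R) :
  rder false t dt0 -> rder true t dt1 ->
  (forall u, `|dt0 u| <= M) -> (forall u, `|dt1 u| <= M) -> ccont (fun u => cexpi (t u)).
Proof.
move=> d0 d1 M0 M1.
apply: (cder_ccont (rder_cexpi d0) (rder_cexpi d1) (M := M)) => u;
  rewrite !cnormM cnorm_cexpi cnormR cnorm_i normr1 mul1r mulr1; [exact: M0|exact: M1].
Qed.

Lemma ccont_phase u : ccont (fun w => cexpi (symp u w)).
Proof.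
apply: (ccont_cexpi (rder_symp false u) (rder_symp true u)
  (M := `|symp u (basis_vec false)| + `|symp u (basis_vec true)|)) => v.
  by rewrite lerDl.
by rewrite lerDr.
Qed.

Definition sfourier g x : R[i] := cintegral (fun w => g w * cexpi (symp x w)).

Lemma cdom_phase g x : cdom g -> cdom (fun w => g w * cexpi (symp x w)).
Proof.
move=> dg.
have -> : (fun w => g w * cexpi (symp x w)) = fun w => cexpi (symp x w) * g w.
  by apply/funext => w; rewrite mulrC.
apply: (cdomMb (M := 1)) => // [|w]; first exact: ccont_phase.
by rewrite cnorm_cexpi.
Qed.

Lemma is_schwartz_cdom f : is_schwartz f -> cdom f.
Proof. by move=> /is_schwartz_elim[c r _]; exact: rapid_cdom. Qed.

Lemma sfourier_lin (a : R[i]) f g x : cdom f -> cdom g ->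
  sfourier (fun w => a * f w + g w) x = a * sfourier f x + sfourier g x.
Proof.
move=> df dg; rewrite /sfourier -cintegralZ; last exact: cdom_phase.
rewrite -cintegralD; [|apply: cdomZ; exact: cdom_phase|exact: cdom_phase].
by apply: cintegral_ext => w; ring.
Qed.

Lemma sfourierZ (a : R[i]) f x : cdom f ->
  sfourier (fun w => a * f w) x = a * sfourier f x.
Proof.
move=> df; rewrite /sfourier -cintegralZ; last exact: cdom_phase.
by apply: cintegral_ext => w; ring.
Qed.

Lemma sfourier_bound g K x : ccont g -> (forall u, bracket u * cnorm (g u) <= K) ->
  cnorm (sfourier g x) <= 2 * pi ^+ 2 * K.
Proof.
move=> cg gK; apply: cintegral_bound.
  by apply: ccontM => //; exact: ccont_phase.
by move=> u; rewrite cnormM cnorm_cexpi mulr1.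
Qed.

Lemma is_schwartz_symp_coef i g : is_schwartz g ->
  is_schwartz (fun w => symp_coef i w * g w).
Proof.
move=> sg; rewrite /symp_coef; case: i; first exact: is_schwartz_crd.
have := is_schwartzZ (-1) (is_schwartz_crd true sg).
by congr is_schwartz; apply/funext => w; rewrite mulN1r mulNr.
Qed.

Lemma cder_sfourier i g : is_schwartz g -> cder i (sfourier g)
  (fun x => - ii * sfourier (fun w => symp_coef i w * g w) x).
Proof.
move=> sg; have s1 := is_schwartz_symp_coef i sg.
have s2 := is_schwartz_symp_coef i s1.
have [c2 r2 _] := is_schwartz_elim s2; have [K hK] := r2 1%N.
have -> : (fun x => - ii * sfourier (fun w => symp_coef i w * g w) x) =
    fun x => cintegral (fun w => g w * (- (ii * symp_coef i w) * cexpi (symp x w))).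
  apply/funext => x; rewrite -sfourierZ; last exact: is_schwartz_cdom.
  by apply: cintegral_ext => w; ring.
apply: (@cintegral_param _ i _ _ (fun x w => g w * (- (ii * symp_coef i w) *
   (- (ii * symp_coef i w) * cexpi (symp x w)))) K).
- by move=> w; apply: cderZ; exact: cder_phasel.
- by move=> w; apply: cderZ; apply: cderZ; exact: cder_phasel.
- by move=> x; apply: cdom_phase; exact: is_schwartz_cdom.
- move=> x.
  have -> : (fun w => g w * (- (ii * symp_coef i w) * cexpi (symp x w))) =
      fun w => - ii * ((symp_coef i w * g w) * cexpi (symp x w)).
    by apply/funext => w; ring.
  by apply: cdomZ; apply: cdom_phase; exact: is_schwartz_cdom.
- move=> x w; apply: le_trans (hK w).
  rewrite expr1 !cnormM !cnormN !cnormM cnorm_i normr1 !mul1r cnorm_cexpi mulr1.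
  by rewrite le_eqVlt; apply/orP; left; apply/eqP; ring.
Qed.

Lemma sfourier_partial i g x : is_schwartz g ->
  sfourier (partial i g) x = - ii * symp_coef i x * sfourier g x.
Proof.
move=> sg; have [cg rg /(_ i)[sp dg]] := is_schwartz_elim sg.
have dc := is_schwartz_cdom sg.
have dcp := cdom_phase x dc.
have E : (fun w => g w * (ii * symp_coef i x * cexpi (symp x w))) =
     fun w => ii * symp_coef i x * (g w * cexpi (symp x w)).
  by apply/funext => w; ring.
rewrite /sfourier (cintegral_by_parts dg (cder_phase i x)) ?E ?cintegralZ//.
- by rewrite !mulNr.
- by apply: cdom_phase; exact: is_schwartz_cdom.
- exact: cdomZ.
Qed.

Lemma ccont_sfourier g : is_schwartz g -> ccont (sfourier g).
Proof.
move=> sg.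
have b i : exists M, forall x, cnorm (- ii * sfourier (fun w => symp_coef i w * g w) x) <= M.
  have [c r _] := is_schwartz_elim (is_schwartz_symp_coef i sg).
  have [K hK] := r 1%N; exists (2 * pi ^+ 2 * K) => x.
  rewrite cnormM cnormN cnorm_i normr1 mul1r; exact: sfourier_bound.
have [M0 H0] := b false; have [M1 H1] := b true.
apply: (cder_ccont (cder_sfourier false sg) (cder_sfourier true sg) (M := Num.max M0 M1)) => u.
  by rewrite le_max H0.
by rewrite le_max H1 orbT.
Qed.

Lemma cder_shift i f g w : cder i f g -> cder i (fun v => f (v + w)) (fun v => g (v + w)).
Proof. by move=> [a b]; split; [exact: rder_shift a|exact: rder_shift b]. Qed.

Lemma ccont_shift f w : ccont f -> ccont (fun v => f (v + w)).
Proof.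
have c (h : plane R -> R) : continuous h -> continuous (fun v => h (v + w)).
  move=> ch v; apply: (@continuous_comp _ _ _ (fun v => v + w) h); last exact: ch.
  by apply: cvgD => //; exact: cvg_cst.
by move=> [a b]; split; [exact: c a|exact: c b].
Qed.

End TwistedHermiteProducts.

(** * How multiplications and derivatives pass through the twisted product *)

Section TwistedRelations.
Context {R : realType}.
Implicit Types (f g h : plane R -> R[i]) (u v w x : plane R) (i : bool) (m n k l : nat).
Local Notation ii := (0 +i* 1 : R[i]).

Definition tconst : R[i] := (4 * pi ^+ 2)^-1%:C.

(** The phase u'Jv + v'Jw + w'Ju equals u'Jv + (v-u)'Jw, so the integral over w is the symplectic
    Fourier transform of g at v - u. What remains is a single integral of f against a bounded
    kernel. *)
Definition tkernel g u v : R[i] := cexpi (symp u v) * sfourier g (v - u).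

Lemma twistedE f g u : cdom g ->
  twisted_fun f g u = tconst * cintegral (fun v => tkernel g u v * f v).
Proof.
move=> dg; rewrite /twisted_fun; congr (_ * _); apply: cintegral_ext => v.
rewrite /tkernel /sfourier (mulrC _ (f v)) mulrA -cintegralZ; last exact: cdom_phase.
apply: cintegral_ext => w.
have -> : symp u v + symp v w + symp w u = symp u v + symp (v - u) w.
  by rewrite /symp /=; ring.
by rewrite cexpiD; ring.
Qed.

Lemma tkernel_bound g K u v : ccont g -> (forall w, bracket w * cnorm (g w) <= K) ->
  cnorm (tkernel g u v) <= 2 * pi ^+ 2 * K.
Proof. by move=> cg gK; rewrite cnormM cnorm_cexpi mul1r; exact: sfourier_bound. Qed.

Lemma ccont_tkernel g u : is_schwartz g -> ccont (tkernel g u).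
Proof.
move=> sg; apply: ccontM; first exact: ccont_phase.
exact: ccont_shift (ccont_sfourier sg).
Qed.

Lemma cdom_tkernel f g u : cdom f -> is_schwartz g -> cdom (fun v => tkernel g u v * f v).
Proof.
move=> df sg; have [cg [K gK]] := is_schwartz_cdom sg.
apply: (cdomMb (M := 2 * pi ^+ 2 * K)) => //; first exact: ccont_tkernel.
by move=> v; exact: tkernel_bound.
Qed.

Lemma twisted_linl (a : R[i]) f1 f2 g u : cdom f1 -> cdom f2 -> is_schwartz g ->
  twisted_fun (fun v => a * f1 v + f2 v) g u = a * twisted_fun f1 g u + twisted_fun f2 g u.
Proof.
move=> d1 d2 sg; have dg := is_schwartz_cdom sg; rewrite !twistedE//.
rewrite mulrCA -mulrDr -(cintegralZ a); last exact: cdom_tkernel.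
rewrite -cintegralD; [|apply: cdomZ; exact: cdom_tkernel|exact: cdom_tkernel].
by congr (_ * _); apply: cintegral_ext => v; ring.
Qed.

Lemma twisted_linr (a : R[i]) f g1 g2 u : cdom f -> is_schwartz g1 -> is_schwartz g2 ->
  twisted_fun f (fun v => a * g1 v + g2 v) u = a * twisted_fun f g1 u + twisted_fun f g2 u.
Proof.
move=> df s1 s2; have d1 := is_schwartz_cdom s1; have d2 := is_schwartz_cdom s2.
rewrite !twistedE//; last by apply: cdomD => //; exact: cdomZ.
rewrite mulrCA -mulrDr -(cintegralZ a); last exact: cdom_tkernel.
rewrite -cintegralD; [|apply: cdomZ; exact: cdom_tkernel|exact: cdom_tkernel].
congr (_ * _); apply: cintegral_ext => v.
by rewrite /tkernel sfourier_lin//; ring.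
Qed.

Lemma twistedZl (a : R[i]) f g u : cdom f -> is_schwartz g ->
  twisted_fun (fun v => a * f v) g u = a * twisted_fun f g u.
Proof.
move=> df sg; have dg := is_schwartz_cdom sg; rewrite !twistedE//.
rewrite mulrCA -(cintegralZ a); last exact: cdom_tkernel.
by congr (_ * _); apply: cintegral_ext => v; ring.
Qed.

Lemma twistedZr (a : R[i]) f g u : cdom f -> is_schwartz g ->
  twisted_fun f (fun v => a * g v) u = a * twisted_fun f g u.
Proof.
move=> df sg; have dg := is_schwartz_cdom sg; rewrite !twistedE//; last exact: cdomZ.
rewrite mulrCA -(cintegralZ a); last exact: cdom_tkernel.
congr (_ * _); apply: cintegral_ext => v.
by rewrite /tkernel sfourierZ//; ring.
Qed.

Definition tbound : R := cnorm tconst * (2 * pi ^+ 2) * (2 * pi ^+ 2).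

Lemma tbound_ge0 : 0 <= tbound.
Proof. by rewrite !mulr_ge0 ?cnorm_ge0 ?exprn_ge0 ?pi_ge0. Qed.

Lemma twisted_bound f g Kf Kg u : ccont f -> is_schwartz g ->
  (forall w, bracket w * cnorm (f w) <= Kf) ->
  (forall w, bracket w * cnorm (g w) <= Kg) ->
  cnorm (twisted_fun f g u) <= tbound * Kf * Kg.
Proof.
move=> cf sg fK gK; rewrite twistedE; last exact: is_schwartz_cdom.
have [cg _] := is_schwartz_cdom sg.
have H := @cintegral_bound _ (fun v => tkernel g u v * f v) (2 * pi ^+ 2 * Kg * Kf).
rewrite cnormM (_ : tbound * Kf * Kg =
  cnorm tconst * (2 * pi ^+ 2 * (2 * pi ^+ 2 * Kg * Kf))); last by rewrite /tbound; ring.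
rewrite ler_wpM2l ?cnorm_ge0// H//.
  by apply: ccontM => //; exact: ccont_tkernel.
move=> v; have b0 := mulr_ge0 (bracket_ge0 v) (cnorm_ge0 (f v)).
by rewrite cnormM mulrCA ler_pM ?cnorm_ge0//; exact: tkernel_bound.
Qed.

Lemma cder_tkernel i g u : is_schwartz g -> cder i (tkernel g u)
  (fun v => ii * (symp_coef i u * tkernel g u v - tkernel (fun w => symp_coef i w * g w) u v)).
Proof.
move=> sg; apply: cder_ext (cderM (cder_phase i u) (cder_shift (- u) (cder_sfourier i sg))) => // v.
by rewrite /tkernel; ring.
Qed.

(** Integration by parts in v: differentiating [tkernel g u] brings down [symp_coef i u] from the
    phase and puts [symp_coef i] on g through its transform. *)
Lemma twisted_partiall i f g u : is_schwartz f -> is_schwartz g ->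
  symp_coef i u * twisted_fun f g u =
  twisted_fun f (fun w => symp_coef i w * g w) u + ii * twisted_fun (partial i f) g u.
Proof.
move=> sf sg; have [_ _ /(_ i)[sp df]] := is_schwartz_elim sf.
have ss := is_schwartz_symp_coef i sg.
have dc := is_schwartz_cdom sf; have dp := is_schwartz_cdom sp.
rewrite !twistedE; try exact: is_schwartz_cdom.
have E : (fun v => ii * (symp_coef i u * tkernel g u v -
    tkernel (fun w => symp_coef i w * g w) u v) * f v) =
  fun v => (ii * symp_coef i u) * (tkernel g u v * f v) +
    - ii * (tkernel (fun w => symp_coef i w * g w) u v * f v).
  by apply/funext => v; ring.
have d1 := cdom_tkernel u dc sg; have d2 := cdom_tkernel u dc ss.
have d3 := cdom_tkernel u dp sg.
have := cintegral_by_parts (cder_tkernel i u sg) df d1 _ d3.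
rewrite E => /(_ (cdomD (cdomZ _ d1) (cdomZ _ d2))).
rewrite cintegralD; [|exact: cdomZ|exact: cdomZ].
rewrite !cintegralZ//; set I1 := cintegral _; set I2 := cintegral _; set I3 := cintegral _.
move=> H; have -> : I3 = - (ii * symp_coef i u * I1 + - ii * I2) by rewrite H opprK.
have -> : ii * (tconst * - (ii * symp_coef i u * I1 + - ii * I2)) =
   (ii * ii) * tconst * (I2 - symp_coef i u * I1) by ring.
by rewrite ii_sqr; ring.
Qed.

(** On this side the transform turns [partial i g] into multiplication by [symp_coef i (v - u)],
    which splits into a part acting on f and a factor depending on u only. *)
Lemma twisted_partialr i f g u : is_schwartz f -> is_schwartz g ->
  symp_coef i u * twisted_fun f g u =
  twisted_fun (fun w => symp_coef i w * f w) g u - ii * twisted_fun f (partial i g) u.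
Proof.
move=> sf sg; have [_ _ /(_ i)[sp dg]] := is_schwartz_elim sg.
have ss := is_schwartz_symp_coef i sf.
have dc := is_schwartz_cdom sf; have ds := is_schwartz_cdom ss.
rewrite !twistedE; try exact: is_schwartz_cdom.
have E : (fun v => tkernel (partial i g) u v * f v) =
  fun v => ii * symp_coef i u * (tkernel g u v * f v) +
    - ii * (tkernel g u v * (symp_coef i v * f v)).
  apply/funext => v; rewrite /tkernel sfourier_partial//.
  have -> : symp_coef i (v - u) = symp_coef i v - symp_coef i u :> R[i].
    by rewrite /symp_coef /crd; case: i {sp dg ss ds} => /=; rewrite rcD rcN; ring.
  by ring.
have d1 := cdom_tkernel u dc sg; have d2 := cdom_tkernel u ds sg.
rewrite E cintegralD; [|exact: cdomZ|exact: cdomZ].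
rewrite !cintegralZ//; set I1 := cintegral _; set I2 := cintegral _.
have -> : ii * (tconst * (ii * symp_coef i u * I1 + - ii * I2)) =
   (ii * ii) * tconst * (symp_coef i u * I1 - I2) by ring.
by rewrite ii_sqr; ring.
Qed.

(** Twice the Wirtinger derivative d/dz; [ddb] is twice d/dzbar. *)
Definition dd f : plane R -> R[i] := fun u => - ii * partial true f u + partial false f u.
Definition ddb f : plane R -> R[i] := fun u => ii * partial true f u + partial false f u.

Lemma is_schwartz_dd f : is_schwartz f -> is_schwartz (dd f).
Proof. by move=> sf; apply: is_schwartz_lin; exact: is_schwartz_partial. Qed.

Lemma is_schwartz_ddb f : is_schwartz f -> is_schwartz (ddb f).
Proof. by move=> sf; apply: is_schwartz_lin; exact: is_schwartz_partial. Qed.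

Lemma zed_symp u : zed u = - ii * symp_coef false u + symp_coef true u.
Proof. by rewrite zed_crd /symp_coef; ring. Qed.

Lemma zedb_symp u : zedb u = ii * symp_coef false u + symp_coef true u.
Proof. by rewrite zedb_crd /symp_coef; ring. Qed.

Lemma mul_zedE f : (fun u => zed u * f u) =
  fun u => - ii * (symp_coef false u * f u) + symp_coef true u * f u.
Proof. by apply/funext => u; rewrite zed_symp; ring. Qed.

Lemma mul_zedbE f : (fun u => zedb u * f u) =
  fun u => ii * (symp_coef false u * f u) + symp_coef true u * f u.
Proof. by apply/funext => u; rewrite zedb_symp; ring. Qed.

Lemma is_schwartz_zed f : is_schwartz f -> is_schwartz (fun u => zed u * f u).
Proof.
by move=> sf; rewrite mul_zedE; apply: is_schwartz_lin; exact: is_schwartz_symp_coef.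
Qed.

Lemma is_schwartz_zedb f : is_schwartz f -> is_schwartz (fun u => zedb u * f u).
Proof.
by move=> sf; rewrite mul_zedbE; apply: is_schwartz_lin; exact: is_schwartz_symp_coef.
Qed.

Section Pair.
Variables f g : plane R -> R[i].
Hypotheses (sf : is_schwartz f) (sg : is_schwartz g).
Let df := is_schwartz_cdom sf.
Let sfp i := is_schwartz_partial i sf.
Let sgp i := is_schwartz_partial i sg.
Let sfs i := is_schwartz_symp_coef i sf.
Let sgs i := is_schwartz_symp_coef i sg.
Let dfp i := is_schwartz_cdom (sfp i).
Let dfs i := is_schwartz_cdom (sfs i).

(** Multiplication by z or zbar passes through the product in two ways, each with the multiplication
    on one factor and a derivative on the other. Comparing the two ways yields the algebra of the
    f_mn. *)
Lemma twisted_zedb1 u : zedb u * twisted_fun f g u =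
  twisted_fun f (fun v => zedb v * g v) u - twisted_fun (dd f) g u.
Proof.
rewrite mul_zedbE /dd twisted_linr// twisted_linl// zedb_symp mulrDl -mulrA.
rewrite !(twisted_partiall _ _ sf sg).
set a := twisted_fun _ _ _; set b := twisted_fun (partial false f) _ _.
set c := twisted_fun _ _ _; set d := twisted_fun _ _ _.
have -> : ii * (a + ii * b) = ii * a + (ii * ii) * b by ring.
by rewrite ii_sqr; ring.
Qed.

Lemma twisted_zedb2 u : zedb u * twisted_fun f g u =
  twisted_fun (fun v => zedb v * f v) g u + twisted_fun f (dd g) u.
Proof.
rewrite mul_zedbE /dd twisted_linr// twisted_linl// zedb_symp mulrDl -mulrA.
rewrite !(twisted_partialr _ _ sf sg).
set a := twisted_fun _ _ _; set b := twisted_fun _ (partial false g) _.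
set c := twisted_fun _ _ _; set d := twisted_fun _ _ _.
have -> : ii * (a - ii * b) = ii * a - (ii * ii) * b by ring.
by rewrite ii_sqr; ring.
Qed.

Lemma twisted_zed1 u : zed u * twisted_fun f g u =
  twisted_fun f (fun v => zed v * g v) u + twisted_fun (ddb f) g u.
Proof.
rewrite mul_zedE /ddb twisted_linr// twisted_linl// zed_symp mulrDl -mulrA.
rewrite !(twisted_partiall _ _ sf sg).
set a := twisted_fun _ _ _; set b := twisted_fun (partial false f) _ _.
set c := twisted_fun _ _ _; set d := twisted_fun _ _ _.
have -> : - ii * (a + ii * b) = - ii * a - (ii * ii) * b by ring.
by rewrite ii_sqr; ring.
Qed.

Lemma twisted_zed2 u : zed u * twisted_fun f g u =
  twisted_fun (fun v => zed v * f v) g u - twisted_fun f (ddb g) u.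
Proof.
rewrite mul_zedE /ddb twisted_linr// twisted_linl// zed_symp mulrDl -mulrA.
rewrite !(twisted_partialr _ _ sf sg).
set a := twisted_fun _ _ _; set b := twisted_fun _ (partial false g) _.
set c := twisted_fun _ _ _; set d := twisted_fun _ _ _.
have -> : - ii * (a - ii * b) = - ii * a + (ii * ii) * b by ring.
by rewrite ii_sqr; ring.
Qed.
End Pair.

Lemma dd_herm m n : dd (herm m n) =
  fun u => csqrt n * herm m n.-1 u + - csqrt m.+1 * herm m.+1 n u.
Proof.
apply/funext => u; rewrite /dd !(cder_partial (cder_herm _ m n)).
rewrite [dz true]/= [dz false]/=.
have -> : cj 1 = 1 :> R[i] by exact: (cj_real 1).
have -> : cj ii = - ii :> R[i] by apply: complexP; rewrite /= ?oppr0.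
set a := _ - _; set b := _ - _.
have -> : - ii * (2^-1 * (ii * a + - ii * b)) = - (ii * ii) * (2^-1 * (a - b)) by ring.
rewrite ii_sqr opprK !mul1r -mulrDr.
have -> : a - b + (a + b) = 2 * a by ring.
by rewrite mulKf ?pnatr_eq0// mulNr.
Qed.

Lemma ddb_herm m n : ddb (herm m n) =
  fun u => csqrt m * herm m.-1 n u + - csqrt n.+1 * herm m n.+1 u.
Proof.
apply/funext => u; rewrite /ddb !(cder_partial (cder_herm _ m n)).
rewrite [dz true]/= [dz false]/=.
have -> : cj 1 = 1 :> R[i] by exact: (cj_real 1).
have -> : cj ii = - ii :> R[i] by apply: complexP; rewrite /= ?oppr0.
set a := _ - _; set b := _ - _.
have -> : ii * (2^-1 * (ii * a + - ii * b)) = (ii * ii) * (2^-1 * (a - b)) by ring.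
rewrite ii_sqr !mul1r mulN1r -mulrN -mulrDr.
have -> : - (a - b) + (a + b) = 2 * b by ring.
by rewrite mulKf ?pnatr_eq0// mulNr.
Qed.

End TwistedRelations.

(** * The products f_mn x f_kl *)

Section HermiteProducts.
Context {R : realType}.
Implicit Types (f g h : plane R -> R[i]) (u v w x : plane R) (i : bool) (m n k l : nat).
Local Notation ii := (0 +i* 1 : R[i]).
Local Notation G := (fun u : plane R => (gauss u)%:C).

Lemma herm00 u : herm 0 0 u = 2 * (gauss u)%:C.
Proof.
by rewrite /herm chp0n expr0 mulr1 /hcoef fact0 muln1 sqrtr1 divr1 rc_nat.
Qed.

Lemma is_schwartz_gauss : is_schwartz G.
Proof.
have := is_schwartzZ 2^-1 (@is_schwartz_herm R 0 0).
congr is_schwartz; apply/funext => u.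
by rewrite herm00 mulKf// pnatr_eq0.
Qed.

Opaque herm.

Lemma csqrtS_neq0 n : csqrt n.+1 != 0 :> R[i].
Proof.
apply/eqP => /(congr1 (@complex.Re R)) /= /eqP.
by rewrite gt_eqF// sqrtr_gt0.
Qed.

Lemma csqrt0 : csqrt 0 = 0 :> R[i].
Proof. by rewrite /csqrt sqrtr0. Qed.

(** The relations lower both indices together until one of them is 0; there [csqrt 0] forces the
    value 0 unless the other index is 0 too. This serves for the products f_mn x f_kl and again for
    the coefficients of f_mn. *)
Lemma ladder_delta (X : nat -> nat -> R[i]) :
  (forall n k, csqrt k.+1 * X n k.+1 = csqrt n * X n.-1 k) ->
  (forall n k, csqrt n.+1 * X n.+1 k = csqrt k * X n k.-1) ->
  forall n k, X n k = (n == k)%:R * X 0 0.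
Proof.
move=> H1 H2; elim=> [|n IH] [|k]; first by rewrite mul1r.
- by apply: (mulfI (csqrtS_neq0 k)); rewrite H1 csqrt0 !mul0r mulr0.
- by apply: (mulfI (csqrtS_neq0 n)); rewrite H2 csqrt0 !mul0r mulr0.
- apply: (mulfI (csqrtS_neq0 n)); rewrite H2 /= IH eqSS.
  by case: (eqVneq n k) => [->//|_]; rewrite !mul0r !mulr0.
Qed.

Lemma twisted_lin2r (a b : R[i]) f g1 g2 u : cdom f -> is_schwartz g1 -> is_schwartz g2 ->
  twisted_fun f (fun v => a * g1 v + b * g2 v) u =
  a * twisted_fun f g1 u + b * twisted_fun f g2 u.
Proof. by move=> df s1 s2; rewrite twisted_linr ?twistedZr//; exact: is_schwartzZ. Qed.

Lemma twisted_lin2l (a b : R[i]) f1 f2 g u : cdom f1 -> cdom f2 -> is_schwartz g ->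
  twisted_fun (fun v => a * f1 v + b * f2 v) g u =
  a * twisted_fun f1 g u + b * twisted_fun f2 g u.
Proof. by move=> d1 d2 sg; rewrite twisted_linl ?twistedZl//; exact: cdomZ. Qed.

Lemma zedb_hermE m n : (fun u => zedb u * herm m n u) =
  fun u => csqrt m.+1 * herm m.+1 n u + csqrt n * herm m n.-1 u.
Proof. by apply/funext => u; exact: zedb_herm. Qed.

Lemma zed_hermE m n : (fun u => zed u * herm m n u) =
  fun u => csqrt n.+1 * herm m n.+1 u + csqrt m * herm m.-1 n u.
Proof. by apply/funext => u; exact: zed_herm. Qed.

Lemma cdom_herm m n : cdom (@herm R m n).
Proof. by apply: is_schwartz_cdom; exact: is_schwartz_herm. Qed.

Definition hprod m n k l u := twisted_fun (herm m n) (herm k l) u : R[i].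

Section Products.
Variable u : plane R.
Local Notation X m n k l := (hprod m n k l u).
Let sh := @is_schwartz_herm R.
Let dh := @cdom_herm.

Let lin2 a b m n m' n' k l :
  twisted_fun (fun v => a * herm m n v + b * herm m' n' v) (herm k l) u =
  a * X m n k l + b * X m' n' k l.
Proof. exact: twisted_lin2l (dh _ _) (dh _ _) (sh _ _). Qed.

Let lin2r a b m n k l k' l' :
  twisted_fun (herm m n) (fun v => a * herm k l v + b * herm k' l' v) u =
  a * X m n k l + b * X m n k' l'.
Proof. exact: twisted_lin2r (dh _ _) (sh _ _) (sh _ _). Qed.

Let zb1 m n k l : zedb u * X m n k l =
  (csqrt k.+1 * X m n k.+1 l + csqrt l * X m n k l.-1) -
  (csqrt n * X m n.-1 k l - csqrt m.+1 * X m.+1 n k l).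
Proof.
by rewrite [LHS](twisted_zedb1 (sh m n) (sh k l)) zedb_hermE dd_herm lin2 lin2r mulNr.
Qed.

Let zb2 m n k l : zedb u * X m n k l =
  (csqrt m.+1 * X m.+1 n k l + csqrt n * X m n.-1 k l) +
  (csqrt l * X m n k l.-1 - csqrt k.+1 * X m n k.+1 l).
Proof.
by rewrite [LHS](twisted_zedb2 (sh m n) (sh k l)) zedb_hermE dd_herm lin2 lin2r mulNr.
Qed.

Let z1 m n k l : zed u * X m n k l =
  (csqrt l.+1 * X m n k l.+1 + csqrt k * X m n k.-1 l) +
  (csqrt m * X m.-1 n k l - csqrt n.+1 * X m n.+1 k l).
Proof.
by rewrite [LHS](twisted_zed1 (sh m n) (sh k l)) zed_hermE ddb_herm lin2 lin2r mulNr.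
Qed.

Let z2 m n k l : zed u * X m n k l =
  (csqrt n.+1 * X m n.+1 k l + csqrt m * X m.-1 n k l) -
  (csqrt k * X m n k.-1 l - csqrt l.+1 * X m n k l.+1).
Proof.
by rewrite [LHS](twisted_zed2 (sh m n) (sh k l)) zed_hermE ddb_herm lin2 lin2r mulNr.
Qed.

Let half (a b : R[i]) : a + a = b + b -> a = b.
Proof.
have two : (2 : R[i]) != 0 by rewrite pnatr_eq0.
by move=> H; apply: (mulfI two); rewrite !mulr_natl !mulr2n.
Qed.

(** The difference of the two expressions for z X isolates the inner indices n and k; in [average]
    half of their sum isolates the outer indices m and l. *)
Let cancel1 (z p q r s : R[i]) :
  z = p + q - (r - s) -> z = (s + r) + (q - p) -> p = r.
Proof.
move=> -> H; apply: half.
have -> : p + p = (p + q - (r - s)) - (s + r + (q - p)) + (r + r) by ring.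
by rewrite H subrr add0r.
Qed.

Let average (z p q r s : R[i]) :
  z = p + q - (r - s) -> z = (s + r) + (q - p) -> z = s + q.
Proof.
by move=> e1 e2; apply: half; rewrite {1}e1 e2; ring.
Qed.

Lemma twisted_herm_delta m n k l : X m n k l = (n == k)%:R * X m 0 0 l.
Proof.
apply: (@ladder_delta (fun n k => X m n k l)) => {}n {}k.
  exact: cancel1 (zb1 m n k l) (zb2 m n k l).
by apply: cancel1 (z2 m n k l) _; rewrite z1.
Qed.

Lemma twisted_herm_zedb m l : zedb u * X m 0 0 l =
  csqrt m.+1 * X m.+1 0 0 l + csqrt l * X m 0 0 l.-1.
Proof. exact: average (zb1 m 0 0 l) (zb2 m 0 0 l). Qed.

Lemma twisted_herm_zed m l : zed u * X m 0 0 l =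
  csqrt l.+1 * X m 0 0 l.+1 + csqrt m * X m.-1 0 0 l.
Proof. exact: average (z2 m 0 0 l) (z1 m 0 0 l). Qed.

End Products.

Lemma partial_gauss i : partial i G = fun u => - crd i u * (gauss u)%:C.
Proof. exact: cder_partial (cder_gauss i). Qed.

(** The derivative of the Gaussian along [i] is [- crd i] times it, and the transform exchanges
    derivatives and multiplications, so the transform solves the equation of [gaussian_ode]; its
    value at the origin is the Gaussian integral. *)
Lemma sfourier_gauss x : sfourier G x = (2 * pi)%:C * (gauss x)%:C.
Proof.
have sG := is_schwartz_gauss.
rewrite (@gaussian_ode _ (sfourier G)).
  congr (_ * _); rewrite -cintegral_gauss; apply: cintegral_ext => w.
  by rewrite /symp !mul0r subr0 cexpi0 mulr1.
move=> i; apply: cder_ext (cder_sfourier i sG) => // {}x.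
case: i.
  have -> : (fun w => symp_coef true w * (gauss w)%:C) = fun w => - 1 * partial false G w.
    by apply/funext => w; rewrite partial_gauss /symp_coef; ring.
  rewrite sfourierZ; last by apply: is_schwartz_cdom; exact: is_schwartz_partial.
  rewrite sfourier_partial// /symp_coef.
  have -> : - ii * (-1 * (- ii * - crd true x * sfourier G x)) = ii * ii * (crd true x * sfourier G x) by ring.
  by rewrite ii_sqr; ring.
have -> : (fun w => symp_coef false w * (gauss w)%:C) = partial true G.
  by apply/funext => w; rewrite partial_gauss /symp_coef.
rewrite sfourier_partial// /symp_coef.
have -> : - ii * (- ii * crd false x * sfourier G x) = ii * ii * (crd false x * sfourier G x) by ring.
by rewrite ii_sqr; ring.
Qed.

Lemma gauss_even u v : gauss (u - v) = gauss (v - u).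
Proof. by rewrite /gauss /=; congr (expR (- (_ / 2))); ring. Qed.

Lemma gauss_ge0 u : 0 <= gauss u.
Proof. exact: expR_ge0. Qed.

Lemma gauss_le1 u : gauss u <= 1.
Proof. by rewrite /gauss -expR0 ler_expR oppr_le0 divr_ge0// addr_ge0 ?sqr_ge0. Qed.

Section GaussianProduct.
Let Q u v : R[i] := cexpi (symp u v) * (gauss (u - v))%:C.
Let E u v : R[i] := Q u v * (gauss v)%:C.

Let ccont_Q u : ccont (Q u).
Proof.
apply: ccontM; first exact: ccont_phase.
have := ccont_shift (- u) (@ccont_gauss R).
by congr ccont; apply/funext => v; rewrite gauss_even.
Qed.

Let cdom_Q u f : is_schwartz f -> cdom (fun v => Q u v * f v).
Proof.
move=> sf; apply: (cdomMb (M := 1)) (is_schwartz_cdom sf); first exact: ccont_Q.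
by move=> v; rewrite cnormM cnorm_cexpi mul1r cnormR ger0_norm ?gauss_le1 ?gauss_ge0.
Qed.

Let a1 i u v : R[i] := - (ii * symp_coef i v) - crd i (u - v).

Let crdB i u v : crd i (u - v) = crd i u - crd i v :> R[i].
Proof. by rewrite /crd; case: i; rewrite /= rcD rcN. Qed.

Let dQ i v : cder i (fun u => Q u v) (fun u => a1 i u v * Q u v).
Proof.
apply: cder_ext (cderM (cder_phasel i v) (cder_shift (- v) (cder_gauss i))) => // u.
by rewrite /Q /a1; ring.
Qed.

Let dEu i v : cder i (fun u => E u v) (fun u => a1 i u v * E u v).
Proof.
apply: cder_ext (cderM (dQ i v) (cder_cst i (gauss v)%:C)) => // u.
by rewrite /E; ring.
Qed.

Let da1 i v : cder i (fun u => a1 i u v) (fun=> -1).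
Proof.
apply: cder_ext (cderB (cder_cst i (- (ii * symp_coef i v))) (cder_shift (- v) (cder_crd i i))) => // u.
by rewrite eqxx sub0r.
Qed.

Let dEv i u : cder i (E u)
  (fun v => ii * symp_coef i u * E u v + (crd i u * E u v + - 2 * (Q u v * (crd i v * (gauss v)%:C)))).
Proof.
have d1 : cder i (fun v => (gauss (u - v))%:C) (fun v => - crd i (v - u) * (gauss (u - v))%:C).
  by apply: cder_ext (cder_shift (- u) (cder_gauss i)) => v; rewrite gauss_even.
apply: cder_ext (cderM (cderM (cder_phase i u) d1) (cder_gauss i)) => // v.
by rewrite /E /Q crdB; ring.
Qed.

Let sG := is_schwartz_gauss.
Let sGc i : is_schwartz (fun v => crd i v * (gauss v)%:C).
Proof. exact: is_schwartz_crd. Qed.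

(** Both v-derivatives of [E u] integrate to 0. Added with coefficients 1 and i, their terms in u
    cancel, and the moment of v_1 + i v_2 is left. *)
Let integral_zE u : cintegral (fun v => crd false v * E u v) +
  ii * cintegral (fun v => crd true v * E u v) = 0.
Proof.
have EE i : (fun v => crd i v * E u v) = fun v => Q u v * (crd i v * (gauss v)%:C).
  by apply/funext => v; rewrite /E; ring.
rewrite !EE; set I0 := cintegral _; set I1 := cintegral _.
have dQG := cdom_Q u sG.
have H i : ii * symp_coef i u * cintegral (E u) + (crd i u * cintegral (E u) +
    - 2 * cintegral (fun v => Q u v * (crd i v * (gauss v)%:C))) = 0.
  have dc := cdom_Q u (sGc i).
  have d1 : cdom (fun v => crd i u * E u v + - 2 * (Q u v * (crd i v * (gauss v)%:C))).
    by apply: cdomD; exact: cdomZ.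
  rewrite -!cintegralZ// -!cintegralD//; try exact: cdomZ.
  apply: (cintegral_derivative (dEv i u)) => //.
  by apply: cdomD => //; exact: cdomZ.
have := H false; have := H true; rewrite -/I0 -/I1 /symp_coef.
set J := cintegral (E u) => h1 h0.
have two : (2 : R[i]) != 0 by rewrite pnatr_eq0.
apply: (mulfI two); rewrite mulr0.
have e1 : 2 * I1 = ii * crd false u * J + crd true u * J.
  by apply/eqP; rewrite -subr_eq0 -oppr_eq0 -h1; apply/eqP; ring.
have e0 : 2 * I0 = ii * - crd true u * J + crd false u * J.
  by apply/eqP; rewrite -subr_eq0 -oppr_eq0 -h0; apply/eqP; ring.
have -> : 2 * (I0 + ii * I1) = 2 * I0 + ii * (2 * I1) by ring.
rewrite e0 e1.
have -> : ii * (ii * crd false u * J + crd true u * J) =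
  (ii * ii) * crd false u * J + ii * crd true u * J by ring.
by rewrite ii_sqr; ring.
Qed.

(** As a function of u the integral solves the equation of [gaussian_ode]: [a1 i u v] is [- crd i u]
    plus a multiple of v_1 + i v_2, whose contribution vanishes by [integral_zE]. *)
Lemma integral_gaussian_product u :
  cintegral (fun v => cexpi (symp u v) * (gauss (u - v))%:C * (gauss v)%:C) =
  pi%:C * (gauss u)%:C.
Proof.
have dJ i : cder i (fun u => cintegral (E u)) (fun u => - crd i u * cintegral (E u)).
  have [K2 H2] := @rapid_gauss R 2; have [K3 H3] := @rapid_gauss R 3.
  have d : cder i (fun x => cintegral (E x)) (fun x => cintegral (fun v => a1 i x v * E x v)).
    (* The second derivative carries the factor -1 + a1^2, where |a1| <= b + b' for the brackets b
       of w and b' of x - w. It is at most 1 + 4 (b b')^2 <= 5 (b b')^2, and integrability asks for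
       one more b; hence the powers 2 and 3 in [H2] and [H3]. *)
    apply: (@cintegral_param _ i _ _
      (fun x v => -1 * E x v + a1 i x v * (a1 i x v * E x v)) (5 * (K2 * K3))).
    - by move=> w; exact: dEu.
    - by move=> w; exact: cderM (da1 i w) (dEu i w).
    - by move=> x; exact: cdom_Q.
    - move=> x.
      have -> : (fun v => a1 i x v * E x v) = fun v => - ii * (Q x v * (symp_coef i v * (gauss v)%:C)) +
          (- crd i x * (Q x v * (gauss v)%:C) + Q x v * (crd i v * (gauss v)%:C)).
        by apply/funext => v; rewrite /a1 /E crdB; ring.
      apply: cdomD; first by apply: cdomZ; apply: cdom_Q; exact: is_schwartz_symp_coef.
      by apply: cdomD; [apply: cdomZ|]; exact: cdom_Q.
    - move=> x w; set b := bracket w; set b' := bracket (x - w).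
      have b1 : 1 <= b := bracket_ge1 _; have b'1 : 1 <= b' := bracket_ge1 _.
      have ha : cnorm (a1 i x w) <= b + b'.
        rewrite (le_trans (cnormB _ _))// lerD ?cnorm_crd// cnormN cnormM cnorm_i normr1 mul1r.
        by rewrite /symp_coef; case: (i); rewrite ?cnormN cnorm_crd.
      have -> : -1 * E x w + a1 i x w * (a1 i x w * E x w) = (-1 + a1 i x w ^+ 2) * E x w by ring.
      have hb : cnorm (-1 + a1 i x w ^+ 2) <= 5 * (b ^+ 2 * b' ^+ 2).
        rewrite (le_trans (cnormD _ _))// cnormN cnorm1 cnormX.
        apply: (@le_trans _ _ (1 + (b + b') ^+ 2)).
          by rewrite lerD2l lerXn2r ?nnegrE ?cnorm_ge0 ?addr_ge0//; lra.
        have h1 : b <= b * b' by rewrite ler_peMr//; lra.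
        have h2 : b' <= b * b' by rewrite ler_peMl//; lra.
        rewrite -exprMn; set c := b * b' in h1 h2 *.
        have c1 : 1 <= c by lra.
        apply: (@le_trans _ _ (1 + (c + c) ^+ 2)).
          by rewrite lerD2l lerXn2r ?nnegrE; lra.
        nra.
      rewrite cnormM mulrC -mulrA mulrC.
      have e : cnorm (E x w) = gauss (x - w) * gauss w.
        by rewrite /E /Q !cnormM cnorm_cexpi mul1r !cnormR !ger0_norm ?gauss_ge0.
      rewrite e.
      have h2 := H2 (x - w); have h3 := H3 w.
      rewrite cnormR ger0_norm ?gauss_ge0// -/b' in h2.
      rewrite cnormR ger0_norm ?gauss_ge0// -/b in h3.
      have g1 := gauss_ge0 (x - w); have g2 := gauss_ge0 w.
      have p : 0 <= gauss (x - w) * gauss w * b := mulr_ge0 (mulr_ge0 g1 g2) (bracket_ge0 w).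
      apply: le_trans (ler_wpM2l p hb) _.
      have -> : gauss (x - w) * gauss w * b * (5 * (b ^+ 2 * b' ^+ 2)) =
        5 * ((b' ^+ 2 * gauss (x - w)) * (b ^+ 3 * gauss w)) by ring.
      have q1 : 0 <= b' ^+ 2 * gauss (x - w) := mulr_ge0 (bracketX_ge0 _ _) g1.
      have q2 : 0 <= b ^+ 3 * gauss w := mulr_ge0 (bracketX_ge0 _ _) g2.
      by rewrite ler_wpM2l// ler_pM.
  apply: cder_ext d => // x.
  have sx := integral_zE x.
  have dQG := cdom_Q x sG.
  have dc j : cdom (fun v => crd j v * E x v).
    have -> : (fun v => crd j v * E x v) = fun v => Q x v * (crd j v * (gauss v)%:C).
      by apply/funext => v; rewrite /E; ring.
    exact: cdom_Q.
  have -> : (fun v => a1 i x v * E x v) = fun v => - crd i x * E x v +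
      (if i then - ii else 1) * (1 * (crd false v * E x v) + ii * (crd true v * E x v)).
    apply/funext => v; rewrite /a1 crdB /symp_coef; case: i => /=; last by ring.
    have -> : - ii * (1 * (crd false v * E x v) + ii * (crd true v * E x v)) =
      - ii * crd false v * E x v - (ii * ii) * (crd true v * E x v) by ring.
    by rewrite ii_sqr; ring.
  have d2 : cdom (fun v => 1 * (crd false v * E x v) + ii * (crd true v * E x v)).
    by apply: cdomD; exact: cdomZ.
  rewrite cintegralD; [|exact: cdomZ|exact: cdomZ].
  rewrite !cintegralZ// cintegralD; [|exact: cdomZ|exact: cdomZ].
  by rewrite !cintegralZ// mul1r sx mulr0 addr0.
rewrite [LHS](gaussian_ode dJ u); congr (_ * _).
rewrite -cintegral_gauss2; apply: cintegral_ext => v.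
rewrite /E /Q gauss_even /symp !mul0r subr0 cexpi0 mul1r.
by congr (_%:C * _); congr gauss; case: v => a b /=; rewrite !subr0.
Qed.

End GaussianProduct.

Lemma hprod00 u : hprod 0 0 0 0 u = herm 0 0 u.
Proof.
rewrite /hprod twistedE; last exact: cdom_herm.
(* 8 pi is 2 * 2 * 2 pi, from the two ground states and the transform of the Gaussian. With the
   remaining integral pi and the prefactor 1/(4 pi^2) this gives the 2 of [herm00]. *)
have -> : (fun v => tkernel (herm 0 0) u v * herm 0 0 v) = fun v => (8 * pi)%:C *
    (cexpi (symp u v) * (gauss (u - v))%:C * (gauss v)%:C).
  apply/funext => v; rewrite /tkernel !herm00 /sfourier.
  have -> : (fun w => herm 0 0 w * cexpi (symp (v - u) w)) =
      fun w => 2 * ((gauss w)%:C * cexpi (symp (v - u) w)).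
    by apply/funext => w; rewrite herm00 mulrA.
  rewrite cintegralZ; last by apply: cdom_phase; apply: is_schwartz_cdom; exact: is_schwartz_gauss.
  rewrite -/(sfourier G _) sfourier_gauss (gauss_even v) !rcM.
  by rewrite -[(8 : R)%:C]/((8%:R)%:C) -[(2 : R)%:C]/((2%:R)%:C) !rc_nat; ring.
have := @integral_gaussian_product u => H.
rewrite cintegralZ ?H ?herm00.
  rewrite /tconst !mulrA -!rcM -(rc_nat 2) -rcM; congr (_%:C).
  have p0 : pi != 0 :> R by rewrite gt_eqF// pi_gt0.
  by move: p0; move: (pi : R) => p p0; field.
have sG := is_schwartz_gauss.
apply: (cdomMb (M := 1)) (is_schwartz_cdom sG).
  apply: ccontM; first exact: ccont_phase.
  have := ccont_shift (- u) (@ccont_gauss R).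
  by congr ccont; apply/funext => v; rewrite gauss_even.
by move=> v; rewrite cnormM cnorm_cexpi mul1r cnormR ger0_norm ?gauss_le1 ?gauss_ge0.
Qed.

(** Once the inner indices are reduced to a Kronecker delta, the products f_m0 x f_0l obey the same
    raising relations as f_ml and agree with it at m = l = 0; cancelling the nonzero factor
    [csqrt m.+1] or [csqrt j.+1] propagates this. *)
Lemma hprodE m n k l u : hprod m n k l u = (n == k)%:R * herm m l u.
Proof.
rewrite twisted_herm_delta; congr (_ * _).
have H0 j : hprod 0 0 0 j u = herm 0 j u.
  elim: j => [|j IH]; first exact: hprod00.
  apply: (mulfI (csqrtS_neq0 j)).
  have := twisted_herm_zed u 0 j; rewrite IH zed_herm csqrt0 !mul0r !addr0.
  by move/esym.
elim: m l => [|m IH] l; first exact: H0.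
apply: (mulfI (csqrtS_neq0 m)).
have := twisted_herm_zedb u m l; rewrite !IH zedb_herm.
by move/addIr/esym.
Qed.

End HermiteProducts.

(** * Polynomial bounds on f_mn and on all words applied to it *)

Section HermiteBounds.
Context {R : realType}.
Implicit Types (f g h : plane R -> R[i]) (u v w x : plane R) (i : bool) (m n k l : nat).
Local Notation ii := (0 +i* 1 : R[i]).

Lemma cnorm_zedb_sqr u : cnorm (zedb u) ^+ 2 = u.1 ^+ 2 + u.2 ^+ 2.
Proof.
by rewrite /cnorm /zedb /= sqr_sqrtr ?sqrrN// addr_ge0 ?sqr_ge0.
Qed.

Transparent herm.
(** From r^(2m) exp(-r^2) <= m! for r = |z|, which is one term of the exponential series at r^2. *)
Lemma cnorm_herm0_le2 m u : cnorm (herm m 0 u) <= 2.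
Proof.
rewrite /herm chpn0 !cnormM cnormX !cnormR /hcoef fact0 muln1.
set r := cnorm (zedb u); have r0 : 0 <= r := cnorm_ge0 _.
have f0 : 0 < m`!%:R :> R by rewrite ltr0n fact_gt0.
have s0 : 0 < Num.sqrt m`!%:R :> R by rewrite sqrtr_gt0.
have h0 : 0 <= 2 / Num.sqrt m`!%:R :> R by rewrite divr_ge0 ?(ltW s0).
rewrite (ger0_norm h0) (ger0_norm (gauss_ge0 u)).
have key : r ^+ m * gauss u <= Num.sqrt m`!%:R.
  rewrite -ler_sqr ?nnegrE ?mulr_ge0 ?exprn_ge0 ?gauss_ge0 ?(ltW s0)//.
  rewrite (sqr_sqrtr (ltW f0)) exprMn -exprM mulnC exprM cnorm_zedb_sqr.
  have -> : gauss u ^+ 2 = (expR (u.1 ^+ 2 + u.2 ^+ 2))^-1.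
    by rewrite /gauss -expRN expr2 -expRD; congr expR; field.
  rewrite ler_pdivrMr ?expR_gt0//.
  set x := u.1 ^+ 2 + u.2 ^+ 2; have x0 : 0 <= x by rewrite addr_ge0 ?sqr_ge0.
  case: m f0 {s0 h0} => [_|m f0]; first by rewrite expr0 fact0 mul1r -expR0 ler_expR.
  have := expR_ge1Dxn m x0; have p : 0 <= x ^+ m.+1 / m.+1`!%:R by rewrite divr_ge0 ?exprn_ge0 ?(ltW f0).
  move=> h; rewrite mulrC -ler_pdivrMr//; lra.
have -> : 2 / Num.sqrt m`!%:R * r ^+ m * gauss u = 2 * (r ^+ m * gauss u / Num.sqrt m`!%:R) by ring.
by rewrite -[leRHS]mulr1 ler_wpM2l// ler_pdivrMr// mul1r.
Qed.
Opaque herm.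

Lemma csqrt_cnorm_sqr n : cnorm (csqrt n : R[i]) ^+ 2 = n%:R.
Proof. by rewrite /csqrt cnormR -normrX sqr_sqrtr ?normr_nat. Qed.

Lemma csqrt_cnorm n : cnorm (csqrt n : R[i]) <= n.+1%:R.
Proof.
rewrite -ler_sqr ?nnegrE ?cnorm_ge0// csqrt_cnorm_sqr -natrX ler_nat.
by rewrite expnS expn1; nia.
Qed.

(** 2 + 2 * 18 + 1250, from bracket u <= 1 + 2 r^2 + r^4 with r = |z|: the three terms contribute 2,
    then twice 2 * 9 because m + 3 <= 3 (m + 1), then 2 * 625 because m + 5 <= 5 (m + 1). *)
Definition herm0_const : R := 1288%:R.

Lemma herm0_weighted m u : bracket u * cnorm (herm m 0 u) <= herm0_const * m.+1%:R ^+ 4.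
Proof.
have z1 k : cnorm (zedb u) * cnorm (herm k 0 u) <= cnorm (csqrt k.+1 : R[i]) * 2.
  rewrite -cnormM zedb_herm csqrt0 mul0r addr0 cnormM ler_wpM2l ?cnorm_ge0//.
  exact: cnorm_herm0_le2.
set r := cnorm (zedb u); have r0 : 0 <= r := cnorm_ge0 _.
have zS k : r * cnorm (herm k 0 u) = cnorm (csqrt k.+1 : R[i]) * cnorm (herm k.+1 0 u).
  by rewrite -!cnormM zedb_herm csqrt0 mul0r addr0.
have rS (a k : nat) : r ^+ a * cnorm (herm k 0 u) <= 2 * (k + a).+1%:R ^+ a.
  elim: a k => [|a IH] k; first by rewrite !expr0 mul1r mulr1 cnorm_herm0_le2.
  rewrite exprSr -mulrA zS mulrCA.
  have := IH k.+1; rewrite addSnnS => h.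
  have c0 : 0 <= cnorm (csqrt k.+1 : R[i]) := cnorm_ge0 _.
  apply: le_trans (ler_wpM2l c0 h) _.
  rewrite mulrCA ler_wpM2l// exprS ler_wpM2r ?exprn_ge0//.
  rewrite (le_trans (csqrt_cnorm _))// ler_nat; lia.
have hb : bracket u <= 1 + 2 * r ^+ 2 + r ^+ 4.
  rewrite (_ : 4 = 2 * 2)%N // exprM cnorm_zedb_sqr /bracket.
  have := sqr_ge0 u.1; have := sqr_ge0 u.2; set a := u.1 ^+ 2; set b := u.2 ^+ 2 => b0 a0.
  nra.
set x := cnorm (herm m 0 u); have x0 : 0 <= x := cnorm_ge0 _.
apply: le_trans (ler_wpM2r x0 hb) _.
have m1 : 1 <= m.+1%:R :> R by rewrite ler1n.
have h0 := cnorm_herm0_le2 m u; have h2 := rS 2%N m; have h4 := rS 4%N m.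
rewrite -/x in h0 h2 h4.
have e2 : (m + 2).+1%:R ^+ 2 <= 9 * m.+1%:R ^+ 4 :> R.
  by rewrite -!natrX -natrM ler_nat; nia.
have e4 : (m + 4).+1%:R ^+ 4 <= 625 * m.+1%:R ^+ 4 :> R.
  rewrite -!natrX -natrM ler_nat (_ : 625 = 5 ^ 4)%N// -expnMn leq_exp2r//; lia.
have e0 : 1 <= m.+1%:R ^+ 4 :> R by rewrite exprn_ege1.
move: (r ^+ 2) (r ^+ 4) h2 h4 e2 e4 e0 => r2 r4; set M := m.+1%:R ^+ 4.
set A := _ ^+ 2; set B := _ ^+ 4 => h2 h4 e2 e4 e0.
have -> : (1 + 2 * r2 + r4) * x = x + 2 * (r2 * x) + r4 * x by ring.
rewrite /herm0_const; lra.
Qed.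

Definition nn m n : R := m.+1%:R * n.+1%:R.

Lemma nn_ge1 m n : 1 <= nn m n.
Proof. by rewrite /nn -natrM ler1n. Qed.

Lemma nn_gt0 m n : 0 < nn m n.
Proof. exact: lt_le_trans ltr01 (nn_ge1 m n). Qed.

Lemma nnX_ge0 m n d : 0 <= nn m n ^+ d.
Proof. by rewrite exprn_ge0// ltW// nn_gt0. Qed.

Lemma nnC m n : nn m n = nn n m.
Proof. exact: mulrC. Qed.

Lemma nn_le m n m' n' : (m <= m'.*2.+1)%N -> (n <= n')%N -> nn m n <= 2 * nn m' n'.
Proof. by move=> h1 h2; rewrite /nn -!natrM ler_nat mulnA leq_mul//; lia. Qed.

Definition herm_const : R := tbound * herm0_const ^+ 2.

Lemma herm_const_ge0 : 0 <= herm_const.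
Proof. exact: mulr_ge0 tbound_ge0 (exprn_ge0 _ (ler0n _ _)). Qed.

(** Writing f_mn as f_m0 x f_0n reduces the estimate to the monomial case: a twisted product is
    bounded by the weighted sup norms of its factors, and f_0n is the conjugate of f_n0. *)
Lemma herm_bound m n u : cnorm (herm m n u) <= herm_const * nn m n ^+ 4.
Proof.
have -> : herm m n u = twisted_fun (herm m 0) (herm 0 n) u.
  by have := hprodE m 0 0 n u; rewrite eqxx mul1r => <-.
have [c _] := @cdom_herm R m 0.
have h0n w : bracket w * cnorm (herm 0 n w) <= herm0_const * n.+1%:R ^+ 4.
  by rewrite -cj_herm cnormC herm0_weighted.
apply: le_trans (twisted_bound u c (is_schwartz_herm 0 n) (herm0_weighted m) h0n) _.
by rewrite /herm_const /nn exprMn le_eqVlt; apply/orP; left; apply/eqP; ring.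
Qed.

Definition sop_coef (o : bool * bool) m n j : R[i] :=
  let s : R[i] := if o.1 then -1 else 1 in
  2^-1 * match j with
  | 0 => dz o.2 * csqrt n
  | 1 => s * dz o.2 * csqrt m.+1
  | 2 => cj (dz o.2) * csqrt m
  | _ => s * cj (dz o.2) * csqrt n.+1
  end.

Lemma sop_herm o m n : sop o (herm m n) = fun u =>
  sop_coef o m n 0 * herm m n.-1 u + (sop_coef o m n 1 * herm m.+1 n u +
   (sop_coef o m n 2 * herm m.-1 n u + (sop_coef o m n 3 * herm m n.+1 u))).
Proof.
case: o => [[] i]; rewrite /sop /sop_coef; cbn [fst snd].
  by rewrite (cder_partial (cder_herm i m n)); apply/funext => u; ring.
by apply/funext => u; rewrite crd_herm; ring.
Qed.

Lemma cnorm_dz i : cnorm (dz i : R[i]) = 1.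
Proof. by case: i; rewrite /dz ?cnorm_i ?normr1// cnorm1. Qed.

Lemma sop_coef_bound o m n j : cnorm (sop_coef o m n j) <= 2 * nn m n.
Proof.
have c k : (k <= m.+1)%N || (k <= n.+1)%N -> cnorm (csqrt k : R[i]) <= 2 * nn m n.
  move=> h; rewrite (le_trans (csqrt_cnorm _))// /nn -!natrM ler_nat.
  by case/orP: h; nia.
have h2 : cnorm (2^-1 : R[i]) <= 1 by rewrite cnormV cnorm_nat invf_le1// ler1n.
rewrite /sop_coef cnormM -[leRHS]mul1r ler_pM ?cnorm_ge0//.
have s1 : cnorm (if o.1 then -1 else 1 : R[i]) = 1 by case: (o.1); rewrite ?cnormN cnorm1.
by case: j => [|[|[|j]]]; rewrite !cnormM ?s1 ?[cnorm (cj _)]cnormC cnorm_dz ?mul1r; apply: c; rewrite ?leqnSn ?leqnn ?orbT.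
Qed.

Lemma sopsZ s (a : R[i]) f : is_schwartz f ->
  sops s (fun u => a * f u) = fun u => a * sops s f u.
Proof.
move=> sf; have := sops_lin s a sf (@is_schwartz0 R).
have -> : (fun u => a * f u + 0) = fun u => a * f u by apply/funext => u; rewrite addr0.
move=> ->; have := sops_lin s (-1) (@is_schwartz0 R) (@is_schwartz0 R).
have -> : (fun _ : plane R => -1 * 0 + 0 : R[i]) = fun=> 0 by apply/funext => u; ring.
move=> E; apply/funext => u; have /= -> := congr1 (@^~ u) E.
by ring.
Qed.

Lemma sops_rcons s o f : sops (rcons s o) f = sops s (sop o f).
Proof. by rewrite /sops foldr_rcons. Qed.

Lemma sops_herm_bound s : exists C d, 0 <= C /\
  forall m n u, cnorm (sops s (herm m n) u) <= C * nn m n ^+ d.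
Proof.
elim/last_ind: s => [|s o [C [d [C0 IH]]]].
  by exists herm_const, 4%N; split; [exact: herm_const_ge0|exact: herm_bound].
(* The innermost letter produces four neighbours of f_mn with coefficients at most [2 * nn m n], and
   a neighbour at most doubles [nn]; hence 4 * 2 * 2^d and one more power. *)
exists (8 * C * 2 ^+ d), d.+1; split; first by rewrite !mulr_ge0// exprn_ge0.
move=> m n u; rewrite sops_rcons sop_herm.
have sh := @is_schwartz_herm R.
have S3 := is_schwartzZ (sop_coef o m n 3) (sh m n.+1).
have S2 := is_schwartz_lin (sop_coef o m n 2) (sh m.-1 n) S3.
have S1 := is_schwartz_lin (sop_coef o m n 1) (sh m.+1 n) S2.
rewrite (sops_lin s _ (sh m n.-1) S1) (sops_lin s _ (sh m.+1 n) S2).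
rewrite (sops_lin s _ (sh m.-1 n) S3) (sopsZ s _ (sh m n.+1)).
have B j a b : (a <= m.*2.+1)%N && (b <= n)%N || (a <= m)%N && (b <= n.*2.+1)%N ->
    cnorm (sop_coef o m n j * sops s (herm a b) u) <= 2 * C * 2 ^+ d * nn m n ^+ d.+1.
  move=> h; have hh : nn a b <= 2 * nn m n.
    by case/orP: h => /andP[h1 h2]; [exact: nn_le|rewrite nnC (nnC m); exact: nn_le].
  rewrite cnormM.
  have -> : 2 * C * 2 ^+ d * nn m n ^+ d.+1 = 2 * nn m n * (C * (2 * nn m n) ^+ d).
    by rewrite [(2 * nn m n) ^+ d]exprMn [nn m n ^+ d.+1]exprS; ring.
  rewrite ler_pM ?cnorm_ge0 ?sop_coef_bound//.
  apply: le_trans (IH a b u) _; rewrite ler_wpM2l//.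
  by rewrite lerXn2r ?nnegrE ?mulr_ge0// ltW// nn_gt0.
have -> : 8 * C * 2 ^+ d * nn m n ^+ d.+1 = 2 * C * 2 ^+ d * nn m n ^+ d.+1 +
  (2 * C * 2 ^+ d * nn m n ^+ d.+1 + (2 * C * 2 ^+ d * nn m n ^+ d.+1 +
   2 * C * 2 ^+ d * nn m n ^+ d.+1)) by ring.
rewrite (le_trans (cnormD _ _))// lerD ?B//; first lia.
rewrite (le_trans (cnormD _ _))// lerD ?B//; first lia.
rewrite (le_trans (cnormD _ _))// lerD ?B//; lia.
Qed.

End HermiteBounds.

(** * Hermite coefficients and completeness *)

Section HermiteCoefficients.
Context {R : realType}.
Implicit Types (f g h : plane R -> R[i]) (u v w x : plane R) (i : bool) (m n k l a b : nat).
Local Notation ii := (0 +i* 1 : R[i]).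

Definition pairing f g : R[i] := cintegral (fun u => f u * g u).

Lemma cdom_schwartzM f g : is_schwartz f -> is_schwartz g -> cdom (fun u => f u * g u).
Proof.
by move=> /is_schwartz_elim[cf rf _] /is_schwartz_elim[cg rg _]; exact: rapid_cdomM.
Qed.

Lemma pairing_linl (a : R[i]) f1 f2 g : is_schwartz f1 -> is_schwartz f2 -> is_schwartz g ->
  pairing (fun u => a * f1 u + f2 u) g = a * pairing f1 g + pairing f2 g.
Proof.
move=> s1 s2 sg; have d1 := cdom_schwartzM s1 sg; have d2 := cdom_schwartzM s2 sg.
rewrite /pairing -cintegralZ// -cintegralD//; last exact: cdomZ.
by apply: cintegral_ext => u; ring.
Qed.

Lemma pairingC f g : pairing f g = pairing g f.
Proof. by apply: cintegral_ext => u; rewrite mulrC. Qed.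

Lemma pairing_linr (a : R[i]) f g1 g2 : is_schwartz f -> is_schwartz g1 -> is_schwartz g2 ->
  pairing f (fun u => a * g1 u + g2 u) = a * pairing f g1 + pairing f g2.
Proof. by move=> sf s1 s2; rewrite !(pairingC f) pairing_linl. Qed.

Lemma pairingZl (a : R[i]) f g : is_schwartz f -> is_schwartz g ->
  pairing (fun u => a * f u) g = a * pairing f g.
Proof.
move=> sf sg; rewrite /pairing -cintegralZ; last exact: cdom_schwartzM.
by apply: cintegral_ext => u; rewrite mulrA.
Qed.

Lemma pairingZr (a : R[i]) f g : is_schwartz f -> is_schwartz g ->
  pairing f (fun u => a * g u) = a * pairing f g.
Proof. by move=> sf sg; rewrite !(pairingC f) pairingZl. Qed.

Lemma pairing_partial i f g : is_schwartz f -> is_schwartz g ->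
  pairing (partial i f) g = - pairing f (partial i g).
Proof.
move=> sf sg; have [_ _ /(_ i)[spf df]] := is_schwartz_elim sf.
have [_ _ /(_ i)[spg dg]] := is_schwartz_elim sg.
by rewrite /pairing (cintegral_by_parts df dg)//; exact: cdom_schwartzM.
Qed.

Lemma pairing_mul (c f g : plane R -> R[i]) :
  pairing (fun u => c u * f u) g = pairing f (fun u => c u * g u).
Proof. by apply: cintegral_ext => u; rewrite mulrCA mulrA. Qed.

Opaque pairing.

Lemma pairing_dd f g : is_schwartz f -> is_schwartz g -> pairing (dd f) g = - pairing f (dd g).
Proof.
move=> sf sg; have p := is_schwartz_partial; rewrite /dd.
rewrite pairing_linl ?pairing_linr//; try exact: p.
rewrite (pairing_partial true sf sg) (pairing_partial false sf sg).
by move: (pairing f (partial true g)) (pairing f (partial false g)) => A B; ring.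
Qed.

Lemma pairing_ddb f g : is_schwartz f -> is_schwartz g -> pairing (ddb f) g = - pairing f (ddb g).
Proof.
move=> sf sg; have p := is_schwartz_partial; rewrite /ddb.
rewrite pairing_linl ?pairing_linr//; try exact: p.
rewrite (pairing_partial true sf sg) (pairing_partial false sf sg).
by move: (pairing f (partial true g)) (pairing f (partial false g)) => A B; ring.
Qed.

(** Ladder operators up to a factor 2: sign 1 lowers an index and sign -1 raises one, [zpm] lowering
    m and raising n, [zbpm] lowering n and raising m. Under the bilinear pairing the sign flips,
    since derivatives change sign and multiplications do not. *)
Definition zpm (s : R[i]) f : plane R -> R[i] := fun u => s * ddb f u + zed u * f u.
Definition zbpm (s : R[i]) f : plane R -> R[i] := fun u => s * dd f u + zedb u * f u.

Lemma is_schwartz_zpm s f : is_schwartz f -> is_schwartz (zpm s f).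
Proof.
by move=> sf; apply: is_schwartz_lin; [exact: is_schwartz_ddb|exact: is_schwartz_zed].
Qed.

Lemma is_schwartz_zbpm s f : is_schwartz f -> is_schwartz (zbpm s f).
Proof.
by move=> sf; apply: is_schwartz_lin; [exact: is_schwartz_dd|exact: is_schwartz_zedb].
Qed.

Lemma pairing_zpm s f g : is_schwartz f -> is_schwartz g ->
  pairing (zpm s f) g = pairing f (zpm (- s) g).
Proof.
move=> sf sg; have a := is_schwartz_ddb sf; have b := is_schwartz_ddb sg.
have c := is_schwartz_zed sf; have d := is_schwartz_zed sg.
rewrite /zpm (pairing_linl _ a c sg) (pairing_linr _ sf b d) (pairing_ddb sf sg) pairing_mul.
by move: (pairing f (ddb g)) (pairing f _) => A B; ring.
Qed.

Lemma pairing_zbpm s f g : is_schwartz f -> is_schwartz g ->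
  pairing (zbpm s f) g = pairing f (zbpm (- s) g).
Proof.
move=> sf sg; have a := is_schwartz_dd sf; have b := is_schwartz_dd sg.
have c := is_schwartz_zedb sf; have d := is_schwartz_zedb sg.
rewrite /zbpm (pairing_linl _ a c sg) (pairing_linr _ sf b d) (pairing_dd sf sg) pairing_mul.
by move: (pairing f (dd g)) (pairing f _) => A B; ring.
Qed.

Lemma zpm_herm m n : zpm 1 (herm m n) = fun u => 2 * csqrt m * herm m.-1 n u.
Proof. by apply/funext => u; rewrite /zpm ddb_herm zed_herm; ring. Qed.

Lemma zmm_herm m n : zpm (-1) (herm m n) = fun u => 2 * csqrt n.+1 * herm m n.+1 u.
Proof. by apply/funext => u; rewrite /zpm ddb_herm zed_herm; ring. Qed.

Lemma zbpm_herm m n : zbpm 1 (herm m n) = fun u => 2 * csqrt n * herm m n.-1 u.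
Proof. by apply/funext => u; rewrite /zbpm dd_herm zedb_herm; ring. Qed.

Lemma zbmm_herm m n : zbpm (-1) (herm m n) = fun u => 2 * csqrt m.+1 * herm m.+1 n u.
Proof. by apply/funext => u; rewrite /zbpm dd_herm zedb_herm; ring. Qed.

(** f_nm is the conjugate of f_mn, and 1/(4 pi) is the 1/2 of the coefficient formula times the 1/(2
    pi) by which functions embed into distributions. *)
Definition fcoef f m n : R[i] := (4 * pi)^-1%:C * pairing f (herm n m).

Lemma fcoef_lin (a : R[i]) f g m n : is_schwartz f -> is_schwartz g ->
  fcoef (fun u => a * f u + g u) m n = a * fcoef f m n + fcoef g m n.
Proof.
move=> sf sg; rewrite /fcoef (pairing_linl _ sf sg (is_schwartz_herm _ _)).
by move: (pairing f _) (pairing g _) => A B; ring.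
Qed.

Lemma fcoefZ (a : R[i]) f m n : is_schwartz f ->
  fcoef (fun u => a * f u) m n = a * fcoef f m n.
Proof.
move=> sf; rewrite /fcoef (pairingZl _ sf (is_schwartz_herm _ _)).
by move: (pairing f _) => A; ring.
Qed.

Lemma fcoef_raise1 f m n : is_schwartz f ->
  fcoef (zpm 1 f) m n = 2 * csqrt m.+1 * fcoef f m.+1 n.
Proof.
move=> sf; have sh := @is_schwartz_herm R.
rewrite /fcoef (pairing_zpm _ sf (sh n m)) zmm_herm (pairingZr _ sf (sh _ _)).
by move: (pairing f _) => A; ring.
Qed.

Lemma fcoef_lower1 f m n : is_schwartz f ->
  fcoef (zbpm (-1) f) m n = 2 * csqrt m * fcoef f m.-1 n.
Proof.
move=> sf; have sh := @is_schwartz_herm R.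
rewrite /fcoef (pairing_zbpm _ sf (sh n m)) opprK zbpm_herm (pairingZr _ sf (sh _ _)).
by move: (pairing f _) => A; ring.
Qed.

Lemma fcoef_raise2 f m n : is_schwartz f ->
  fcoef (zbpm 1 f) m n = 2 * csqrt n.+1 * fcoef f m n.+1.
Proof.
move=> sf; have sh := @is_schwartz_herm R.
rewrite /fcoef (pairing_zbpm _ sf (sh n m)) zbmm_herm (pairingZr _ sf (sh _ _)).
by move: (pairing f _) => A; ring.
Qed.

Lemma fcoef_lower2 f m n : is_schwartz f ->
  fcoef (zpm (-1) f) m n = 2 * csqrt n * fcoef f m n.-1.
Proof.
move=> sf; have sh := @is_schwartz_herm R.
rewrite /fcoef (pairing_zpm _ sf (sh n m)) opprK zpm_herm (pairingZr _ sf (sh _ _)).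
by move: (pairing f _) => A; ring.
Qed.

(** Number operator with eigenvalue m + 1 on f_mn: lowering and raising contribute 2 sqrt m each,
    hence 4 m and the factor 1/4. [number2] is its counterpart for n. *)
Definition number1 f : plane R -> R[i] := fun u => 4^-1 * zbpm (-1) (zpm 1 f) u + f u.
Definition number2 f : plane R -> R[i] := fun u => 4^-1 * zpm (-1) (zbpm 1 f) u + f u.

Lemma is_schwartz_number1 f : is_schwartz f -> is_schwartz (number1 f).
Proof.
by move=> sf; apply: is_schwartz_lin => //; apply: is_schwartz_zbpm; exact: is_schwartz_zpm.
Qed.

Lemma is_schwartz_number2 f : is_schwartz f -> is_schwartz (number2 f).
Proof.
by move=> sf; apply: is_schwartz_lin => //; apply: is_schwartz_zpm; exact: is_schwartz_zbpm.
Qed.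

Lemma fcoef_number1 f m n : is_schwartz f ->
  fcoef (number1 f) m n = m.+1%:R * fcoef f m n.
Proof.
move=> sf; have s1 := is_schwartz_zpm 1 sf; have s2 := is_schwartz_zbpm (-1) s1.
rewrite /number1 fcoef_lin// fcoef_lower1// fcoef_raise1// -[m.+1%:R]natr1.
move: (fcoef f) => F; case: m => [|m]; first by rewrite csqrt0; ring.
by rewrite -(csqrt_sqr m.+1) [m.+1.-1]/=; move: (csqrt m.+1) (F m.+1 n) => c X; field.
Qed.

Lemma fcoef_number2 f m n : is_schwartz f ->
  fcoef (number2 f) m n = n.+1%:R * fcoef f m n.
Proof.
move=> sf; have s1 := is_schwartz_zbpm 1 sf; have s2 := is_schwartz_zpm (-1) s1.
rewrite /number2 fcoef_lin// fcoef_lower2// fcoef_raise2// -[n.+1%:R]natr1.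
move: (fcoef f) => F; case: n => [|n]; first by rewrite csqrt0; ring.
by rewrite -(csqrt_sqr n.+1) [n.+1.-1]/=; move: (csqrt n.+1) (F m n.+1) => c X; field.
Qed.

Transparent pairing.
Lemma fcoef_bound f : is_schwartz f ->
  exists2 K, 0 <= K & forall m n, cnorm (fcoef f m n) <= K * nn m n ^+ 4.
Proof.
move=> sf; have [cf [K fK]] := is_schwartz_cdom sf.
have K0 : 0 <= K := le_trans (mulr_ge0 (bracket_ge0 (0, 0)) (cnorm_ge0 _)) (fK (0, 0)).
set c := cnorm ((4 * pi)^-1%:C : R[i]).
have c0 : 0 <= c := cnorm_ge0 _.
exists (c * (2 * pi ^+ 2 * (K * herm_const))).
  exact: mulr_ge0 c0 (mulr_ge0 (mulr_ge0 (ler0n _ 2) (exprn_ge0 _ (pi_ge0 R))) (mulr_ge0 K0 herm_const_ge0)).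
move=> m n; rewrite /fcoef cnormM -/c -[leRHS]mulrA ler_wpM2l//.
rewrite -[leRHS]mulrA; apply: cintegral_bound.
  apply: ccontM => //; exact: (cdom_herm n m).1.
move=> u; rewrite cnormM mulrA.
rewrite -[leRHS]mulrA ler_pM ?cnorm_ge0//; first exact: mulr_ge0 (bracket_ge0 u) (cnorm_ge0 _).
by rewrite nnC; exact: herm_bound.
Qed.
Opaque pairing.

(** Applying both number operators k + 4 times stays in the Schwartz class and multiplies the
    coefficients by [nn m n ^+ (k + 4)]; the general bound by [nn m n ^+ 4] then leaves k powers of
    decay. *)
Lemma fcoef_rapid f k : is_schwartz f ->
  exists2 K, 0 <= K & forall m n, nn m n ^+ k * cnorm (fcoef f m n) <= K.
Proof.
move=> sf; pose N := number1 \o number2.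
pose F j := iter j N f.
have sF j : is_schwartz (F j).
  elim: j => [//|j IH]; rewrite /F iterS.
  by apply: is_schwartz_number1; exact: is_schwartz_number2.
have cF j m n : cnorm (fcoef (F j) m n) = nn m n ^+ j * cnorm (fcoef f m n).
  elim: j => [|j IH]; first by rewrite expr0 mul1r.
  rewrite /F iterS -/(F j) [N _]/= fcoef_number1; last exact: is_schwartz_number2.
  by rewrite (fcoef_number2 _ _ (sF j)) 2!cnormM 2!cnorm_nat IH exprS mulrA -[RHS]mulrA.
have [K K0 HK] := fcoef_bound (sF (k + 4)%N); exists K => // m n.
have p0 : 0 < nn m n ^+ 4 :> R by rewrite exprn_gt0 ?nn_gt0.
by have := HK m n; rewrite cF exprD mulrAC ler_pM2r.
Qed.

Transparent pairing.
Lemma fcoef00 : fcoef (herm 0 0) 0 0 = 1.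
Proof.
rewrite /fcoef /pairing.
have -> : (fun u : plane R => herm 0 0 u * herm 0 0 u) =
    fun u => 4%:R * ((gauss u)%:C * (gauss u)%:C).
  by apply/funext => u; rewrite !herm00; ring.
rewrite cintegralZ; last by apply: cdom_schwartzM; exact: is_schwartz_gauss.
rewrite cintegral_gauss2 -rc_nat -!rcM.
by rewrite mulVf ?mulf_neq0 ?pnatr_eq0// gt_eqF// pi_gt0.
Qed.

Opaque pairing fcoef.

Lemma fcoef_herm a b m n : fcoef (herm a b) m n = ((a == m) && (b == n))%:R.
Proof.
have sh := @is_schwartz_herm R.
have two : (2 : R[i]) != 0 by rewrite pnatr_eq0.
have e1 : fcoef (herm a b) m n = (a == m)%:R * fcoef (herm 0 b) 0 n.
  apply: (@ladder_delta _ (fun a m => fcoef (herm a b) m n)) => {}a {}m; apply: (mulfI two).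
    by rewrite [LHS]mulrA [RHS]mulrA -(fcoef_raise1 m n (sh a b)) zpm_herm (fcoefZ _ _ _ (sh _ _)).
  by rewrite [LHS]mulrA [RHS]mulrA -(fcoef_lower1 m n (sh a b)) zbmm_herm (fcoefZ _ _ _ (sh _ _)).
rewrite e1 {e1}.
have e2 : fcoef (herm 0 b) 0 n = (b == n)%:R * fcoef (herm 0 0) 0 0.
  apply: (@ladder_delta _ (fun b n => fcoef (herm 0 b) 0 n)) => {}b {}n; apply: (mulfI two).
    by rewrite [LHS]mulrA [RHS]mulrA -(fcoef_raise2 0 n (sh 0 b)) zbpm_herm (fcoefZ _ _ _ (sh _ _)).
  by rewrite [LHS]mulrA [RHS]mulrA -(fcoef_lower2 0 n (sh 0 b)) zmm_herm (fcoefZ _ _ _ (sh _ _)).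
by rewrite e2 fcoef00 mulr1 -natrM mulnb.
Qed.
End HermiteCoefficients.

(** * Testing a function against narrow Gaussians *)

Section Peak.
Context {R : realType}.
Implicit Types (u v : plane R).

Definition peak (a : R) u0 u : R :=
  expR (- (a * ((u.1 - u0.1) ^+ 2 + (u.2 - u0.2) ^+ 2))).

Lemma peak_ge0 a u0 u : 0 <= peak a u0 u.
Proof. exact: expR_ge0. Qed.

Lemma peakD a b u0 u : peak (a + b) u0 u = peak a u0 u * peak b u0 u.
Proof. by rewrite /peak -expRD mulrDl opprD. Qed.

Lemma peak_le1 a u0 u : 0 <= a -> peak a u0 u <= 1.
Proof.
by move=> a0; rewrite /peak -expR0 ler_expR oppr_le0 mulr_ge0// addr_ge0 ?sqr_ge0.
Qed.

Lemma continuous_peak a u0 : continuous (peak a u0).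
Proof.
have -> : peak a u0 = fun u : plane R =>
    expR (- (a * (u.1 - u0.1) ^+ 2)) * expR (- (a * (u.2 - u0.2) ^+ 2)).
  by apply/funext => u; rewrite /peak -expRD; congr expR; ring.
move=> u; apply: cvgM.
  exact: continuous_fst_comp (@continuous_expR_sqr R a u0.1) u.
exact: continuous_snd_comp (@continuous_expR_sqr R a u0.2) u.
Qed.

Lemma rdom_peak a u0 : 0 < a -> rdom (peak a u0).
Proof.
move=> a0; split; first exact: continuous_peak.
(* From x^2 <= 2 x0^2 + 2 (x - x0)^2, where (x - x0)^2 = y / a, and 1 + y <= exp y. *)
have H (x x0 : R) : (1 + x ^+ 2) * expR (- (a * (x - x0) ^+ 2)) <= 1 + 2 * x0 ^+ 2 + 2 / a.
  set y := a * (x - x0) ^+ 2; have y0 : 0 <= y by rewrite mulr_ge0 ?sqr_ge0 ?ltW.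
  rewrite expRN ler_pdivrMr ?expR_gt0//.
  have h1 : 1 + y <= expR y := expR_ge1Dx _.
  have -> : 1 + x ^+ 2 = 1 + x0 ^+ 2 + 2 * (x - x0) * x0 + (x - x0) ^+ 2 by ring.
  have h2 : 2 * (x - x0) * x0 <= (x - x0) ^+ 2 + x0 ^+ 2.
    by have := sqr_ge0 (x - x0 - x0); rewrite sqrrB; lra.
  have h3 : (x - x0) ^+ 2 = y / a by rewrite /y; field; rewrite gt_eqF.
  have ia : 0 < a^-1 by rewrite invr_gt0.
  apply: (@le_trans _ _ ((1 + 2 * x0 ^+ 2 + 2 / a) * (1 + y))); last first.
    apply: ler_wpM2l => //; have := sqr_ge0 x0.
    have : 0 <= 2 / a by rewrite divr_ge0// ltW.
    by move: (2 / a) => w h5 h6; lra.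
  have h4 := sqr_ge0 x0; rewrite h3 in h2 *.
  have : 0 <= x0 ^+ 2 * y by rewrite mulr_ge0.
  have : 0 <= y / a by rewrite mulr_ge0 ?(ltW ia).
  set z := y / a; rewrite -/z in h2; move=> z0 xy.
  have -> : (1 + 2 * x0 ^+ 2 + 2 / a) * (1 + y) = 1 + 2 * x0 ^+ 2 + 2 / a + y + 2 * (x0 ^+ 2 * y) + 2 * z.
    by rewrite /z; ring.
  have : 0 <= 2 / a by rewrite mulr_ge0 ?(ltW ia).
  by move: (2 / a) (2 * (x - x0) * x0) h2 => w t h2 w0; lra.
exists ((1 + 2 * u0.1 ^+ 2 + 2 / a) * (1 + 2 * u0.2 ^+ 2 + 2 / a)) => u.
rewrite ger0_norm ?peak_ge0//; apply: bracket_bound.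
have -> : bracket u * peak a u0 u =
    ((1 + u.1 ^+ 2) * expR (- (a * (u.1 - u0.1) ^+ 2))) *
    ((1 + u.2 ^+ 2) * expR (- (a * (u.2 - u0.2) ^+ 2))).
  rewrite /peak mulrDr opprD expRD /bracket; ring.
by rewrite ler_pM ?H// mulr_ge0 ?expR_ge0// addr_ge0 ?sqr_ge0.
Qed.

Lemma rint_peak a u0 : 0 < a -> rint (peak a u0) = pi / a.
Proof. exact: rint_gaussian. Qed.

Lemma expR_ge_sqr (y : R) : 0 <= y -> 1 + y ^+ 2 / 2 <= expR y.
Proof. by move=> y0; have := expR_ge1Dxn 1 y0; rewrite (_ : 2`! = 2)%N. Qed.

(** If a value c > 0 is exceeded near u0, the peak with parameter (k+1) a collects a positive part
    of relative size c / (k+1), while away from u0 it is smaller than the peak with parameter a by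
    the factor exp(- k y). The two cannot balance for all k. *)
Lemma peak_vanish (phi : plane R -> R) (a K : R) u0 : 0 < a -> continuous phi ->
  (forall u, `|phi u| <= K) ->
  (forall k : nat, rint (fun u => phi u * peak (k.+1%:R * a) u0 u) = 0) ->
  phi u0 = 0.
Proof.
move=> a0.
suff H (psi : plane R -> R) : continuous psi -> (forall u, `|psi u| <= K) ->
  (forall k : nat, rint (fun u => psi u * peak (k.+1%:R * a) u0 u) = 0) ->
  psi u0 <= 0.
  move=> cp pK p0; apply/eqP; rewrite eq_le H//= -oppr_le0.
  apply: (H (fun u => - phi u)).
  - by move=> u; apply: cvgN; exact: cp.
  - by move=> u; rewrite normrN.
  - move=> k; rewrite -[RHS](mulr0 (-1)) -(p0 k) -rintZ.
      by congr rint; apply/funext => u; ring.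
    have ak : 0 < k.+1%:R * a by rewrite mulr_gt0.
    have [c [L hL]] := rdom_peak u0 ak.
    split; first by move=> u; apply: cvgM; [exact: cp|exact: c].
    by exists (K * L) => u; rewrite normrM -mulrA ler_pM.
move=> cp pK p0; rewrite leNgt; apply/negP => pos.
pose c := psi u0 / 2; have c0 : 0 < c by rewrite divr_gt0.
have K0 : 0 <= K := le_trans (normr_ge0 _) (pK u0).
have [d d0 near] := continuous_plane (cp u0) c0.
pose y := a * d ^+ 2; have y0 : 0 < y by rewrite mulr_gt0 ?exprn_gt0.
have key (k : nat) : c / k.+1%:R <= (c + K) * expR (- (k%:R * y)).
  pose b := k.+1%:R * a; have b0 : 0 < b by rewrite mulr_gt0.
  have [cpk [L hL]] := rdom_peak u0 b0.
  have dpsi : rdom (fun u => psi u * peak b u0 u).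
    split; first by move=> u; apply: cvgM; [exact: cp|exact: cpk].
    by exists (K * L) => u; rewrite normrM -mulrA ler_pM.
  have d1 := rdomZ c (rdom_peak u0 b0).
  have d2 := rdomZ (- ((c + K) * expR (- (k%:R * y)))) (rdom_peak u0 a0).
  have low u : c * peak b u0 u + - ((c + K) * expR (- (k%:R * y))) * peak a u0 u <=
      psi u * peak b u0 u.
    have pb := peak_ge0 b u0 u; have pa := peak_ge0 a u0 u.
    have [/andP[n1 n2]|far] := boolP ((`|u.1 - u0.1| < d) && (`|u.2 - u0.2| < d)).
      have := near u n1 n2; rewrite ltr_norml => /andP[h _].
      have h1 : c <= psi u by move: h; rewrite /c; lra.
      have h2 : c * peak b u0 u <= psi u * peak b u0 u by rewrite ler_wpM2r.
      have h3 : 0 <= (c + K) * expR (- (k%:R * y)) * peak a u0 u.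
        by rewrite !mulr_ge0 ?expR_ge0 ?addr_ge0 ?(ltW c0).
      by rewrite mulNr; lra.
    have far2 : d ^+ 2 <= (u.1 - u0.1) ^+ 2 + (u.2 - u0.2) ^+ 2.
      have sq (x : R) : d <= `|x| -> d ^+ 2 <= x ^+ 2.
        by move=> dx; rewrite -[x ^+ 2]real_normK ?num_real// lerXn2r ?nnegrE// ltW.
      have s1 := sqr_ge0 (u.1 - u0.1); have s2 := sqr_ge0 (u.2 - u0.2).
      by move: far; rewrite negb_and -!leNgt => /orP[/sq h|/sq h]; lra.
    have e : peak b u0 u <= expR (- (k%:R * y)) * peak a u0 u.
      have -> : b = k%:R * a + a by rewrite /b -natr1; ring.
      rewrite peakD ler_wpM2r// /peak ler_expR lerN2 /y mulrA ler_wpM2l//.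
      by rewrite mulr_ge0 ?(ltW a0).
    have p1 : - K <= psi u by have := pK u; rewrite ler_norml => /andP[].
    have h1 : - K * peak b u0 u <= psi u * peak b u0 u by rewrite ler_wpM2r.
    have cK : 0 <= c + K by rewrite addr_ge0 ?(ltW c0).
    have h2 := ler_wpM2l cK e.
    move: h1 h2; clear; clearbody c.
    by move: (peak b u0 u) (peak a u0 u) (expR _) (psi u) => P Q E ps h1 h2; lra.
  have := rint_le (rdomD d1 d2) dpsi low; rewrite p0 (rintD d1 d2).
  rewrite (rintZ _ (rdom_peak u0 b0)) (rintZ _ (rdom_peak u0 a0)) !rint_peak//.
  have pa : 0 < pi / a by rewrite divr_gt0 ?pi_gt0.
  have -> : c * (pi / b) = c / k.+1%:R * (pi / a) by rewrite /b invfM; ring.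
  by rewrite -mulrDl pmulr_lle0// subr_le0.
have : c <= 0.
  move: y0 c0 K0 key; clearbody y c; clear => y0 c0 K0 key.
  (* A quadratic lower bound on the exponential is enough: exp(N y) >= 1 + (N y)^2 / 2, and 8 / y^2
     is chosen so that the product contains 4 N^2, giving (N+1)^2 in [q]. *)
  apply: (@le0_of_rate _ _ ((c + K) * (4 + 8 / y ^+ 2))) => N.
  have := key N; rewrite expRN => h.
  have Ny0 : 0 <= N%:R * y := mulr_ge0 (ler0n _ N) (ltW y0).
  have e1 := expR_ge_sqr Ny0.
  have ep := expR_gt0 (N%:R * y).
  have n1 : 0 < N.+1%:R :> R by [].
  have cK : 0 < c + K by rewrite ltr_wpDr.
  rewrite ler_pdivrMr// in h; rewrite ler_pdivlMr//.
  have yi : 0 < (y ^+ 2)^-1 by rewrite invr_gt0 exprn_gt0.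
  have q : N.+1%:R ^+ 2 <= (4 + 8 / y ^+ 2) * expR (N%:R * y).
    have -> : N.+1%:R = N%:R + 1 :> R by rewrite natr1.
    have nn0 : 0 <= N%:R :> R by [].
    have g : (4 + 8 / y ^+ 2) * (1 + (N%:R * y) ^+ 2 / 2) =
      4 + 2 * (N%:R * y) ^+ 2 + 8 / y ^+ 2 + 4 * N%:R ^+ 2 by field; rewrite gt_eqF.
    have c8 : 0 <= 4 + 8 / y ^+ 2 by rewrite addr_ge0 ?mulr_ge0 ?(ltW yi).
    apply: le_trans (ler_wpM2l c8 e1); rewrite g.
    have : 0 <= 8 / y ^+ 2 by rewrite mulr_ge0 ?(ltW yi).
    have := sqr_ge0 (N%:R * y); have := sqr_ge0 (N%:R - 1 : R).
    move: (8 / y ^+ 2) ((N%:R * y) ^+ 2) => s t; rewrite sqrrB1; nra.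
  have h2 : c * N.+1%:R <= (c + K) * (expR (N%:R * y))^-1 * N.+1%:R ^+ 2.
    rewrite expr2 mulrA ler_wpM2r//; exact: h.
  apply: le_trans h2 _; rewrite -mulrA ler_wpM2l ?(ltW cK)//.
  by rewrite mulrC ler_pdivrMr.
by rewrite leNgt c0.
Qed.

End Peak.

(** * The remainder of the exponential series *)

Section ExponentialTail.
Context {R : realType}.

Lemma series_exp_le (x : R) N : 0 <= x -> series (exp_coeff x) N <= expR x.
Proof.
move=> x0; apply: nondecreasing_cvgn_le; last exact: is_cvg_series_exp_coeff.
apply/nondecreasing_seqP => n; rewrite seriesSr lerDl; exact: exp_coeff_ge0.
Qed.

Lemma exp_coeffD (y : R) N : series (exp_coeff y) N.+1 =
  series (exp_coeff y) N + y ^+ N / N`!%:R.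
Proof. by rewrite seriesSr /exp_coeff. Qed.

(** For k >= N one has |y|^k <= 2^-N (2 |y|)^k. The geometric gain costs a doubled exponent, which
    [gauss_sqdist] pays for. *)
Lemma expR_tail (y : R) N :
  `|expR y - series (exp_coeff y) N| <= (2 ^+ N)^-1 * expR (2 * `|y|).
Proof.
have p2 k : 0 < 2 ^+ k :> R by rewrite exprn_gt0.
have i2 k : 0 <= (2 ^+ k)^-1 :> R by rewrite invr_ge0 (ltW (p2 k)).
have y2 : 0 <= 2 * `|y| by rewrite mulr_ge0.
have H d : `|series (exp_coeff y) (d + N)%N - series (exp_coeff y) N| <=
    (2 ^+ N)^-1 * (series (exp_coeff (2 * `|y|)) (d + N)%N).
  elim: d => [|d IH].
    rewrite [(0 + N)%N]/= subrr normr0 mulr_ge0//.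
    by rewrite sumr_ge0// => i _; rewrite exp_coeff_ge0.
  rewrite addSn (exp_coeffD y) (exp_coeffD (2 * _)) addrAC mulrDr.
  rewrite (le_trans (ler_normD _ _))// lerD//.
  have -> : `|y ^+ (d + N) / (d + N)`!%:R| = `|y| ^+ (d + N) / (d + N)`!%:R.
    by rewrite normrM normrX normfV normr_nat.
  rewrite mulrA ler_wpM2r ?invr_ge0//.
  rewrite exprMn mulrA ler_peMl ?exprn_ge0// exprD mulrCA mulVf ?mulr1 ?gt_eqF//.
  by rewrite exprn_ege1// ler1n.
set B := _^-1 * _.
have HB M : (N <= M)%N -> `|series (exp_coeff y) M - series (exp_coeff y) N| <= B.
  move=> NM; have := H (M - N)%N; rewrite subnK// => /le_trans; apply.
  by rewrite ler_wpM2l// series_exp_le.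
apply/ler_addgt0Pl => e e0.
have /cvgrPdist_le /(_ _ e0) [M _ HM] : series (exp_coeff y) @ \oo --> expR y.
  exact: is_cvg_series_exp_coeff.
have := HM (M + N)%N (leq_addr _ _); have := HB (M + N)%N (leq_addl _ _).
set s := series _ _; set t := series _ _ => h1 h2.
have -> : expR y - t = (expR y - s) + (s - t) by ring.
by rewrite (le_trans (ler_normD _ _))// lerD.
Qed.
End ExponentialTail.

(** * Completeness of the f_mn *)

Section Completeness.
Context {R : realType}.
Implicit Types (f g h : plane R -> R[i]) (u v w x : plane R) (i : bool) (m n k l : nat).

Transparent fcoef pairing.
Lemma fcoefE f m n : fcoef f m n = (4 * pi)^-1%:C * pairing f (herm n m).
Proof. by []. Qed.

Lemma pairingE f g : pairing f g = cintegral (fun u => f u * g u).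
Proof. by []. Qed.
Opaque fcoef pairing.

Lemma fcoef_eq0 f m n : fcoef f m n = 0 -> pairing f (herm n m) = 0.
Proof.
move=> /eqP; rewrite fcoefE mulf_eq0 => /orP[|/eqP//].
move=> /eqP /(congr1 (@complex.Re R)) /= /eqP; rewrite gt_eqF// invr_gt0.
by rewrite mulr_gt0// pi_gt0.
Qed.

(** This class is stable under multiplication by coordinates, because they map f_mn to combinations
    of its neighbours; hence under polynomials, in particular Taylor polynomials of a Gaussian. *)
Definition hermite_null g := is_schwartz g /\ forall m n, fcoef g m n = 0.

Lemma hermite_null_lin (a : R[i]) f g : hermite_null f -> hermite_null g ->
  hermite_null (fun u => a * f u + g u).
Proof.
move=> [sf f0] [sg g0]; split=> [|m n]; first exact: is_schwartz_lin.
by rewrite (fcoef_lin _ _ _ sf sg) f0 g0 mulr0 addr0.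
Qed.

Lemma hermite_null0 : hermite_null (fun=> 0).
Proof.
split=> [|m n]; first exact: is_schwartz0.
have := fcoefZ 0 m n (@is_schwartz0 R); rewrite (_ : (fun u => _) = fun=> 0).
  by rewrite mul0r.
by apply/funext => u; rewrite mulr0.
Qed.

Lemma hermite_null_crd i g : hermite_null g -> hermite_null (fun u => crd i u * g u).
Proof.
move=> [sg g0]; split=> [|m n]; first exact: is_schwartz_crd.
have p0 a b : pairing g (herm a b) = 0.
  exact: fcoef_eq0 (g0 b a).
rewrite fcoefE pairing_mul.
have := sop_herm (false, i) n m; rewrite /sop [fst _]/= [snd _]/= => ->.
have sh := @is_schwartz_herm R.
have S3 := is_schwartzZ (sop_coef (false, i) n m 3) (sh n m.+1).
have S2 := is_schwartz_lin (sop_coef (false, i) n m 2) (sh n.-1 m) S3.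
have S1 := is_schwartz_lin (sop_coef (false, i) n m 1) (sh n.+1 m) S2.
rewrite (pairing_linr _ sg (sh n m.-1) S1) (pairing_linr _ sg (sh n.+1 m) S2).
rewrite (pairing_linr _ sg (sh n.-1 m) S3) (pairingZr _ sg (sh n m.+1)).
by rewrite p0 p0 p0 p0 !mulr0 !addr0 mulr0.
Qed.

Lemma hermite_null_ext f g : f =1 g -> hermite_null f -> hermite_null g.
Proof. by move=> /funext ->. Qed.

Lemma hermite_null_shift i (c : R) g : hermite_null g ->
  hermite_null (fun u => (crd i u - c%:C) * g u).
Proof.
move=> ng; apply: hermite_null_ext (hermite_null_lin (- c%:C) ng (hermite_null_crd i ng)) => u.
by ring.
Qed.

Definition sqdist u0 u : R := (u.1 - u0.1) ^+ 2 + (u.2 - u0.2) ^+ 2.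

Lemma hermite_null_sqdist (c : R) u0 g : hermite_null g ->
  hermite_null (fun u => (c * sqdist u0 u)%:C * g u).
Proof.
move=> ng.
have n1 := hermite_null_shift false u0.1 (hermite_null_shift false u0.1 ng).
have n2 := hermite_null_shift true u0.2 (hermite_null_shift true u0.2 ng).
apply: hermite_null_ext (hermite_null_lin c%:C n1 (hermite_null_lin c%:C n2 hermite_null0)) => u.
by rewrite /sqdist /crd !(rcM, rcD, rcX, rcN); ring.
Qed.

Lemma hermite_null_series (c : R) u0 g N : hermite_null g ->
  hermite_null (fun u => (series (exp_coeff (c * sqdist u0 u)) N)%:C * g u).
Proof.
move=> ng.
have H k : hermite_null (fun u => ((c * sqdist u0 u) ^+ k)%:C * g u).
  elim: k => [|k IH]; first by apply: hermite_null_ext ng => u; rewrite expr0 mul1r.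
  apply: hermite_null_ext (hermite_null_sqdist c u0 IH) => u.
  by rewrite mulrA -rcM -exprS.
elim: N => [|N IH].
  apply: hermite_null_ext hermite_null0 => u.
  by rewrite /series /= big_geq// mul0r.
apply: hermite_null_ext (hermite_null_lin (N`!%:R^-1)%:C (H N) IH) => u.
by rewrite exp_coeffD rcD rcM; ring.
Qed.

(** From |u - u0|^2 <= 2 |u|^2 + 2 |u0|^2. This is the origin of the step 1/8: the doubled exponent
    |u - u0|^2 / 4 of the Taylor error is still absorbed by one Gaussian factor. *)
Lemma gauss_sqdist u0 u :
  gauss u * expR (2 * (8^-1 * sqdist u0 u)) <= expR ((u0.1 ^+ 2 + u0.2 ^+ 2) / 2).
Proof.
rewrite /gauss -expRD ler_expR /sqdist.
have h1 := sqr_ge0 (u.1 + u0.1); have h2 := sqr_ge0 (u.2 + u0.2); nra.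
Qed.

Lemma continuous_gauss : continuous (@gauss R).
Proof. exact: (@ccont_gauss R).1. Qed.

(* Narrow Gaussians are obtained from the ground state by finitely many
   multiplications by exp (- |u - u0|^2 / 8), each a limit of polynomials. *)
Lemma gauss_peak_null u0 k g : hermite_null g ->
  cintegral (fun u => (gauss u * peak (k%:R * 8^-1) u0 u)%:C * g u) = 0.
Proof.
elim: k g => [|k IH] g ng.
  have [sg g0] := ng.
  have E : (fun u => (gauss u * peak (0%:R * 8^-1) u0 u)%:C * g u) =
      fun u => 2^-1 * (g u * herm 0 0 u).
    apply/funext => u; rewrite herm00 /peak mul0r mul0r oppr0 expR0 mulr1.
    by rewrite mulrCA [2^-1 * _]mulrA mulVf ?pnatr_eq0// mul1r mulrC.
  rewrite E cintegralZ; last by apply: cdom_schwartzM => //; exact: is_schwartz_herm.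
  by rewrite -pairingE (fcoef_eq0 (g0 0%N 0%N)) mulr0.
have [sg _] := ng; have [cg [K gK]] := is_schwartz_cdom sg.
pose a : R := k%:R * 8^-1; have a0 : 0 <= a by rewrite mulr_ge0.
pose W u := gauss u * peak a u0 u.
have W0 u : 0 <= W u by exact: mulr_ge0 (gauss_ge0 u) (peak_ge0 a u0 u).
have W1 u : W u <= gauss u by exact: ler_piMr (gauss_ge0 u) (peak_le1 u0 u a0).
have cW : ccont (fun u => (W u)%:C).
  by apply: ccont_real => u; apply: cvgM; [exact: continuous_gauss|exact: continuous_peak].
have bW u : cnorm ((W u)%:C : R[i]) <= 1.
  by rewrite cnormR ger0_norm// (le_trans (W1 u))// gauss_le1.
pose e u := - 8^-1 * sqdist u0 u.
have pe u : peak 8^-1 u0 u = expR (e u) by rewrite /peak /e /sqdist mulNr.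
have cp : cdom (fun u => (peak 8^-1 u0 u)%:C * g u).
  apply: (@cdomMb _ _ _ 1); [exact: ccont_real (@continuous_peak _ _ _)| |by split => //; exists K].
  by move=> u; rewrite cnormR ger0_norm ?peak_ge0// peak_le1.
have c1 : cdom (fun u => (W u)%:C * ((peak 8^-1 u0 u)%:C * g u)) by exact: (cdomMb cW bW).
have -> : (fun u => (gauss u * peak (k.+1%:R * 8^-1) u0 u)%:C * g u) =
    fun u => (W u)%:C * ((peak 8^-1 u0 u)%:C * g u).
  apply/funext => u; rewrite -natr1 mulrDl mul1r peakD -/a /W.
  by move: (gauss u) (peak a u0 u) (peak 8^-1 u0 u) (g u) => x1 x2 x3 x4; rewrite !rcM; ring.
apply: cnorm_eq0; apply/eqP; rewrite eq_le cnorm_ge0 andbT.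
pose B := expR ((u0.1 ^+ 2 + u0.2 ^+ 2) / 2).
apply: (@le0_of_rate _ _ (2 * pi ^+ 2 * (B * K))) => N.
pose S u := (series (exp_coeff (e u)) N)%:C * g u.
have nS : hermite_null S by exact: hermite_null_series.
have c2 : cdom (fun u => (W u)%:C * S u).
  by apply: (cdomMb cW bW); exact: is_schwartz_cdom nS.1.
rewrite -[cintegral _]subr0 -(IH S nS) -/a -/W -cintegralB//.
have c3 := cdomB c1 c2.
have K0 : 0 <= K := le_trans (mulr_ge0 (bracket_ge0 (0, 0)) (cnorm_ge0 _)) (gK (0, 0)).
rewrite -[2 * pi ^+ 2 * _ / _]mulrA.
apply: cintegral_bound c3.1 _ => u.
have -> : (W u)%:C * ((peak 8^-1 u0 u)%:C * g u) - (W u)%:C * S u =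
    (W u * (expR (e u) - series (exp_coeff (e u)) N))%:C * g u.
  by rewrite /S pe rcM rcD rcN; ring.
rewrite cnormM cnormR normrM (ger0_norm (W0 u)) mulrCA.
have -> : B * K / N.+1%:R = B / N.+1%:R * K by rewrite mulrAC.
apply: (ler_pM _ (mulr_ge0 (ltW (bracket_gt0 u)) (cnorm_ge0 _)) _ (gK u)).
  exact: mulr_ge0 (W0 u) (normr_ge0 _).
have h := expR_tail (e u) N.
have e8 : `|e u| = 8^-1 * sqdist u0 u.
  by rewrite /e mulNr normrN ger0_norm// mulr_ge0 ?addr_ge0 ?sqr_ge0.
rewrite e8 in h.
apply: le_trans (ler_pM (W0 u) (normr_ge0 _) (W1 u) h) _.
rewrite mulrCA mulrC.
have i2 : 0 <= 2 ^- N :> R by rewrite invr_ge0 exprn_ge0.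
apply: (ler_pM (mulr_ge0 (gauss_ge0 u) (expR_ge0 _)) i2 (gauss_sqdist u0 u)).
rewrite lef_pV2 ?posrE ?exprn_gt0// -natrX ler_nat.
exact: ltn_expl.
Qed.

(** The product gauss * g integrates to 0 against all peaks around u0 with parameter (k+1)/8, so
    [peak_vanish] applies to its real and imaginary parts, and the Gaussian is nonzero at u0. *)
Lemma hermite_null_eq0 g : hermite_null g -> g =1 fun=> 0.
Proof.
move=> ng u0; have [sg _] := ng; have [[cr ci] [K gK]] := is_schwartz_cdom sg.
have gb u : cnorm (g u) <= K.
  by apply: le_trans (gK u); rewrite ler_peMl ?cnorm_ge0 ?bracket_ge1.
have g0 : gauss u0 != 0 by rewrite gt_eqF// expR_gt0.
have p8 : 0 < 8^-1 :> R by rewrite invr_gt0.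
have key (phi : plane R -> R) : continuous phi -> (forall u, `|phi u| <= K) ->
    (forall k, rint (fun u => gauss u * phi u * peak (k.+1%:R * 8^-1) u0 u) = 0) ->
    phi u0 = 0.
  move=> cphi bphi H; apply/eqP; rewrite -[_ == 0](mulrI_eq0 _ (mulfI g0)); apply/eqP.
  apply: (@peak_vanish _ (fun u => gauss u * phi u) 8^-1 K) => //.
    by move=> u; apply: cvgM; [exact: continuous_gauss|exact: cphi].
  move=> u; rewrite normrM (ger0_norm (gauss_ge0 u)) -[leRHS]mul1r.
  by rewrite ler_pM ?gauss_ge0 ?gauss_le1.
apply: complexP => /=; [apply: (key (re_part g))|apply: (key (im_part g))] => //.
- by move=> u; apply: le_trans (gb u); exact: cnorm_Re.
- move=> k; have := gauss_peak_null u0 k.+1 ng.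
  move=> /(congr1 (@complex.Re R)); rewrite cintegralE [complex.Re _]/= => E.
  by rewrite -[RHS]E; congr rint; apply/funext => u; rewrite /re_part cReM /= mul0r subr0 mulrAC.
- by move=> u; apply: le_trans (gb u); exact: cnorm_Im.
- move=> k; have := gauss_peak_null u0 k.+1 ng.
  move=> /(congr1 (@complex.Im R)); rewrite cintegralE [complex.Im _]/= => E.
  by rewrite -[RHS]E; congr rint; apply/funext => u; rewrite /im_part cImM /= mul0r addr0 mulrAC.
Qed.

Lemma fcoef_inj f g : is_schwartz f -> is_schwartz g ->
  (forall m n, fcoef f m n = fcoef g m n) -> f = g.
Proof.
move=> sf sg fg; apply/funext => u.
have /hermite_null_eq0 /(_ u) /eqP : hermite_null (fun u => -1 * g u + f u).
  split=> [|m n]; first exact: is_schwartz_lin.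
  by rewrite (fcoef_lin _ _ _ sg sf) fg mulN1r addNr.
by rewrite mulN1r addrC subr_eq0 => /eqP.
Qed.

End Completeness.

(** * Hermite series *)

Section SumsOfBoxes.
Context {R : realType}.
Implicit Types (x y : nat -> nat -> R[i]) (z w : R[i]).

(* Both sums are 0 when the partial sums have no limit at rate 1/(N+1). *)
Definition csum x : R[i] := xget 0 [set z | clim (boxsum x) z].
Definition csum1 (x : nat -> R[i]) : R[i] := xget 0 [set z | clim (fun N => \sum_(n < N) x n) z].

Lemma csum_eq x z : clim (boxsum x) z -> csum x = z.
Proof.
move=> xz; have : clim (boxsum x) (csum x) := @xgetPex _ 0 [set z | clim (boxsum x) z] (ex_intro _ z xz).
by move=> /clim_unique; apply.
Qed.

Lemma csum1_eq (x : nat -> R[i]) z : clim (fun N => \sum_(n < N) x n) z -> csum1 x = z.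
Proof.
move=> xz; have : clim (fun N => \sum_(n < N) x n) (csum1 x) :=
  @xgetPex _ 0 [set z | clim (fun N => \sum_(n < N) x n) z] (ex_intro _ z xz).
by move=> /clim_unique; apply.
Qed.

Definition summable x := exists K, forall m n, cnorm (x m n) <= K * wt m * wt n.

Lemma csum_rate x K N : (forall m n, cnorm (x m n) <= K * wt m * wt n) ->
  cnorm (csum x - boxsum x N) <= (8 * K + 8 * K) / N.+1%:R.
Proof. by move=> xK; have [z /csum_eq -> ] := boxsum_clim xK. Qed.

Lemma csum_clim x : summable x -> clim (boxsum x) (csum x).
Proof. by move=> [K xK]; have [z h _] := boxsum_clim xK; rewrite (csum_eq h). Qed.

Lemma csum1_rate (x : nat -> R[i]) K N : (forall n, cnorm (x n) <= K * wt n) ->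
  cnorm (csum1 x - \sum_(n < N) x n) <= (2 * K + 2 * K) / N.+1%:R.
Proof. by move=> xK; have [z /csum1_eq -> ] := sum_clim xK. Qed.

Lemma csum1_clim (x : nat -> R[i]) K : (forall n, cnorm (x n) <= K * wt n) ->
  clim (fun N => \sum_(n < N) x n) (csum1 x).
Proof. by move=> xK; have [z h _] := sum_clim xK; rewrite (csum1_eq h). Qed.

Lemma boxsum_lin z x y N :
  boxsum (fun m n => z * x m n + y m n) N = z * boxsum x N + boxsum y N.
Proof.
rewrite /boxsum mulr_sumr -big_split; apply: eq_bigr => m _.
by rewrite mulr_sumr -big_split.
Qed.

Lemma csum_lin z x y : summable x -> summable y ->
  csum (fun m n => z * x m n + y m n) = z * csum x + csum y.
Proof.
move=> sx sy; apply: csum_eq; apply: (@eq_clim _ (fun N => z * boxsum x N + boxsum y N)).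
  by move=> N; rewrite boxsum_lin.
by apply: climD; [apply: climZ|]; exact: csum_clim.
Qed.

Lemma boxsum0 N : boxsum (fun _ _ => 0 : R[i]) N = 0.
Proof. by rewrite /boxsum big1// => m _; rewrite big1. Qed.

Lemma csum0 : csum (fun _ _ => 0) = 0.
Proof. by apply: csum_eq; apply: eq_clim (clim_cst 0) => N; rewrite boxsum0. Qed.

Lemma summable0 : summable (fun _ _ => 0).
Proof. by exists 0 => m n; rewrite cnorm0 !mul0r. Qed.

Lemma summable_lin z x y : summable x -> summable y ->
  summable (fun m n => z * x m n + y m n).
Proof.
move=> [K xK] [L yL]; exists (cnorm z * K + L) => m n.
rewrite (le_trans (cnormD _ _))// cnormM.
have := ler_wpM2l (cnorm_ge0 z) (xK m n); have := yL m n.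
move: (cnorm (x m n)) (cnorm (y m n)) => X Y h1 h2; lra.
Qed.

Lemma csumZ z x : summable x -> csum (fun m n => z * x m n) = z * csum x.
Proof.
move=> sx; rewrite -[RHS]addr0 -csum0 -(csum_lin z sx summable0).
by congr csum; do 2! apply/funext => ?; rewrite addr0.
Qed.

Lemma boxsum_bound x K N : (forall m n, cnorm (x m n) <= K * wt m * wt n) ->
  cnorm (boxsum x N) <= 4 * K.
Proof.
move=> xK; have K0 : 0 <= K.
  by have := le_trans (cnorm_ge0 _) (xK 0%N 0%N); rewrite /wt expr1n invr1 !mulr1.
rewrite (le_trans (cnorm_sum _ _ _))//.
apply: (@le_trans _ _ (\sum_(m < N) K * wt m * 2)); last first.
  rewrite -mulr_suml -mulr_sumr; have := ler_wpM2l K0 (@wt_sum R N).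
  set s := \sum_(_ < _) _; move=> h; lra.
apply: ler_sum => m _; rewrite (le_trans (cnorm_sum _ _ _))//.
apply: (@le_trans _ _ (\sum_(n < N) K * wt m * wt n)); first exact: ler_sum.
by rewrite -mulr_sumr ler_wpM2l ?wt_sum// mulr_ge0 ?wt_ge0.
Qed.

Lemma csum_bound x K : (forall m n, cnorm (x m n) <= K * wt m * wt n) ->
  cnorm (csum x) <= 4 * K.
Proof.
move=> xK; have sx : summable x by exists K.
apply: (clim_le (K := 0) _ (csum_clim sx)) => N.
by rewrite mul0r addr0; exact: boxsum_bound.
Qed.

Lemma csum1_bound (x : nat -> R[i]) K : (forall n, cnorm (x n) <= K * wt n) ->
  cnorm (csum1 x) <= 2 * K.
Proof.
move=> xK; have K0 : 0 <= K.
  by have := le_trans (cnorm_ge0 _) (xK 0%N); rewrite /wt expr1n invr1 !mulr1.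
apply: (clim_le (K := 0) _ (csum1_clim xK)) => N.
rewrite mul0r addr0 (le_trans (cnorm_sum _ _ _))//.
apply: (@le_trans _ _ (\sum_(n < N) K * wt n)); first exact: ler_sum.
by rewrite -mulr_sumr mulrC ler_wpM2r// wt_sum.
Qed.

Lemma csum_transpose x : csum (fun m n => x n m) = csum x.
Proof.
rewrite /csum (_ : boxsum (fun m n => x n m) = boxsum x)//.
by apply/funext => N; rewrite /boxsum exchange_big.
Qed.

Lemma csum_delta x k l : (forall m n, (m, n) <> (k, l) -> x m n = 0) -> csum x = x k l.
Proof.
(* Until the box contains (k, l) the error is the whole entry; since N <= k + l there, the factor k
   + l + 1 pays for the rate. *)
move=> H; apply: csum_eq; exists (cnorm (x k l) * (k + l).+1%:R) => N.
have [kN|Nk] := ltnP k N; last first.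
  rewrite /boxsum big1 ?subr0.
    by rewrite -mulrA ler_peMr ?cnorm_ge0// ler_pdivlMr// mul1r ler_nat; lia.
  by move=> m _; rewrite big1// => n _; apply: H => -[]; have := ltn_ord m; lia.
have [lN|Nl] := ltnP l N; last first.
  rewrite /boxsum big1 ?subr0.
    by rewrite -mulrA ler_peMr ?cnorm_ge0// ler_pdivlMr// mul1r ler_nat; lia.
  by move=> m _; rewrite big1// => n _; apply: H => -[]; have := ltn_ord n; lia.
rewrite /boxsum (bigD1 (Ordinal kN))//= (bigD1 (Ordinal lN))//= !big1 ?addr0 ?subrr ?cnorm0.
- by rewrite divr_ge0// mulr_ge0 ?cnorm_ge0.
- move=> m /eqP mk; rewrite big1// => n _; apply: H => -[] e _; apply: mk; exact: val_inj.
- move=> n /eqP nl; apply: H => -[] e; apply: nl; exact: val_inj.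
Qed.

Definition cube (x : nat -> nat -> nat -> R[i]) N : R[i] :=
  \sum_(m < N) \sum_(n < N) \sum_(k < N) x m n k.

(** Truncating the inner sums at N costs at most [4 * K / N.+1%:R * wt m * wt n], uniformly in m and
    n, so summing this error over the box keeps the rate. *)
Lemma cube_csum (x : nat -> nat -> nat -> R[i]) K :
  (forall m n k, cnorm (x m n k) <= K * wt m * wt n * wt k) ->
  clim (cube x) (csum (fun m n => csum1 (x m n))).
Proof.
move=> xK.
have K0 : 0 <= K.
  by have := le_trans (cnorm_ge0 _) (xK 0%N 0%N 0%N); rewrite /wt expr1n invr1 !mulr1.
have x1 m n := csum1_bound (xK m n).
have x2 : summable (fun m n => csum1 (x m n)).
  by exists (2 * K) => m n; rewrite -[2 * K * _]mulrA -mulrA x1.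
apply: (clim_sub (K := 4 * (4 * K)) _ (csum_clim x2)) => N.
rewrite /boxsum /cube -sumrB; under eq_bigr do rewrite -sumrB.
pose y m n := csum1 (x m n) - \sum_(k < N) x m n k.
have yb m n : cnorm (y m n) <= 4 * K / N.+1%:R * wt m * wt n.
  apply: le_trans (csum1_rate N (xK m n)) _.
  by set i := _^-1; rewrite le_eqVlt; apply/orP; left; apply/eqP; ring.
apply: le_trans (boxsum_bound N yb) _.
by rewrite mulrA.
Qed.

(* Both iterated sums are the limit of the sums over cubes. *)
Lemma csum_tri (x : nat -> nat -> nat -> R[i]) K :
  (forall m n k, cnorm (x m n k) <= K * wt m * wt n * wt k) ->
  csum (fun m n => csum1 (x m n)) = csum (fun n k => csum1 (fun m => x m n k)).
Proof.
move=> xK; apply: clim_unique (cube_csum xK) _.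
have yK n k m : cnorm (x m n k) <= K * wt n * wt k * wt m.
  by apply: le_trans (xK m n k) _; rewrite le_eqVlt; apply/orP; left; apply/eqP; ring.
apply: eq_clim (cube_csum (x := fun n k m => x m n k) yK) => N.
rewrite /cube [RHS]exchange_big; apply: eq_bigr => n _; exact: exchange_big.
Qed.

End SumsOfBoxes.

(** * Schwartz functions built from rapidly decreasing matrices *)

Section Synthesis.
Context {R : realType}.
Implicit Types (f g h : plane R -> R[i]) (u v w : plane R) (i : bool) (m n k l : nat).

Definition rapid_mx (a : nat -> nat -> R[i]) :=
  forall k, exists K, forall m n, nn m n ^+ k * cnorm (a m n) <= K.

Lemma nn_wt m n d (x K : R) : nn m n ^+ (d + 2) * x <= K ->
  nn m n ^+ d * x <= K * wt m * wt n.
Proof.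
move=> h; have e : wt m * wt n = (nn m n ^+ 2)^-1 :> R.
  by rewrite /wt -invfM -(exprMn 2).
rewrite -mulrA e ler_pdivlMr ?exprn_gt0 ?nn_gt0//.
by rewrite mulrAC -exprD.
Qed.

Lemma rapid_mx_wt (a : nat -> nat -> R[i]) (C : R) d : rapid_mx a -> 0 <= C ->
  exists2 K, 0 <= K & forall m n (z : R[i]) (e : R), 0 <= e ->
    cnorm z <= e * (C * nn m n ^+ d) ->
    cnorm (a m n * z) <= e * K * wt m * wt n.
Proof.
move=> ra C0; have [K aK] := ra (d + 2)%N.
have K0 : 0 <= K.
  by apply: le_trans (aK 0%N 0%N); exact: mulr_ge0 (nnX_ge0 _ _ _) (cnorm_ge0 _).
exists (C * K); first exact: mulr_ge0.
move=> m n z e e0 hz; have h := nn_wt (aK m n).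
rewrite cnormM; apply: le_trans (ler_wpM2l (cnorm_ge0 (a m n)) hz) _.
have := ler_wpM2l (mulr_ge0 e0 C0) h.
move: (cnorm _) (nn m n ^+ d) => x y; rewrite -!mulrA.
by apply: le_trans; rewrite le_eqVlt; apply/orP; left; apply/eqP; ring.
Qed.

Variable a : nat -> nat -> R[i].
Hypothesis ra : rapid_mx a.

(** The word [s] acts term by term. Carrying it in the definition makes the family over all [s]
    closed under derivatives and coordinates, as the coinduction for the Schwartz class requires. *)
Definition hermite_series (s : seq (bool * bool)) u : R[i] :=
  csum (fun m n => a m n * sops s (herm m n) u).
Local Notation F := hermite_series.

Lemma hermite_terms s : exists2 K, 0 <= K &
  forall u m n, cnorm (a m n * sops s (herm m n) u) <= K * wt m * wt n.
Proof.
have [C [d [C0 hC]]] := @sops_herm_bound R s.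
have [K K0 HK] := rapid_mx_wt d ra C0; exists K => // u m n.
by rewrite -[K]mul1r; apply: HK; rewrite ?mul1r.
Qed.

Lemma hermite_series_bounded s : exists M, forall u, cnorm (F s u) <= M.
Proof.
by have [K K0 HK] := hermite_terms s; exists (4 * K) => u; exact: csum_bound.
Qed.

Lemma hermite_summable s u : summable (fun m n => a m n * sops s (herm m n) u).
Proof. by have [K _ HK] := hermite_terms s; exists K. Qed.

(** Second derivatives of the terms are words again, bounded polynomially by [sops_herm_bound], so
    the Taylor remainders of the terms sum to a multiple of t^2. *)
Lemma hermite_series_cder s i : cder i (F s) (F ((true, i) :: s)).
Proof.
have [C [d [C0 hC]]] := @sops_herm_bound R [:: (true, i), (true, i) & s].
have C2 : 0 <= C + C by rewrite addr_ge0.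
have [K K0 HK] := rapid_mx_wt d ra C2.
apply: (@cder_quad _ _ _ _ (fun=> 4 * K)) => u t _.
pose y m n := a m n * (sops s (herm m n) (u + t *: basis_vec i) - sops s (herm m n) u
   - t%:C * sops ((true, i) :: s) (herm m n) u).
have -> : F s (u + t *: basis_vec i) - F s u - t%:C * F ((true, i) :: s) u = csum y.
  have s1 := hermite_summable s (u + t *: basis_vec i).
  have s2 := hermite_summable s u.
  have s3 := hermite_summable ((true, i) :: s) u.
  have s4 := summable_lin (-1) s2 s1.
  have E := csum_lin (- t%:C) s3 s4; rewrite (csum_lin (-1) s2 s1) in E.
  rewrite /hermite_series mulN1r mulNr in E *; rewrite addrC [csum _ - csum _]addrC -E.
  by congr csum; apply/funext => m; apply/funext => n; rewrite /y; ring.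
rewrite -[leRHS]mulrA (mulrC K); apply: csum_bound => m n; apply: HK; first exact: exprn_ge0.
have sh := is_schwartz_sops s (@is_schwartz_herm R m n).
have [_ _ /(_ i)[sp d1]] := is_schwartz_elim sh.
have [_ _ /(_ i)[_ d2]] := is_schwartz_elim sp.
have := cder_taylor u t d1 d2 (hC m n).
by rewrite [leRHS]mulrC -mulrDl.
Qed.

Lemma hermite_series_crd s i u : crd i u * F s u = F ((false, i) :: s) u.
Proof.
rewrite /hermite_series -csumZ; last exact: hermite_summable.
by congr csum; apply/funext => m; apply/funext => n; rewrite /= /sop /= mulrCA.
Qed.

(** Expanding bracket = 1 + q^2 + p^2 + q^2 p^2 and moving the coordinates into the word trades a
    power of [bracket] for longer words, all of which give bounded series. *)
Lemma hermite_series_rapid s : rapid (F s).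
Proof.
move=> k; elim: k s => [|k IH] s.
  by have [M HM] := hermite_series_bounded s; exists M => u; rewrite expr0 mul1r.
pose q i s := [:: (false, i), (false, i) & s].
have [K1 H1] := IH s; have [K2 H2] := IH (q false s).
have [K3 H3] := IH (q true s); have [K4 H4] := IH (q false (q true s)).
exists (K1 + K2 + K3 + K4) => u.
have sq (x : R) t : x ^+ 2 * cnorm (F t u) = cnorm (x%:C * (x%:C * F t u)).
  by rewrite !cnormM !cnormR mulrA -expr2 real_normK// num_real.
have e2 t : u.1 ^+ 2 * cnorm (F t u) = cnorm (F (q false t) u).
  by rewrite sq -/(crd false u) !hermite_series_crd.
have e3 t : u.2 ^+ 2 * cnorm (F t u) = cnorm (F (q true t) u).
  by rewrite sq -/(crd true u) !hermite_series_crd.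
have -> : bracket u ^+ k.+1 * cnorm (F s u) = bracket u ^+ k * cnorm (F s u) +
    bracket u ^+ k * (u.1 ^+ 2 * cnorm (F s u)) + bracket u ^+ k * (u.2 ^+ 2 * cnorm (F s u)) +
    bracket u ^+ k * (u.1 ^+ 2 * (u.2 ^+ 2 * cnorm (F s u))).
  by rewrite exprS {1}/bracket; ring.
by rewrite (e3 s) (e2 s) (e2 (q true s)) !lerD.
Qed.

Lemma hermite_series_ccont s : ccont (F s).
Proof.
have [M0 H0] := hermite_series_bounded ((true, false) :: s).
have [M1 H1] := hermite_series_bounded ((true, true) :: s).
have B0 u : cnorm (F ((true, false) :: s) u) <= Num.max M0 M1.
  by apply: le_trans (H0 u) _; rewrite le_max lexx.
have B1 u : cnorm (F ((true, true) :: s) u) <= Num.max M0 M1.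
  by apply: le_trans (H1 u) _; rewrite le_max lexx orbT.
exact: cder_ccont (hermite_series_cder s false) (hermite_series_cder s true) B0 B1.
Qed.

Lemma is_schwartz_series s : is_schwartz (F s).
Proof.
apply: (@is_schwartz_coind _ (fun g => exists s, g = F s)); last by exists s.
move=> _ [{}s ->]; split; [exact: hermite_series_ccont|exact: hermite_series_rapid|].
move=> i; exists (F ((true, i) :: s)); [by exists ((true, i) :: s)|exact: hermite_series_cder].
Qed.

Lemma sops_series s : sops s (F [::]) = F s.
Proof.
elim: s => [//|[[] i] s /= ->]; rewrite /sop /=.
  exact: cder_partial (hermite_series_cder s i).
by apply/funext => u; exact: hermite_series_crd.
Qed.

Definition hermite_sum N u : R[i] := boxsum (fun m n => a m n * herm m n u) N.

Lemma boxsum_schwartz (b : nat -> nat -> plane R -> R[i]) N (s : seq (bool * bool)) :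
  (forall m n, is_schwartz (b m n)) ->
  is_schwartz (fun u => boxsum (fun m n => b m n u) N) /\
  sops s (fun u => boxsum (fun m n => b m n u) N) =
    fun u => boxsum (fun m n => sops s (b m n) u) N.
Proof.
move=> sb.
have H (I : Type) (r : seq I) (g : I -> plane R -> R[i]) : (forall j, is_schwartz (g j)) ->
    is_schwartz (fun u => \sum_(j <- r) g j u) /\
    sops s (fun u => \sum_(j <- r) g j u) = fun u => \sum_(j <- r) sops s (g j) u.
  move=> sg; elim: r => [|j r [IH1 IH2]].
    have E (G : I -> plane R -> R[i]) : (fun u => \sum_(j <- [::]) G j u) = fun=> 0.
      by apply/funext => u; rewrite big_nil.
    rewrite !E; split; first exact: is_schwartz0.
    have := sopsZ s 0 (@is_schwartz0 R); rewrite (_ : (fun u => 0 * 0) = fun=> 0).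
      by move=> {1}->; apply/funext => u; rewrite mul0r.
    by apply/funext => u; rewrite mul0r.
  have E (G : I -> plane R -> R[i]) : (fun u => \sum_(j <- j :: r) G j u) =
      fun u => 1 * G j u + \sum_(j <- r) G j u.
    by apply/funext => u; rewrite big_cons mul1r.
  rewrite (E g) (E (fun j => sops s (g j))); split; first exact: is_schwartz_lin.
  by rewrite sops_lin// IH2.
have H1 (p : 'I_N) := H _ (index_enum 'I_N) (fun q : 'I_N => b p q) (fun q : 'I_N => sb p q).
have [H2 H3] := H _ (index_enum 'I_N) (fun (p : 'I_N) u => \sum_(q < N) b p q u) (fun p : 'I_N => (H1 p).1).
split=> //; rewrite H3; apply/funext => u; apply: eq_bigr => m _.
by rewrite (H1 m).2.
Qed.

Lemma is_schwartz_sum N : is_schwartz (hermite_sum N).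
Proof.
apply: (boxsum_schwartz N [::] _).1 => m n; apply: is_schwartzZ; exact: is_schwartz_herm.
Qed.

Lemma hermite_series_rate s : exists K, forall N u,
  cnorm (sops s (fun u => F [::] u - hermite_sum N u) u) <= K / N.+1%:R.
Proof.
have [K K0 HK] := hermite_terms s; exists (8 * K + 8 * K) => N u.
have -> : (fun u => F [::] u - hermite_sum N u) = fun u => -1 * hermite_sum N u + F [::] u.
  by apply/funext => v; ring.
rewrite sops_lin; [|exact: is_schwartz_sum|exact: is_schwartz_series].
rewrite sops_series /hermite_sum.
have sa m n : is_schwartz (fun u => a m n * herm m n u).
  by apply: is_schwartzZ; exact: is_schwartz_herm.
rewrite (boxsum_schwartz N s sa).2 mulN1r addrC.
have -> : boxsum (fun m n => sops s (fun v => a m n * herm m n v) u) N =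
    boxsum (fun m n => a m n * sops s (herm m n) u) N.
  apply: eq_bigr => m _; apply: eq_bigr => n _; rewrite sopsZ//; exact: is_schwartz_herm.
exact: csum_rate.
Qed.
End Synthesis.

(** * Tempered functionals and Hermite expansions *)

Section TemperedFunctionals.
Context {R : realType}.
Implicit Types (f g h : plane R -> R[i]) (u v w : plane R) (i : bool) (m n k l : nat).
Implicit Types (L : (plane R -> R[i]) -> R[i]) (a b : nat -> nat -> R[i]).

(** Functionals on plain functions, continuous for finitely many sup norms of words. The notion
    covers distributions, pairings and the evaluation of a twisted product at a point, the last
    before the product is known to be a Schwartz function. *)
Definition tempered L :=
  (forall (c : R[i]) f g, is_schwartz f -> is_schwartz g ->
    L (fun u => c * f u + g u) = c * L f + L g) /\
  exists (ws : seq (seq (bool * bool))) (K : R), 0 <= K /\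
    forall f (B : R), is_schwartz f -> 0 <= B ->
      (forall s, s \in ws -> forall u, cnorm (sops s f u) <= B) -> cnorm (L f) <= K * B.

Lemma tempered_herm L : tempered L ->
  exists C d, 0 <= C /\ forall m n, cnorm (L (herm m n)) <= C * nn m n ^+ d.
Proof.
move=> [_ [ws [K [K0 HL]]]].
have [C [d [C0 H]]] : exists C d, 0 <= C /\ forall s, s \in ws -> forall m n u,
    cnorm (sops s (herm m n) u) <= C * nn m n ^+ d.
  elim: {HL} ws => [|s ws [C [d [C0 IH]]]]; first by exists 0, 0%N.
  have [C' [d' [C'0 H]]] := @sops_herm_bound R s.
  exists (C + C'), (d + d')%N; split; first exact: addr_ge0.
  have e m n e e' : nn m n ^+ e <= nn m n ^+ (e + e') :> R.
    by rewrite ler_weXn2l ?nn_ge1 ?leq_addr.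
  move=> s'; rewrite inE => /orP[/eqP -> m n u|/IH h m n u].
    apply: le_trans (H m n u) _; apply: (ler_pM C'0 (nnX_ge0 _ _ _)); first by rewrite lerDr.
    by rewrite addnC.
  apply: le_trans (h m n u) _; apply: (ler_pM C0 (nnX_ge0 _ _ _)) => //.
  by rewrite lerDl.
exists (K * C), d; split=> [|m n]; first exact: mulr_ge0.
rewrite -mulrA; apply: HL; [exact: is_schwartz_herm|exact: mulr_ge0 C0 (nnX_ge0 _ _ _)|].
by move=> s /H; apply.
Qed.

Lemma tempered0 L : tempered L -> L (fun=> 0) = 0.
Proof.
move=> [H _]; have := H (-1) _ _ (@is_schwartz0 R) (@is_schwartz0 R).
rewrite [-1 * L _]mulN1r addNr => E; rewrite -[RHS]E; congr L.
by apply/funext => u; ring.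
Qed.

Lemma temperedZ L (c : R[i]) f : tempered L -> is_schwartz f ->
  L (fun u => c * f u) = c * L f.
Proof.
move=> tL sf; have [H _] := tL; have := H c _ _ sf (@is_schwartz0 R).
by rewrite (tempered0 tL) addr0 (_ : (fun u => _) = fun u => c * f u)//; apply/funext => u; rewrite addr0.
Qed.

Lemma tempered_sum L (I : Type) (r : seq I) (g : I -> plane R -> R[i]) : tempered L ->
  (forall j, is_schwartz (g j)) ->
  is_schwartz (fun u => \sum_(j <- r) g j u) /\
  L (fun u => \sum_(j <- r) g j u) = \sum_(j <- r) L (g j).
Proof.
move=> tL sg; elim: r => [|j r [IH1 IH2]].
  rewrite big_nil (_ : (fun u => _) = fun=> 0); last by apply/funext => u; rewrite big_nil.
  by split; [exact: is_schwartz0|exact: tempered0].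
have -> : (fun u => \sum_(j <- j :: r) g j u) = fun u => 1 * g j u + \sum_(j <- r) g j u.
  by apply/funext => u; rewrite big_cons mul1r.
split; first exact: is_schwartz_lin.
by rewrite tL.1// big_cons IH2 mul1r.
Qed.

Lemma tempered_hermite_sum L a N : tempered L ->
  L (hermite_sum a N) = boxsum (fun m n => a m n * L (herm m n)) N.
Proof.
move=> tL; have sa m n : is_schwartz (fun u => a m n * herm m n u).
  by apply: is_schwartzZ; exact: is_schwartz_herm.
have H1 (p : 'I_N) := tempered_sum (index_enum 'I_N) (g := fun (q : 'I_N) u => a p q * herm p q u) tL (fun q : 'I_N => sa p q).
have [_ H3] := tempered_sum (index_enum 'I_N) (g := fun (p : 'I_N) u => \sum_(q < N) a p q * herm p q u) tL (fun p : 'I_N => (H1 p).1).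
rewrite /hermite_sum H3; apply: eq_bigr => m _; rewrite (H1 m).2.
by apply: eq_bigr => n _; rewrite (temperedZ _ tL)//; exact: is_schwartz_herm.
Qed.

Lemma tempered_summable L a : tempered L -> rapid_mx a ->
  summable (fun m n => a m n * L (herm m n)).
Proof.
move=> /tempered_herm[C [d [C0 H]]] ra; have [K K0 HK] := rapid_mx_wt d ra C0.
by exists K => m n; rewrite -[K]mul1r; apply: HK; rewrite ?mul1r.
Qed.

Lemma tempered_series L a : tempered L -> rapid_mx a ->
  L (hermite_series a [::]) = csum (fun m n => a m n * L (herm m n)).
Proof.
move=> tL ra; apply: esym; apply: csum_eq.
have [lin [ws [K [K0 HL]]]] := tL.
have [B [B0 H]] : exists B, 0 <= B /\ forall s, s \in ws -> forall N u,
    cnorm (sops s (fun u => hermite_series a [::] u - hermite_sum a N u) u) <= B / N.+1%:R.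
  elim: {HL} ws => [|s ws [B [B0 IH]]]; first by exists 0.
  have [B' H] := hermite_series_rate ra s.
  exists (B + `|B'|); split; first by rewrite addr_ge0.
  move=> s'; rewrite inE => /orP[/eqP -> N u|/IH h N u].
    apply: le_trans (H N u) _; rewrite ler_wpM2r// (le_trans (ler_norm _))//.
    by rewrite lerDr.
  by apply: le_trans (h N u) _; rewrite ler_wpM2r// lerDl.
have sF := is_schwartz_series ra [::].
exists (K * B) => N; have sN := is_schwartz_sum a N.
rewrite -(tempered_hermite_sum a N tL) -mulrA.
have -> : L (hermite_series a [::]) - L (hermite_sum a N) =
    L (fun u => hermite_series a [::] u - hermite_sum a N u).
  have := lin (-1) _ _ sN sF; rewrite mulN1r addrC => <-; congr L.
  by apply/funext => u; rewrite mulN1r addrC.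
apply: HL; [exact: is_schwartzB|exact: divr_ge0|].
by move=> s sw u; exact: H.
Qed.

Lemma tempered_pairing g : is_schwartz g -> tempered (pairing^~ g).
Proof.
move=> sg; split=> [c f h sf sh|]; first exact: pairing_linl.
have [cg [K gK]] := is_schwartz_cdom sg.
have K0 : 0 <= K := le_trans (mulr_ge0 (bracket_ge0 (0, 0)) (cnorm_ge0 _)) (gK (0, 0)).
exists [:: [::]], (2 * pi ^+ 2 * K); split.
  exact: mulr_ge0 (mulr_ge0 (ler0n _ 2) (exprn_ge0 _ (pi_ge0 R))) K0.
move=> f B sf B0 H; rewrite pairingE -mulrA; apply: cintegral_bound.
  by apply: ccontM => //; case: (is_schwartz_elim sf).
move=> u; have h := H [::] (mem_head _ _) u.
rewrite cnormM mulrCA mulrC.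
exact: (ler_pM (mulr_ge0 (bracket_ge0 u) (cnorm_ge0 _)) (cnorm_ge0 _) (gK u) h).
Qed.

(** The four monomials of bracket = 1 + q^2 + p^2 + q^2 p^2, written as words. *)
Definition bracket_words : seq (seq (bool * bool)) :=
  let q := (false, false) in let p := (false, true) in
  [:: [::]; [:: q; q]; [:: p; p]; [:: q; q; p; p]].

Lemma bracket_words_bound f (B : R) :
  (forall s, s \in bracket_words -> forall u, cnorm (sops s f u) <= B) ->
  forall u, bracket u * cnorm (f u) <= 4 * B.
Proof.
move=> H u.
have h1 := H [::] (mem_head _ _) u.
have /(H _)/(_ u) h2 : [:: (false, false); (false, false)] \in bracket_words by [].
have /(H _)/(_ u) h3 : [:: (false, true); (false, true)] \in bracket_words by [].
have /(H _)/(_ u) h4 : [:: (false, false); (false, false); (false, true); (false, true)] \in bracket_words by [].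
move: h1 h2 h3 h4; rewrite /sops /sop /= /crd !cnormM !cnormR /bracket.
have e1 : u.1 ^+ 2 = `|u.1| * `|u.1| by rewrite -expr2 real_normK// num_real.
have e2 : u.2 ^+ 2 = `|u.2| * `|u.2| by rewrite -expr2 real_normK// num_real.
rewrite e1 e2; move: (cnorm (f u)) `|u.1| `|u.2| => z x y h1 h2 h3 h4.
have -> : (1 + x * x) * (1 + y * y) * z = z + x * (x * z) + y * (y * z) + x * (x * (y * (y * z))) by ring.
lra.
Qed.

Lemma tempered_twistedl h u : is_schwartz h -> tempered (fun f => twisted_fun f h u).
Proof.
move=> sh; split=> [c f g sf sg|].
  by apply: twisted_linl => //; exact: is_schwartz_cdom.
have [ch [K hK]] := is_schwartz_cdom sh.
have K0 : 0 <= K := le_trans (mulr_ge0 (bracket_ge0 (0, 0)) (cnorm_ge0 _)) (hK (0, 0)).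
exists bracket_words, (tbound * 4 * K); split.
  exact: mulr_ge0 (mulr_ge0 tbound_ge0 (ler0n _ 4)) K0.
move=> f B sf B0 /bracket_words_bound fB; have [cf _ _] := is_schwartz_elim sf.
have := twisted_bound u cf sh fB hK.
by congr (_ <= _); move: tbound => t; ring.
Qed.

Lemma tempered_twistedr f u : is_schwartz f -> tempered (fun h => twisted_fun f h u).
Proof.
move=> sf; split=> [c g h sg sh|].
  by apply: twisted_linr => //; exact: is_schwartz_cdom.
have [cf [K fK]] := is_schwartz_cdom sf.
have K0 : 0 <= K := le_trans (mulr_ge0 (bracket_ge0 (0, 0)) (cnorm_ge0 _)) (fK (0, 0)).
exists bracket_words, (tbound * K * 4); split.
  exact: mulr_ge0 (mulr_ge0 tbound_ge0 K0) (ler0n _ 4).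
move=> h B sh B0 /bracket_words_bound hB.
have := twisted_bound u cf sh fK hB.
by congr (_ <= _); move: tbound => t; ring.
Qed.

Lemma rapid_fcoef f : is_schwartz f -> rapid_mx (fcoef f).
Proof. by move=> sf k; have [K _ HK] := fcoef_rapid k sf; exists K. Qed.

Lemma fcoef_series a m n : rapid_mx a -> fcoef (hermite_series a [::]) m n = a m n.
Proof.
move=> ra; have tp := tempered_pairing (@is_schwartz_herm R n m).
rewrite fcoefE (tempered_series tp ra) -csumZ; last exact: (tempered_summable tp ra).
have E k l : (4 * pi)^-1%:C * (a k l * pairing (herm k l) (herm n m)) =
    a k l * ((k == m) && (l == n))%:R.
  by rewrite -fcoef_herm fcoefE; move: (pairing _ _) => p; ring.
rewrite (csum_delta (k := m) (l := n)).
  by rewrite E !eqxx mulr1.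
move=> k l; rewrite E; case: eqP => [->|]; case: eqP => [->|]; rewrite ?mulr0//.
Qed.

(** Both sides are Schwartz functions with the same coefficients, so completeness identifies the sum
    of the series. *)
Lemma series_fcoef f : is_schwartz f -> hermite_series (fcoef f) [::] = f.
Proof.
move=> sf; have rf := rapid_fcoef sf; apply: fcoef_inj => //.
  exact: is_schwartz_series.
by move=> m n; exact: fcoef_series.
Qed.

Lemma tempered_expand L f : tempered L -> is_schwartz f ->
  L f = csum (fun m n => fcoef f m n * L (herm m n)).
Proof.
by move=> tL sf; rewrite -(tempered_series tL (rapid_fcoef sf)) series_fcoef.
Qed.

End TemperedFunctionals.

(** * Multipliers *)

Section GlidingHump.
Context {R : realType}.
Implicit Types (m n k l j : nat).

Definition rapid_seq (y : nat -> R[i]) :=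
  forall k, exists K, forall n, n.+1%:R ^+ k * cnorm (y n) <= K.

Lemma clim_delta (z : R[i]) n : clim (fun N => \sum_(l < N) (if l == n :> nat then z else 0)) z.
Proof.
exists (cnorm z * n.+1%:R) => N.
have [nN|Nn] := ltnP n N.
  rewrite (bigD1 (Ordinal nN))//= eqxx big1 ?addr0 ?subrr ?cnorm0 ?divr_ge0 ?mulr_ge0 ?cnorm_ge0//.
  by move=> l /eqP h; case: eqP => // e; case: h; exact: val_inj.
rewrite big1 ?subr0 => [|l _]; last by case: eqP => // e; have := ltn_ord l; lia.
by rewrite -mulrA ler_peMr ?cnorm_ge0// ler_pdivlMr// mul1r ler_nat.
Qed.

Variables (c : nat -> nat -> R[i]) (C0 : R) (p k : nat).
Hypothesis C0_ge0 : 0 <= C0.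
Hypothesis c_bound : forall m n, cnorm (c m n) <= C0 * nn m n ^+ p.
Hypothesis c_rapid : forall y, rapid_seq y -> rapid_seq (fun m => csum1 (fun n => c m n * y n)).

(** Applied to the n-th unit vector, [c_rapid] controls each single column; only the dependence of
    the bound on n can be bad. *)
Lemma rapid_column n : exists K, forall m, m.+1%:R ^+ k * cnorm (c m n) <= K.
Proof.
have rd : rapid_seq (fun l => if l == n then 1 else 0).
  move=> q; exists (n.+1%:R ^+ q) => l; case: eqP => [->|_].
    by rewrite cnorm1 mulr1.
  by rewrite cnorm0 mulr0 exprn_ge0.
have [K HK] := c_rapid rd k; exists K => m; have := HK m.
rewrite (@csum1_eq _ _ (c m n))//.
apply: eq_clim (clim_delta (c m n) n) => N; apply: eq_bigr => l _.
by case: eqP => [->|_]; rewrite ?mulr1 ?mulr0.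
Qed.

Hypothesis not_bounded : forall (d : nat) (C : R), exists m n,
  C * n.+1%:R ^+ d < m.+1%:R ^+ k * cnorm (c m n).

Let column := projT1 (choice rapid_column).

Let columnP n m : m.+1%:R ^+ k * cnorm (c m n) <= column n.
Proof. exact: projT2 (choice rapid_column) n m. Qed.

Let column_ge0 n : 0 <= column n.
Proof. by apply: le_trans (columnP n 0%N); rewrite mulr_ge0 ?cnorm_ge0 ?exprn_ge0. Qed.

(* The state (j, A, M): number of humps so far, bound for the contribution of
   the previous columns, and normalisation making the later columns small in
   the rows of the previous humps. *)
Let hump n (s : nat * R * R) m :=
  (s.1.2 + s.1.1%:R + 2) * (s.2 * n.+1%:R ^+ (p + s.1.1 + 2)) < m.+1%:R ^+ k * cnorm (c m n).

(** Lifts the hump term, (m+1)^k times the entry times the weight, above A + j + 2: A pays for the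
    earlier columns, 2 for the later ones because the [wt] sum to at most 2, and j is left over. The
    exponent grows with j so that the weights decrease rapidly; a column without a hump gets weight
    0. *)
Let weight n (s : nat * R * R) : R :=
  if `[< exists m, hump n s m >] then (s.2 * n.+1%:R ^+ (p + s.1.1 + 2))^-1 else 0.

Let row n s : nat := xget 0%N [set m | hump n s m].

(** The increment of A bounds the new column in every row. The increment of M is the size C0
    (m+1)^(k+p) attached to the hump row m, which makes later weights small against that row. *)
Let step n (s : nat * R * R) : nat * R * R :=
  if `[< exists m, hump n s m >] then
    (s.1.1.+1, s.1.2 + column n * weight n s, s.2 + C0 * (row n s).+1%:R ^+ (k + p))
  else s.

Let Fixpoint state n : nat * R * R := if n is n'.+1 then step n' (state n') else (0%N, 0, 1).

Let J n := (state n).1.1.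
Let A n := (state n).1.2.
Let M n := (state n).2.
Let al n := weight n (state n).
Let trig n := exists m, hump n (state n) m.

Let stateS n : state n.+1 = step n (state n). Proof. by []. Qed.

Let step_trig n : trig n -> [/\ J n.+1 = (J n).+1, A n.+1 = A n + column n * al n,
  M n.+1 = M n + C0 * (row n (state n)).+1%:R ^+ (k + p),
  al n = (M n * n.+1%:R ^+ (p + J n + 2))^-1 & hump n (state n) (row n (state n))].
Proof.
move=> t; rewrite /J /A /M /al stateS /step /weight; have tt : `[< trig n >] by apply/asboolP.
rewrite /trig in tt; rewrite tt; split=> //.
exact: (@xgetPex _ 0%N [set m | hump n (state n) m]).
Qed.

Let step_notrig n : ~ trig n -> state n.+1 = state n /\ al n = 0.
Proof.
by move=> /asboolPn/negPf t; rewrite stateS /step /al /weight t.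
Qed.

Let M_ge1 n : 1 <= M n.
Proof.
elim: n => [//|n IH]; have [t|/step_notrig[e _]] := pselect (trig n); last by rewrite /M e.
have [_ _ -> _ _] := step_trig t.
by rewrite (le_trans IH)// lerDl mulr_ge0// exprn_ge0.
Qed.

Let al_ge0 n : 0 <= al n.
Proof.
have [t|/step_notrig[_ ->]] := pselect (trig n); last by [].
have [_ _ _ -> _] := step_trig t.
by rewrite invr_ge0 mulr_ge0 ?exprn_ge0// (le_trans ler01).
Qed.

Let A_sum n : A n = \sum_(l < n) column l * al l.
Proof.
elim: n => [|n IH]; first by rewrite big_ord0.
rewrite big_ord_recr /= -IH; have [t|/step_notrig[e ->]] := pselect (trig n).
  by have [_ -> _ _ _] := step_trig t.
by rewrite mulr0 addr0 /A e.
Qed.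

Let J_le n n' : (n <= n')%N -> (J n <= J n')%N.
Proof.
elim: n' => [|n' IH]; first by rewrite leqn0 => /eqP ->.
rewrite leq_eqVlt => /orP[/eqP -> //|]; rewrite ltnS => /IH /leq_trans; apply.
have [t|/step_notrig[e _]] := pselect (trig n'); last by rewrite /J e.
by have [-> _ _ _ _] := step_trig t.
Qed.

Let M_le n n' : (n <= n')%N -> M n <= M n'.
Proof.
elim: n' => [|n' IH]; first by rewrite leqn0 => /eqP ->.
rewrite leq_eqVlt => /orP[/eqP -> //|]; rewrite ltnS => /IH /le_trans; apply.
have [t|/step_notrig[e _]] := pselect (trig n'); last by rewrite /M e.
by have [_ _ -> _ _] := step_trig t; rewrite lerDl mulr_ge0 ?exprn_ge0.
Qed.

(** Without a further hump the state would stay constant, so the columns from N on would be bounded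
    by [D] times a fixed power of n + 1; the finitely many earlier ones are bounded by [column].
    Together this contradicts [not_bounded]. *)
Let trig_exists N : exists2 n, (N <= n)%N & trig n.
Proof.
have [//|H] := pselect (exists2 n, (N <= n)%N & trig n).
have nt n : (N <= n)%N -> ~ trig n by move=> Nn t; apply: H; exists n.
have cst d : state (d + N)%N = state N.
  elim: d => [//|d IH]; have [-> _] := step_notrig (nt (d + N)%N (leq_addl _ _)).
  exact: IH.
set D := (A N + (J N)%:R + 2) * M N.
have A0 : 0 <= A N by rewrite A_sum sumr_ge0// => l _; rewrite mulr_ge0.
have M0 : 0 <= M N by rewrite (le_trans ler01).
have D0 : 0 <= D by rewrite mulr_ge0// !addr_ge0.
have [m [n]] := not_bounded (p + J N + 2) (D + \sum_(l < N) column l).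
rewrite ltNge => /negP[].
have S0 (Q : pred 'I_N) : 0 <= \sum_(l < N | Q l) column l by exact: sumr_ge0.
have n1 : 1 <= n.+1%:R ^+ (p + J N + 2) :> R by rewrite exprn_ege1// ler1n.
have [nN|Nn] := ltnP n N.
  apply: le_trans (columnP n m) _; rewrite (bigD1 (Ordinal nN))//=.
  have h := S0 (fun r => r != Ordinal nN).
  move: h; set S := \sum_(_ < _ | _) _ => h; have := column_ge0 n => h2.
  apply: (@le_trans _ _ (D + (column n + S))); first by lra.
  by rewrite ler_peMr//; lra.
have := nt n Nn; have := cst (n - N)%N; rewrite subnK// => e.
rewrite /trig e => h; rewrite leNgt; apply/negP => h2; apply: h; exists m.
rewrite /hump -/(A N) -/(J N) -/(M N) mulrA -/D; apply: le_lt_trans h2.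
by rewrite ler_wpM2r ?exprn_ge0// lerDl.
Qed.

Let J_unbounded q : exists N, (q <= J N)%N.
Proof.
elim: q => [|q [N IH]]; first by exists 0%N.
have [n Nn t] := trig_exists N; exists n.+1; have [-> _ _ _ _] := step_trig t.
by rewrite ltnS (leq_trans IH)// J_le.
Qed.

Let al_le n q : (q <= p + J n + 2)%N -> n.+1%:R ^+ q * al n <= 1.
Proof.
move=> qn; have [t|/step_notrig[_ ->]] := pselect (trig n); last by rewrite mulr0.
have [_ _ _ -> _] := step_trig t.
have M0 : 0 < M n := lt_le_trans ltr01 (M_ge1 n).
rewrite ler_pdivrMr ?mulr_gt0 ?exprn_gt0// mul1r.
apply: (@le_trans _ _ (n.+1%:R ^+ (p + J n + 2))).
  by rewrite ler_weXn2l// ler1n.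
by rewrite ler_peMl ?exprn_ge0.
Qed.

(** The number of humps tends to infinity, so the exponent p + J n + 2 of the weights eventually
    exceeds any given power. *)
Let al_rapid : rapid_seq (fun n => (al n)%:C).
Proof.
move=> q; have [N HN] := J_unbounded q.
have S0 : 0 <= \sum_(l < N) l.+1%:R ^+ q * al l.
  by apply: sumr_ge0 => l _; rewrite mulr_ge0 ?exprn_ge0.
exists (1 + \sum_(l < N) l.+1%:R ^+ q * al l) => n.
rewrite cnormR ger0_norm//; have [nN|Nn] := ltnP n N.
  rewrite (bigD1 (Ordinal nN))//= addrCA lerDl addr_ge0// sumr_ge0// => l _.
  by rewrite mulr_ge0 ?exprn_ge0.
rewrite (le_trans (al_le _)) ?lerDl//.
by have := J_le Nn; lia.
Qed.

Let hump_large n : trig n ->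
  (J n)%:R < (row n (state n)).+1%:R ^+ k *
    cnorm (csum1 (fun l => c (row n (state n)) l * (al l)%:C)).
Proof.
move=> t; have [_ _ Mn aln hn] := step_trig t.
set m := row n (state n) in Mn hn *; rewrite /hump -/(A n) -/(J n) -/(M n) in hn.
pose x l := c m l * (al l)%:C.
pose x' l := if l == n then 0 else x l.
set mk : R := m.+1%:R ^+ k; have mk0 : 0 < mk by rewrite exprn_gt0.
have cx l : cnorm (x l) = cnorm (c m l) * al l by rewrite cnormM cnormR ger0_norm.
have [K HK] : exists K, forall l, cnorm (x l) <= K * wt l.
  have [K HK] := al_rapid (p + 2).
  exists (C0 * m.+1%:R ^+ p * K) => l; rewrite cx.
  have := HK l; rewrite cnormR (ger0_norm (al_ge0 l)) exprD => h.
  apply: le_trans (ler_wpM2r (al_ge0 l) (c_bound m l)) _.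
  rewrite /wt ler_pdivlMr ?exprn_gt0// /nn exprMn.
  have := ler_wpM2l (mulr_ge0 C0_ge0 (exprn_ge0 p (ler0n R m.+1))) h.
  by congr (_ <= _); ring.
have HK' l : cnorm (x' l) <= K * wt l.
  rewrite /x'; case: eqP => _; last exact: HK.
  by rewrite cnorm0; apply: le_trans (HK l); exact: cnorm_ge0.
have E : csum1 x = csum1 x' + x n.
  apply: csum1_eq; apply: eq_clim (climD (csum1_clim HK') (clim_delta (x n) n)) => N.
  rewrite -big_split; apply: eq_bigr => l _; rewrite /x' /=.
  by case: eqP => [->|_]; rewrite ?add0r ?addr0.
(* [M l] contains C0 (m+1)^(k+p), and (l+1)^(p + J l) dominates (l+1)^p, so the growth bound on the
   entry is used up; the remaining exponent 2 in the weight is [wt l]. *)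
have later l : (n < l)%N -> mk * cnorm (x l) <= wt l.
  move=> nl; have [tl|/step_notrig[_ e]] := pselect (trig l); last first.
    by rewrite cx e !mulr0 wt_ge0.
  have [_ _ _ al_l _] := step_trig tl.
  have Ml : C0 * m.+1%:R ^+ (k + p) <= M l.
    by apply: le_trans (M_le nl); rewrite Mn lerDr (le_trans ler01).
  have M0 : 0 < M l := lt_le_trans ltr01 (M_ge1 l).
  rewrite cx al_l mulrA ler_pdivrMr ?mulr_gt0 ?exprn_gt0// /wt.
  have l0 : (0 : R) < l.+1%:R by [].
  have -> : (l.+1%:R ^+ 2)^-1 * (M l * l.+1%:R ^+ (p + J l + 2)) = M l * l.+1%:R ^+ (p + J l) :> R.
    have z0 : l.+1%:R ^+ 2 != 0 :> R by rewrite expf_neq0// gt_eqF.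
    rewrite [l.+1%:R ^+ (_ + 2)]exprD; move: z0 (l.+1%:R ^+ (p + J l)).
    by move: (l.+1%:R ^+ 2) (M l) => z q z0 y; field.
  apply: (@le_trans _ _ (C0 * m.+1%:R ^+ (k + p) * l.+1%:R ^+ p)).
    have := ler_wpM2l (ltW mk0) (c_bound m l); congr (_ <= _).
    by rewrite /mk /nn exprMn exprD; ring.
  rewrite ler_pM ?exprn_ge0 ?mulr_ge0// ?exprn_ge0//.
  by rewrite ler_weXn2l ?ler1n// leq_addr.
have rest : mk * cnorm (csum1 x') <= A n + 2.
  rewrite mulrC -ler_pdivlMr//; apply: (clim_le (K := 0) _ (csum1_clim HK')) => N.
  rewrite mul0r addr0 ler_pdivlMr// mulrC.
  apply: le_trans (ler_wpM2l (ltW mk0) (cnorm_sum _ _ _)) _; rewrite mulr_sumr.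
  apply: (@le_trans _ _ (\sum_(l < N) ((if (l < n)%N then column l * al l else 0) + wt l))).
    apply: ler_sum => l _; have w0 := @wt_ge0 R l.
    rewrite /x'; case: ltngtP => ln.
    - rewrite cx mulrA (le_trans (ler_wpM2r (al_ge0 l) (columnP l m)))// lerDl//.
    - by rewrite add0r; exact: later.
    - by rewrite cnorm0 mulr0 add0r.
  rewrite big_split /= lerD ?wt_sum// A_sum.
  have c0 l : 0 <= column l * al l by rewrite mulr_ge0.
  have [Nn|nN] := leqP N n.
    rewrite (big_ord_widen n (fun l => if (l < n)%N then column l * al l else 0) Nn).
    rewrite [leLHS]big_mkcond; apply: ler_sum => l _; rewrite ltn_ord.
    by case: ifP.
  rewrite -big_mkcond /= [leRHS](big_ord_widen N (fun l => column l * al l) (ltnW nN)).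
  by [].
have main : A n + (J n)%:R + 2 < mk * cnorm (x n).
  rewrite cx aln mulrA ltr_pdivlMr//.
  by rewrite mulr_gt0 ?exprn_gt0// (lt_le_trans ltr01 (M_ge1 n)).
have := cnormB (csum1 x' + x n) (csum1 x'); rewrite addrAC subrr add0r -E.
move=> /(ler_wpM2l (ltW mk0)); rewrite mulrDr.
rewrite -/x; move: rest main; set X := mk * _; set Y := mk * _; set Z := mk * _.
move=> h1 h2 h3; lra.
Qed.

Lemma gliding_hump : False.
Proof.
have [K HK] := c_rapid al_rapid k.
have [q qK] : exists q : nat, K < q%:R.
  exists (Num.bound `|K|); apply: le_lt_trans (ler_norm K) _.
  exact: archi_boundP.
have [N HN] := J_unbounded q; have [n Nn t] := trig_exists N.
have := lt_le_trans (hump_large t) (HK _); rewrite ltNge => /negP; apply.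
by rewrite (le_trans (ltW qK))// ler_nat (leq_trans HN)// J_le.
Qed.

End GlidingHump.

Lemma rapid_row_growth (R : realType) (c : nat -> nat -> R[i]) (C0 : R) p k : 0 <= C0 ->
  (forall m n, cnorm (c m n) <= C0 * nn m n ^+ p) ->
  (forall y, rapid_seq y -> rapid_seq (fun m => csum1 (fun n => c m n * y n))) ->
  exists d C, forall m n, m.+1%:R ^+ k * cnorm (c m n) <= C * n.+1%:R ^+ d.
Proof.
move=> C00 cb cr; have [//|H] := pselect (exists d C, forall m n,
  m.+1%:R ^+ k * cnorm (c m n) <= C * n.+1%:R ^+ d).
exfalso; apply: (@gliding_hump R c C0 p k C00 cb cr) => d C.
have [//|H2] := pselect (exists m n, C * n.+1%:R ^+ d < m.+1%:R ^+ k * cnorm (c m n)).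
exfalso; apply: H; exists d, C => m n; rewrite leNgt; apply/negP => h; apply: H2.
by exists m, n.
Qed.

(** * Matrix products and exchange of summations *)

Section MatrixProducts.
Context {R : realType}.
Implicit Types (m n k l : nat) (a b c : nat -> nat -> R[i]).

Definition mmul a b m l : R[i] := csum1 (fun k => a m k * b k l).

Lemma csum1Z (z : R[i]) (x : nat -> R[i]) K : (forall n, cnorm (x n) <= K * wt n) ->
  csum1 (fun n => z * x n) = z * csum1 x.
Proof.
move=> xK; apply: csum1_eq; apply: eq_clim (climZ z (csum1_clim xK)) => N.
by rewrite mulr_sumr.
Qed.

Lemma nn_tri m k l : nn m l <= nn m k * nn k l :> R.
Proof. by rewrite /nn -!natrM ler_nat; nia. Qed.

Lemma mul_nnX (C : R) m n d : C * nn m n ^+ d = C * m.+1%:R ^+ d * n.+1%:R ^+ d.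
Proof. by rewrite /nn exprMn mulrA. Qed.

Lemma wt_le1 n : wt n <= 1 :> R.
Proof. by rewrite invf_le1 ?exprn_gt0// exprn_ege1// ler1n. Qed.

(** The growth of z in (m, l) is distributed over the two factors by [nn_tri]; two further powers of
    decay in each provide the weights. *)
Lemma tri_bound a b (C : R) d : rapid_mx a -> rapid_mx b -> 0 <= C ->
  exists2 K, 0 <= K & forall m k l (z : R[i]), cnorm z <= C * nn m l ^+ d ->
    cnorm (a m k * b k l * z) <= K * wt m * wt k * wt l.
Proof.
move=> ra rb C0; have [Ka aK] := ra (d + 2)%N; have [Kb bK] := rb (d + 2)%N.
have Ka0 : 0 <= Ka.
  by apply: le_trans (aK 0%N 0%N); exact: mulr_ge0 (nnX_ge0 _ _ _) (cnorm_ge0 _).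
have Kb0 : 0 <= Kb.
  by apply: le_trans (bK 0%N 0%N); exact: mulr_ge0 (nnX_ge0 _ _ _) (cnorm_ge0 _).
exists (C * (Ka * Kb)) => [|m k l z zC]; first by rewrite !mulr_ge0.
have h1 := nn_wt (aK m k); have h2 := nn_wt (bK k l).
have p1 := mulr_ge0 (nnX_ge0 m k d) (cnorm_ge0 (a m k)).
have p2 := mulr_ge0 (nnX_ge0 k l d) (cnorm_ge0 (b k l)).
have h := ler_pM p1 p2 h1 h2.
have w0 := @wt_ge0 R.
have ht : nn m l ^+ d <= nn m k ^+ d * nn k l ^+ d :> R.
  rewrite -exprMn lerXn2r ?nnegrE ?nn_tri//; first exact: ltW (nn_gt0 _ _).
  exact: mulr_ge0 (ltW (nn_gt0 _ _)) (ltW (nn_gt0 _ _)).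
rewrite (cnormM (a m k * b k l)) (cnormM (a m k)).
have ab0 : 0 <= cnorm (a m k) * cnorm (b k l) by exact: mulr_ge0 (cnorm_ge0 _) (cnorm_ge0 _).
apply: le_trans (ler_wpM2l ab0 (le_trans zC (ler_wpM2l C0 ht))) _.
have hw : Ka * wt m * wt k * (Kb * wt k * wt l) <= Ka * Kb * wt m * wt k * wt l.
  have -> : Ka * wt m * wt k * (Kb * wt k * wt l) = Ka * Kb * wt m * wt k * wt l * wt k.
    by move: (wt m) (wt k) (wt l) => x y t; ring.
  by rewrite ler_piMr ?wt_le1// !mulr_ge0.
have := ler_wpM2l C0 (le_trans h hw).
move: (wt m) (wt k) (wt l) (cnorm _) (cnorm _) (nn m k ^+ d) (nn k l ^+ d) => x1 x2 x3 x4 x5 x6 x7.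
by congr (_ <= _); ring.
Qed.

Lemma mmul_terms a b m l : rapid_mx a -> rapid_mx b ->
  exists K, forall k, cnorm (a m k * b k l) <= K * wt k.
Proof.
move=> ra rb; have [K K0 HK] := tri_bound 0 ra rb ler01.
exists (K * wt m * wt l) => k; have := HK m k l 1.
rewrite mulr1 expr0 cnorm1 mulr1 => /(_ (lexx _)).
by congr (_ <= _); move: (wt m) (wt k) (wt l) => x y t; ring.
Qed.

Lemma growth_terms a (y : nat -> R[i]) (C : R) d k : rapid_mx a -> 0 <= C ->
  (forall n, cnorm (y n) <= C * n.+1%:R ^+ d) ->
  (exists K, forall n, cnorm (a n k * y n) <= K * wt n) /\
  (exists K, forall n, cnorm (a k n * y n) <= K * wt n).
Proof.
move=> ra C0 yC; have [K K0 HK] := rapid_mx_wt d ra C0.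
split; exists (K * wt k) => n.
  have := HK n k (y n) 1 ler01; rewrite mul1r mul1r [_ * wt k]mulrAC; apply.
  apply: le_trans (yC n) _; rewrite ler_wpM2l// lerXn2r ?nnegrE ?(ltW (nn_gt0 _ _))//.
  by rewrite /nn ler_peMr// ler1n.
have := HK k n (y n) 1 ler01; rewrite mul1r mul1r; apply.
apply: le_trans (yC n) _; rewrite ler_wpM2l// lerXn2r ?nnegrE ?(ltW (nn_gt0 _ _))//.
by rewrite /nn ler_peMl// ler1n.
Qed.

(** The decay of [a] and [b] beats the growth of [c], so the triple series is dominated and its
    summations may be exchanged. These are the trace identities that move one factor of a product
    onto a distribution. *)
Lemma csum_tri_scaled a b c (C : R) d : rapid_mx a -> rapid_mx b -> 0 <= C ->
  (forall m l, cnorm (c m l) <= C * nn m l ^+ d) ->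
  [/\ csum (fun m l => mmul a b m l * c m l) =
        csum (fun k l => b k l * csum1 (fun m => a m k * c m l)) &
      csum (fun m l => mmul a b m l * c m l) =
        csum (fun m k => a m k * csum1 (fun l => b k l * c m l))].
Proof.
move=> ra rb C0 cC; have [K K0 HK] := tri_bound d ra rb C0.
pose x m k l := a m k * b k l * c m l.
have xK m k l : cnorm (x m k l) <= K * wt m * wt k * wt l by exact: HK.
have xK' l m k : cnorm (x m k l) <= K * wt l * wt m * wt k.
  by have := xK m k l; congr (_ <= _); move: (wt m) (wt k) (wt l) => p q r; ring.
have E0 : csum (fun m l => mmul a b m l * c m l) = csum (fun m k => csum1 (x m k)).
  rewrite -(@csum_tri _ (fun l m k => x m k l) K xK') -csum_transpose.
  congr csum; apply/funext => l; apply/funext => m.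
  have [K' HK'] := mmul_terms m l ra rb.
  rewrite mulrC /mmul -(csum1Z _ HK'); congr csum1; apply/funext => k.
  by rewrite mulrC.
split; rewrite E0.
  rewrite (csum_tri xK); congr csum; apply/funext => k; apply/funext => l.
  apply: csum1_eq; rewrite /x.
  have Cl : 0 <= C * l.+1%:R ^+ d by rewrite mulr_ge0 ?exprn_ge0.
  have cl m : cnorm (c m l) <= C * l.+1%:R ^+ d * m.+1%:R ^+ d.
    by have := cC m l; rewrite nnC mul_nnX.
  have [[Kl Hl] _] := growth_terms k ra Cl cl.
  apply: eq_clim (climZ (b k l) (csum1_clim Hl)) => N.
  by rewrite mulr_sumr; apply: eq_bigr => m _; ring.
congr csum; apply/funext => m; apply/funext => k.
apply: csum1_eq; rewrite /x.
have Cm : 0 <= C * m.+1%:R ^+ d by rewrite mulr_ge0 ?exprn_ge0.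
have cm l : cnorm (c m l) <= C * m.+1%:R ^+ d * l.+1%:R ^+ d.
  by have := cC m l; rewrite mul_nnX.
have [_ [Kl Hl]] := growth_terms k rb Cm cm.
apply: eq_clim (climZ (a m k) (csum1_clim Hl)) => N.
by rewrite mulr_sumr; apply: eq_bigr => l _; ring.
Qed.

Lemma rapid_mmul a b : rapid_mx a -> rapid_mx b -> rapid_mx (mmul a b).
Proof.
move=> ra rb j; have [Ka aK] := ra (j + 2)%N; have [Kb bK] := rb (j + 2)%N.
have Ka0 : 0 <= Ka.
  by apply: le_trans (aK 0%N 0%N); exact: mulr_ge0 (nnX_ge0 _ _ _) (cnorm_ge0 _).
exists (2 * (Ka * Kb)) => m l.
rewrite mulrC -ler_pdivlMr ?exprn_gt0 ?nn_gt0// -mulrA; apply: csum1_bound => k.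
rewrite mulrAC ler_pdivlMr ?exprn_gt0 ?nn_gt0// cnormM.
have h1 := nn_wt (aK m k); have h2 := nn_wt (bK k l).
have p1 := mulr_ge0 (nnX_ge0 m k j) (cnorm_ge0 (a m k)).
have p2 := mulr_ge0 (nnX_ge0 k l j) (cnorm_ge0 (b k l)).
have ht : nn m l ^+ j <= nn m k ^+ j * nn k l ^+ j :> R.
  rewrite -exprMn lerXn2r ?nnegrE ?nn_tri//; first exact: ltW (nn_gt0 _ _).
  exact: mulr_ge0 (ltW (nn_gt0 _ _)) (ltW (nn_gt0 _ _)).
have ab0 : 0 <= cnorm (a m k) * cnorm (b k l) by exact: mulr_ge0 (cnorm_ge0 _) (cnorm_ge0 _).
have w0 := @wt_ge0 R.
apply: le_trans (ler_wpM2l ab0 ht) _.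
have h1' : nn m k ^+ j * cnorm (a m k) <= Ka * wt k.
  by apply: le_trans h1 _; rewrite ler_wpM2r// ler_piMr ?wt_le1.
have h2' : nn k l ^+ j * cnorm (b k l) <= Kb.
  apply: le_trans (bK k l); rewrite ler_wpM2r ?cnorm_ge0//.
  by rewrite ler_weXn2l ?nn_ge1 ?leq_addr.
have := ler_pM p1 p2 h1' h2'.
move: (wt k) (cnorm _) (cnorm _) (nn m k ^+ j) (nn k l ^+ j) => x1 x4 x5 x6 x7.
by congr (_ <= _); ring.
Qed.

End MatrixProducts.

(** * The twisted product as a matrix product *)

Section TwistedSeries.
Context {R : realType}.
Implicit Types (f g h : plane R -> R[i]) (u v w : plane R) (i : bool) (m n k l : nat).

Lemma csum_row (x : nat -> nat -> R[i]) k : summable x ->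
  (forall m n, m <> k -> x m n = 0) -> csum x = csum1 (x k).
Proof.
move=> sx H; apply: esym; apply: csum1_eq; have [K xK] := sx; have [K' HK'] := csum_clim sx.
have K0 : 0 <= K.
  by have := le_trans (cnorm_ge0 _) (xK 0%N 0%N); rewrite /wt expr1n invr1 !mulr1.
have xkK n : cnorm (x k n) <= K * wt k * wt n by exact: xK.
exists (K' + K * wt k * 2 * k.+1%:R) => N; have := HK' N; rewrite /boxsum.
have s0 : cnorm (\sum_(n < N) x k n) <= K * wt k * 2.
  apply: le_trans (cnorm_sum _ _ _) _; apply: (@le_trans _ _ (\sum_(n < N) K * wt k * wt n)).
    exact: ler_sum.
  by rewrite -mulr_sumr ler_wpM2l ?wt_sum// mulr_ge0 ?wt_ge0.
have [kN|Nk] := ltnP k N.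
  rewrite (bigD1 (Ordinal kN))//= [X in _ - (_ + X)]big1 ?addr0.
    move=> /le_trans; apply; rewrite ler_wpM2r// lerDl mulr_ge0//.
    exact: le_trans (cnorm_ge0 _) s0.
  by move=> m /eqP mk; rewrite big1// => n _; apply: H => e; apply: mk; exact: val_inj.
rewrite big1 ?subr0.
  move=> h; apply: le_trans (cnormB _ _) _; rewrite mulrDl lerD//.
  rewrite (le_trans s0)// -[leRHS]mulrA ler_peMr//; first exact: le_trans (cnorm_ge0 _) s0.
  by rewrite ler_pdivlMr// mul1r ler_nat; lia.
by move=> m _; rewrite big1// => n _; apply: H => e; have := ltn_ord m; lia.
Qed.

(** At a fixed u the value is a tempered functional of f and of h, so both are expanded; by [hprodE]
    the product of f_mk with f_k'l survives only for k' = k, and the sum over k forms the matrix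
    product. *)
Lemma twisted_series f h : is_schwartz f -> is_schwartz h ->
  twisted_fun f h = hermite_series (mmul (fcoef f) (fcoef h)) [::].
Proof.
move=> sf sh; apply/funext => u.
have rf := rapid_fcoef sf; have rh := rapid_fcoef sh.
rewrite (tempered_expand (tempered_twistedl u sh) sf) /hermite_series.
have [C [d [C0 hC]]] := @sops_herm_bound R [::].
have [_ ->] := csum_tri_scaled rf rh C0 (fun m l => hC m l u).
congr csum; apply/funext => m; apply/funext => k; congr (_ * _).
have tr := tempered_twistedr u (@is_schwartz_herm R m k).
rewrite (tempered_expand tr sh).
rewrite (@csum_row _ k).
- congr csum1; apply/funext => l; have := hprodE m k k l u.
  by rewrite eqxx mul1r /hprod => ->.
- exact: tempered_summable tr rh.
- move=> k' l kk; have := hprodE m k k' l u; case: eqP => [e|_]; first by case: kk.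
  by rewrite mul0r /hprod => ->; rewrite mulr0.
Qed.

Lemma is_schwartz_twisted f h : is_schwartz f -> is_schwartz h -> is_schwartz (twisted_fun f h).
Proof.
move=> sf sh; rewrite twisted_series//; apply: is_schwartz_series.
by apply: rapid_mmul; exact: rapid_fcoef.
Qed.

Lemma fcoef_twisted f h m n : is_schwartz f -> is_schwartz h ->
  fcoef (twisted_fun f h) m n = mmul (fcoef f) (fcoef h) m n.
Proof.
move=> sf sh; rewrite twisted_series//; apply: fcoef_series.
by apply: rapid_mmul; exact: rapid_fcoef.
Qed.

End TwistedSeries.

(** * Matrices of distributions and of their twisted products *)

Section Distributions.
Context {R : realType}.
Implicit Types (f g h : schwartz_space R) (u : plane R) (m n k l : nat).
Implicit Types (phi : plane R -> R[i]) (T : schwartz_space R -> R[i]).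

Lemma schwartz_funK f : is_schwartz f.
Proof. by apply/asboolP; exact: schwartz_funP f. Qed.

Lemma to_schwartzK phi : is_schwartz phi -> to_schwartz phi = phi :> (plane R -> R[i]).
Proof.
move=> /asboolP s; have s' : phi \in schwartz by [].
by rewrite /to_schwartz -[schwartz_fun _]/(val _) val_insubd s'.
Qed.

Lemma schwartz_inj f g : f = g :> (plane R -> R[i]) -> f = g.
Proof. exact: val_inj. Qed.

Lemma to_schwartz_fun f : to_schwartz f = f.
Proof. by apply: schwartz_inj; apply: to_schwartzK; exact: schwartz_funK. Qed.

Definition monomial_word (a b c d : nat) : seq (bool * bool) :=
  nseq a (false, false) ++ nseq b (false, true) ++ nseq c (true, false) ++ nseq d (true, true).

Lemma sops_monomial_word a b c d phi u :
  cnorm (sops (monomial_word a b c d) phi u) = weighted_partial a b c d phi u.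
Proof.
have crdX i k psi : sops (nseq k (false, i)) psi u = crd i u ^+ k * psi u.
  elim: k => [|k /= IH]; first by rewrite mul1r.
  by rewrite /sop /= IH exprS mulrA.
have parX s psi : sops [seq (true, i) | i <- s] psi = partials s psi by elim: s => [//|i s /= ->].
rewrite /weighted_partial /monomial_word.
have -> : nseq c (true, false) ++ nseq d (true, true) =
    [seq (true, i) | i <- nseq c false ++ nseq d true] by rewrite map_cat !map_nseq.
rewrite /sops 2!foldr_cat -!/(sops _ _) parX crdX crdX cnormM cnormM.
by rewrite !cnormX !cnormR normrM !normrX mulrA.
Qed.

Lemma tempered_to_schwartz T : tempered_distribution T -> tempered (fun phi => T (to_schwartz phi)).
Proof.
move=> [lin [N [K TK]]]; split=> [c phi psi sphi spsi|].
  rewrite -lin; congr T; apply: schwartz_inj.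
  rewrite to_schwartzK; last exact: is_schwartz_lin.
  by apply/funext => u; rewrite /= !to_schwartzK.
exists [seq monomial_word t.1.1.1 t.1.1.2 t.1.2 t.2 | t : 'I_N * 'I_N * 'I_N * 'I_N].
(* The sum contains N^4 seminorms, each at most B; the absolute value is taken because [K] may be
   negative. *)
exists (`|K| * N%:R ^+ 4); split; first by rewrite mulr_ge0// exprn_ge0.
move=> phi B sphi B0 H; apply: le_trans (TK _) _.
have sB a b c d : (a < N)%N -> (b < N)%N -> (c < N)%N -> (d < N)%N ->
    0 <= seminorm a b c d (to_schwartz phi) <= B.
  move=> aN bN cN dN; rewrite to_schwartzK//.
  have UB : ubound (range (weighted_partial a b c d phi)) B.
    move=> _ [u _ <-]; rewrite -sops_monomial_word; apply: H.
    apply/mapP; exists (Ordinal aN, Ordinal bN, Ordinal cN, Ordinal dN) => //.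
    by rewrite mem_enum.
  apply/andP; split.
    apply: (@le_trans _ _ (weighted_partial a b c d phi (0, 0))).
      by rewrite -sops_monomial_word cnorm_ge0.
    by apply: ub_le_sup; [exists B|exists (0, 0)].
  by apply: ge_sup => //; exists (weighted_partial a b c d phi (0, 0)), (0, 0).
set S := \sum_(a < N) _.
have : 0 <= S <= N%:R ^+ 4 * B.
  have const (x : R) : \sum_(a < N) x = N%:R * x by rewrite sumr_const card_ord mulr_natl.
  apply/andP; split.
    apply: sumr_ge0 => a _; apply: sumr_ge0 => b _; apply: sumr_ge0 => c _.
    by apply: sumr_ge0 => d _; case/andP: (sB a b c d (ltn_ord a) (ltn_ord b) (ltn_ord c) (ltn_ord d)).
  rewrite exprS -mulrA -const; apply: ler_sum => a _.
  rewrite exprS -mulrA -const; apply: ler_sum => b _.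
  rewrite exprS -mulrA -const; apply: ler_sum => c _.
  rewrite expr1 -const; apply: ler_sum => d _.
  by case/andP: (sB a b c d (ltn_ord a) (ltn_ord b) (ltn_ord c) (ltn_ord d)).
move=> /andP[S0 SB]; rewrite -mulrA.
by apply: le_trans (ler_wpM2r S0 (ler_norm K)) _; rewrite ler_wpM2l.
Qed.

Lemma hermite_coefE T m n : hermite_coef T m n = 2^-1 * T (to_schwartz (herm n m)).
Proof.
rewrite /hermite_coef; congr (_ * T (to_schwartz _)); apply/funext => u.
by rewrite twisted_hermiteE; exact: cj_herm.
Qed.

Lemma dist_herm T m n : T (to_schwartz (herm m n)) = 2 * hermite_coef T n m.
Proof. by rewrite hermite_coefE mulrA mulfV ?mul1r// pnatr_eq0. Qed.

Lemma dist_expand T f : tempered_distribution T ->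
  T f = csum (fun m n => fcoef f m n * (2 * hermite_coef T n m)).
Proof.
move=> /tempered_to_schwartz tT; have := tempered_expand tT (schwartz_funK f).
rewrite to_schwartz_fun => ->; congr csum; apply/funext => m; apply/funext => n.
by rewrite dist_herm.
Qed.

Lemma hermite_coef_growth T : tempered_distribution T ->
  exists C d, 0 <= C /\ forall m n, cnorm (hermite_coef T m n) <= C * nn m n ^+ d.
Proof.
move=> /tempered_to_schwartz/tempered_herm[C [d [C0 H]]].
exists C, d; split => // m n; rewrite hermite_coefE cnormM nnC.
by rewrite -[leRHS]mul1r ler_pM ?cnorm_ge0// cnormV cnorm_nat invf_le1 ?ler1n ?ltr0n.
Qed.

Lemma embedE g h : embed g h = (2 * pi)^-1%:C * pairing g h.
Proof. by rewrite pairingE. Qed.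

Lemma hermite_coef_embed g m n : hermite_coef (embed g) m n = fcoef g m n.
Proof.
rewrite hermite_coefE embedE fcoefE to_schwartzK; last exact: is_schwartz_herm.
move: (pairing _ _) => p; rewrite mulrA; congr (_ * _).
have -> : (2^-1 : R[i]) = (2^-1)%:C by rewrite -[2](rc_nat 2); exact/esym/fmorphV.
rewrite -rcM -invfM; congr (_^-1%:C); ring.
Qed.

Lemma embed_expand g h : embed g h = csum (fun m n => fcoef h m n * (2 * fcoef g n m)).
Proof.
have sg := schwartz_funK g; have sh := schwartz_funK h.
rewrite embedE pairingC (tempered_expand (tempered_pairing sg) sh).
rewrite -csumZ; last exact: tempered_summable (tempered_pairing sg) (rapid_fcoef sh).
congr csum; apply/funext => m; apply/funext => n.
have -> : 2 * fcoef g n m = (2 * pi)^-1%:C * pairing g (herm m n).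
  rewrite -hermite_coef_embed hermite_coefE embedE to_schwartzK; last exact: is_schwartz_herm.
  by move: (pairing _ _) => p; rewrite [LHS]mulrA mulfV ?pnatr_eq0// mul1r.
rewrite pairingC; move: (pairing g _) (fcoef h m n) => p q; ring.
Qed.

Lemma twisted_val f h : twisted f h = twisted_fun f h :> (plane R -> R[i]).
Proof. by apply: to_schwartzK; apply: is_schwartz_twisted; exact: schwartz_funK. Qed.

Lemma fcoef_twisted_val f h m n : fcoef (twisted f h) m n = mmul (fcoef f) (fcoef h) m n.
Proof. by rewrite twisted_val fcoef_twisted//; exact: schwartz_funK. Qed.

Lemma rapid_fcoef_val f : rapid_mx (fcoef f).
Proof. exact: rapid_fcoef (schwartz_funK f). Qed.

(** T of a twisted product is twice a trace of three matrices. Grouping the matrix of f with that of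
    T exhibits T x f tested on h; grouping that of h with T exhibits h x T tested on f. *)
Lemma dist_twisted_expand T f h : tempered_distribution T ->
  T (twisted f h) = csum (fun k l => fcoef h k l * (2 * mmul (hermite_coef T) (fcoef f) l k)) /\
  T (twisted f h) = csum (fun m k => fcoef f m k * (2 * mmul (fcoef h) (hermite_coef T) k m)).
Proof.
move=> tT; have [C [d [C0 HC]]] := hermite_coef_growth tT.
have C2 : 0 <= 2 * C by rewrite mulr_ge0.
have H2 m l : cnorm (2 * hermite_coef T l m) <= 2 * C * nn m l ^+ d.
  by rewrite cnormM cnorm_nat -[leRHS]mulrA ler_wpM2l// nnC.
have [E1 E2] := csum_tri_scaled (rapid_fcoef_val f) (rapid_fcoef_val h) C2 H2.
have Cn n : 0 <= C * n.+1%:R ^+ d by rewrite mulr_ge0 ?exprn_ge0.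
have E : T (twisted f h) = csum (fun m l => mmul (fcoef f) (fcoef h) m l * (2 * hermite_coef T l m)).
  rewrite dist_expand//; congr csum; apply/funext => m; apply/funext => n.
  by rewrite fcoef_twisted_val.
split; rewrite E; [rewrite E1|rewrite E2].
  congr csum; apply/funext => k; apply/funext => l; congr (_ * _).
  have cl m : cnorm (hermite_coef T l m) <= C * l.+1%:R ^+ d * m.+1%:R ^+ d.
    by have := HC l m; rewrite mul_nnX.
  have [[K HK] _] := growth_terms k (rapid_fcoef_val f) (Cn l) cl.
  rewrite /mmul -(@csum1Z _ 2 _ K).
    by congr csum1; apply/funext => m; ring.
  by move=> m; rewrite mulrC.
congr csum; apply/funext => m; apply/funext => k; congr (_ * _).
have cm l : cnorm (hermite_coef T l m) <= C * m.+1%:R ^+ d * l.+1%:R ^+ d.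
  by have := HC l m; rewrite nnC mul_nnX.
have [_ [K HK]] := growth_terms k (rapid_fcoef_val h) (Cn m) cm.
rewrite /mmul -(@csum1Z _ 2 _ K)//.
by congr csum1; apply/funext => l; ring.
Qed.

Lemma hermite_coef_dist_twisted T f m n : tempered_distribution T ->
  hermite_coef (dist_twisted T f) m n = mmul (hermite_coef T) (fcoef f) m n.
Proof.
move=> tT; rewrite hermite_coefE /dist_twisted (dist_twisted_expand _ _ tT).1.
have sh := @is_schwartz_herm R n m.
rewrite (csum_delta (k := n) (l := m)); rewrite to_schwartzK//; last first.
  move=> k l; rewrite fcoef_herm; case: eqP => [<-|]; case: eqP => [<-|]; rewrite ?mul0r//.
by rewrite fcoef_herm !eqxx mul1r mulrA mulVf ?mul1r// pnatr_eq0.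
Qed.

Lemma hermite_coef_twisted_dist T f m n : tempered_distribution T ->
  hermite_coef (twisted_dist f T) m n = mmul (fcoef f) (hermite_coef T) m n.
Proof.
move=> tT; rewrite hermite_coefE /twisted_dist (dist_twisted_expand _ _ tT).2.
have sh := @is_schwartz_herm R n m.
rewrite (csum_delta (k := n) (l := m)); rewrite to_schwartzK//; last first.
  move=> k l; rewrite fcoef_herm; case: eqP => [<-|]; case: eqP => [<-|]; rewrite ?mul0r//.
by rewrite fcoef_herm !eqxx mul1r mulrA mulVf ?mul1r// pnatr_eq0.
Qed.

(** The matrix of T x f is the product of the two matrices. If it is rapidly decreasing, its Hermite
    series is a Schwartz function whose expansion against every h agrees with that of T x f. *)
Lemma in_schwartz_twisted T f : tempered_distribution T ->
  in_schwartz (dist_twisted T f) <-> rapid_mx (mmul (hermite_coef T) (fcoef f)).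
Proof.
move=> tT; split=> [[g gE]|rc].
  suff <- : fcoef g = mmul (hermite_coef T) (fcoef f) by exact: rapid_fcoef_val.
  apply/funext => m; apply/funext => n.
  by rewrite -hermite_coef_dist_twisted// gE hermite_coef_embed.
exists (to_schwartz (hermite_series (mmul (hermite_coef T) (fcoef f)) [::])).
apply/funext => h; rewrite /dist_twisted (dist_twisted_expand _ _ tT).1 embed_expand.
congr csum; apply/funext => k; apply/funext => l; congr (_ * (_ * _)).
by rewrite to_schwartzK ?fcoef_series//; exact: is_schwartz_series.
Qed.

Lemma in_schwartz_twistedr T f : tempered_distribution T ->
  in_schwartz (twisted_dist f T) <-> rapid_mx (mmul (fcoef f) (hermite_coef T)).
Proof.
move=> tT; split=> [[g gE]|rc].
  suff <- : fcoef g = mmul (fcoef f) (hermite_coef T) by exact: rapid_fcoef_val.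
  apply/funext => m; apply/funext => n.
  by rewrite -hermite_coef_twisted_dist// gE hermite_coef_embed.
exists (to_schwartz (hermite_series (mmul (fcoef f) (hermite_coef T)) [::])).
apply/funext => h; rewrite /twisted_dist (dist_twisted_expand _ _ tT).2 embed_expand.
congr csum; apply/funext => k; apply/funext => l; congr (_ * (_ * _)).
by rewrite to_schwartzK ?fcoef_series//; exact: is_schwartz_series.
Qed.

End Distributions.

(** * Multiplier matrices and weighted square sums *)

Section WeightedMatrices.
Context {R : realType}.
Implicit Types (m n k l : nat) (a b c : nat -> nat -> R[i]).

Definition transpose c : nat -> nat -> R[i] := fun m n => c n m.

Definition row_growth c := forall k, exists d (C : R), forall m n,
  m.+1%:R ^+ k * cnorm (c m n) <= C * n.+1%:R ^+ d.

Lemma rapid_transpose a : rapid_mx a -> rapid_mx (transpose a).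
Proof. by move=> ra k; have [K HK] := ra k; exists K => m n; rewrite nnC. Qed.

Lemma mmul_transpose a c : mmul a c = transpose (mmul (transpose c) (transpose a)).
Proof.
apply/funext => m; apply/funext => n; rewrite /transpose /mmul.
by congr csum1; apply/funext => k; rewrite mulrC.
Qed.

Lemma left_multiplier_mx c (C : R) d : 0 <= C ->
  (forall m n, cnorm (c m n) <= C * nn m n ^+ d) ->
  (forall a, rapid_mx a -> rapid_mx (mmul c a)) <-> row_growth c.
Proof.
move=> C0 cC; split=> [H k|gc a ra j].
  apply: (rapid_row_growth k C0 cC) => y ry j.
  (* A vector is tested as column 0 of a matrix vanishing elsewhere: column 0 of the product is the
     image of the vector. *)
  pose a m n := if n == 0%N then y m else 0.
  have ra : rapid_mx a.
    move=> q; have [K HK] := ry q; exists K => m n; rewrite /a; case: eqP => [->|_].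
      by have := HK m; rewrite /nn mulr1.
    rewrite cnorm0 mulr0; apply: le_trans (HK 0%N).
    exact: mulr_ge0 (exprn_ge0 _ (ler0n _ _)) (cnorm_ge0 _).
  have [K HK] := H a ra j; exists K => m; have := HK m 0%N.
  by rewrite /nn mulr1.
(* The exponent e compensates the growth of [c] in k, j is the decay required in l, and 2 makes the
   sum over k converge. *)
have [e [D HD]] := gc j; have [K HK] := ra (e + j + 2)%N.
have D0 : 0 <= D.
  have := HD 0%N 0%N; rewrite !expr1n mul1r mulr1; apply: le_trans; exact: cnorm_ge0.
have K0 : 0 <= K.
  by apply: le_trans (HK 0%N 0%N); exact: mulr_ge0 (nnX_ge0 _ _ _) (cnorm_ge0 _).
exists (2 * (D * K)) => m l.
rewrite mulrC -ler_pdivlMr ?exprn_gt0 ?nn_gt0// -mulrA; apply: csum1_bound => k.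
rewrite mulrAC ler_pdivlMr ?exprn_gt0 ?nn_gt0// cnormM.
have h1 := HD m k; have h2 := nn_wt (HK k l).
have p1 := mulr_ge0 (exprn_ge0 j (ler0n R m.+1)) (cnorm_ge0 (c m k)).
have p2 : 0 <= l.+1%:R ^+ j * cnorm (a k l).
  exact: mulr_ge0 (exprn_ge0 _ (ler0n _ _)) (cnorm_ge0 _).
have h2' : k.+1%:R ^+ e * (l.+1%:R ^+ j * cnorm (a k l)) <= K * wt k.
  apply: (@le_trans _ _ (K * wt k * wt l)).
    apply: le_trans h2; rewrite mulrA ler_wpM2r ?cnorm_ge0//.
    rewrite exprD ler_pM ?exprn_ge0// lerXn2r ?nnegrE ?(ltW (nn_gt0 _ _))//.
      by rewrite /nn ler_peMr// ler1n.
    by rewrite /nn ler_peMl// ler1n.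
  by rewrite ler_piMr ?wt_le1// mulr_ge0 ?wt_ge0.
have h3 := ler_wpM2r p2 h1; have h4 := ler_wpM2l D0 h2'.
have h5 : D * k.+1%:R ^+ e * (l.+1%:R ^+ j * cnorm (a k l)) <= D * (K * wt k).
  by rewrite -mulrA.
have := le_trans h3 h5; rewrite /nn exprMn [D * K * _]mulrAC.
by move: (wt k) (cnorm (c m k)) (cnorm (a k l)) => x y z; congr (_ <= _); ring.
Qed.

Definition weighted_sum (s t : R) c : \bar R :=
  (\esum_(k in [set: nat * nat])
    ((2 * k.1%:R + 1) `^ s * (2 * k.2%:R + 1) `^ t * cnorm (c k.1 k.2) ^+ 2)%:E)%E.

Lemma weighted_sum_transpose s t c : weighted_sum s t (transpose c) = weighted_sum t s c.
Proof.
rewrite /weighted_sum (@reindex_esum _ _ _ [set: nat * nat] [set: nat * nat] (fun r => (r.2, r.1))).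
  by apply: eq_esum => k _ /=; rewrite [X in X * _]mulrC.
split=> //; first by move=> [x1 x2] [y1 y2] _ _ [-> ->].
by move=> [x1 x2] _; exists (x2, x1).
Qed.

Lemma esum_nat_le (x : nat -> R) (B : R) : (forall n, 0 <= x n) ->
  (forall N, \sum_(n < N) x n <= B) -> (\esum_(n in [set: nat]) (x n)%:E <= B%:E)%E.
Proof.
move=> x0 xB; rewrite -nneseries_esumT => [|n]; last by rewrite lee_fin.
apply: lime_le; first by apply: is_cvg_nneseries => n _ _; rewrite lee_fin.
by apply: nearW => N; rewrite sumEFin lee_fin big_mkord.
Qed.

Lemma esum_wt (D : R) : 0 <= D ->
  (\esum_(k in [set: nat * nat]) (D * wt k.1 * wt k.2)%:E <= (D * 2 * 2)%:E)%E.
Proof.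
move=> D0.
have -> : [set: nat * nat] = [set: nat] `*`` (fun=> [set: nat]).
  by apply/seteqP; split=> -[].
rewrite -(@esum_esum _ _ _ [set: nat] (fun=> [set: nat]) (fun m n => (D * wt m * wt n)%:E)) => [|m n _ _]; last first.
  by rewrite lee_fin !mulr_ge0 ?wt_ge0.
apply: (@le_trans _ _ (\esum_(m in [set: nat]) (D * wt m * 2)%:E)%E).
  apply: le_esum => m _; apply: esum_nat_le => [n|N].
    by rewrite !mulr_ge0 ?wt_ge0.
  by rewrite -mulr_sumr ler_wpM2l ?wt_sum// mulr_ge0 ?wt_ge0.
apply: esum_nat_le => [n|N]; first by rewrite !mulr_ge0 ?wt_ge0.
by rewrite -mulr_suml -mulr_sumr ler_wpM2r// ler_wpM2l ?wt_sum.
Qed.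

Lemma nat_above (x : R) : exists q : nat, `|x| <= q%:R.
Proof. by exists (Num.bound `|x|); apply/ltW/archi_boundP. Qed.

Lemma odd_weight_ge1 n : 1 <= 2 * n%:R + 1 :> R.
Proof. by rewrite lerDr mulr_ge0. Qed.

Lemma odd_weight_gt0 n : 0 < 2 * n%:R + 1 :> R.
Proof. exact: lt_le_trans ltr01 (odd_weight_ge1 n). Qed.

Lemma odd_weight_ge0 n : 0 <= 2 * n%:R + 1 :> R.
Proof. exact: ltW (odd_weight_gt0 n). Qed.

Lemma odd_weight_le n : 2 * n%:R + 1 <= 2 * n.+1%:R :> R.
Proof. by rewrite -natr1; lra. Qed.

Lemma odd_weight_ge n : n.+1%:R <= 2 * n%:R + 1 :> R.
Proof. by rewrite -natr1; have := ler0n R n; lra. Qed.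

(** A single term is at most the sum, which gives the growth bound; conversely two spare powers in
    each index make the weighted series converge. Real exponents are compared with integers through
    [nat_above], and 2 n + 1 lies between n + 1 and 2 (n + 1). *)
Lemma weighted_sum_row_growth c :
  (forall s, exists t, (weighted_sum s t c < +oo)%E) <-> row_growth c.
Proof.
split=> [H k|gc s].
  have [t Ht] := H (2 * k)%:R.
  have [B HB] : exists B : R, forall m n, (2 * m%:R + 1) `^ (2 * k)%:R * (2 * n%:R + 1) `^ t
      * cnorm (c m n) ^+ 2 <= B.
    exists (fine (weighted_sum (2 * k)%:R t c)) => m n.
    rewrite -lee_fin fineK; last first.
      rewrite ge0_fin_numE//; apply: esum_ge0 => x _; rewrite lee_fin.
      by rewrite !mulr_ge0 ?powR_ge0 ?exprn_ge0 ?cnorm_ge0.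
    apply: esum_ge; exists [set (m, n)]; first by split.
    by rewrite fsbig_set1.
  have [q Hq] := nat_above t.
  have B0 : 0 <= B.
    by apply: le_trans (HB 0%N 0%N); rewrite !mulr_ge0 ?powR_ge0 ?exprn_ge0 ?cnorm_ge0.
  (* Squares are compared below, and the summand 1 spares a square root: B 2^q is at most (B 2^q +
     1)^2. *)
  exists q, (B * 2 ^+ q + 1) => m n.
  have m0 := ler0n R m.+1; have n0 := ler0n R n.+1; have c0 := cnorm_ge0 (c m n).
  have om := odd_weight_ge1 m; have on := odd_weight_ge1 n.
  have h1 : m.+1%:R ^+ (2 * k) <= (2 * m%:R + 1) `^ (2 * k)%:R :> R.
    rewrite powR_mulrn ?odd_weight_ge0// lerXn2r ?nnegrE ?odd_weight_ge0//.
    exact: odd_weight_ge.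
  have h2 : ((2 * n.+1%:R) ^+ q)^-1 <= (2 * n%:R + 1) `^ t :> R.
    apply: (@le_trans _ _ ((2 * n%:R + 1) `^ (- q%:R))).
      rewrite powRN powR_mulrn ?odd_weight_ge0// lef_pV2 ?posrE ?exprn_gt0 ?mulr_gt0 ?odd_weight_gt0//.
      by rewrite lerXn2r ?nnegrE ?mulr_ge0 ?odd_weight_ge0// odd_weight_le.
    by apply: ler_powR => //; rewrite lerNl (le_trans _ Hq)// -normrN ler_norm.
  have h3 : m.+1%:R ^+ (2 * k) * ((2 * n.+1%:R) ^+ q)^-1 * cnorm (c m n) ^+ 2 <= B.
    apply: le_trans (HB m n); rewrite ler_wpM2r ?exprn_ge0//.
    apply: (ler_pM _ _ h1 h2); first exact: exprn_ge0.
    by rewrite invr_ge0 exprn_ge0// mulr_ge0.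
  have q0 : 0 < (2 * n.+1%:R) ^+ q :> R by rewrite exprn_gt0// mulr_gt0.
  rewrite mulrAC ler_pdivrMr// in h3.
  have nq : 1 <= n.+1%:R ^+ q :> R by rewrite exprn_ege1// ler1n.
  have t0 : 0 <= 2 ^+ q :> R by rewrite exprn_ge0.
  rewrite -ler_sqr ?nnegrE; last 2 first.
  - by rewrite mulr_ge0 ?exprn_ge0.
  - by rewrite mulr_ge0 ?exprn_ge0// addr_ge0 ?mulr_ge0.
  rewrite exprMn -exprM mulnC; apply: le_trans h3 _; rewrite exprMn mulrA exprMn.
  set x := B * 2 ^+ q; have x0 : 0 <= x by rewrite mulr_ge0.
  move: nq; set y := n.+1%:R ^+ q => y1.
  have y0 : 0 <= y by exact: le_trans ler01 y1.
  rewrite ler_pM//; last by rewrite expr2 ler_peMl.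
  by rewrite sqrrD1; have := sqr_ge0 x; lra.
(* After squaring, the exponent q + 1 gives at least q + 2 powers of m + 1: q absorb the weight and
   2 remain for [wt m]. *)
have [q Hq] := nat_above s; have [d [C HC]] := gc q.+1.
have C0 : 0 <= C.
  by have := HC 0%N 0%N; rewrite !expr1n mul1r mulr1; apply: le_trans; exact: cnorm_ge0.
(* 2 d cancels the squared growth in n, and 2 remains for [wt n]. *)
exists (- (2 * d + 2)%N%:R).
apply: le_lt_trans (ltry _); apply: le_trans (esum_wt (D := 2 ^+ q * C ^+ 2) _); last first.
  by rewrite mulr_ge0 ?exprn_ge0.
apply: le_esum => -[m n] _ /=; rewrite lee_fin.
have m0 := ler0n R m.+1; have n0 := ler0n R n.+1; have c0 := cnorm_ge0 (c m n).
have om := odd_weight_ge1 m; have on := odd_weight_ge1 n.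
have m1 : 1 <= m.+1%:R :> R by rewrite ler1n.
have h1 : (2 * m%:R + 1) `^ s <= 2 ^+ q * m.+1%:R ^+ q :> R.
  apply: (@le_trans _ _ ((2 * m%:R + 1) `^ q%:R)).
    by apply: ler_powR => //; rewrite (le_trans _ Hq)// ler_norm.
  rewrite powR_mulrn ?odd_weight_ge0// -exprMn lerXn2r ?nnegrE ?mulr_ge0 ?odd_weight_ge0//.
  exact: odd_weight_le.
have h2 : (2 * n%:R + 1) `^ (- (2 * d + 2)%N%:R) <= (n.+1%:R ^+ (2 * d + 2))^-1 :> R.
  rewrite powRN powR_mulrn ?odd_weight_ge0// lef_pV2 ?posrE ?exprn_gt0 ?odd_weight_gt0//.
  by rewrite lerXn2r ?nnegrE ?odd_weight_ge0// odd_weight_ge.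
have h3 : m.+1%:R ^+ (q + 2) * cnorm (c m n) ^+ 2 <= C ^+ 2 * n.+1%:R ^+ (2 * d).
  have := HC m n; rewrite -ler_sqr ?nnegrE ?mulr_ge0 ?exprn_ge0//; rewrite !exprMn -!exprM => h.
  apply: le_trans _ (le_trans h _); last by rewrite mulnC.
  by rewrite ler_wpM2r ?exprn_ge0// ler_weXn2l//; lia.
have d0 : 0 < n.+1%:R ^+ (2 * d + 2) :> R by rewrite exprn_gt0.
have i0 : 0 <= (n.+1%:R ^+ (2 * d + 2))^-1 :> R by rewrite invr_ge0 ltW.
have e0 : 0 <= cnorm (c m n) ^+ 2 by rewrite exprn_ge0.
apply: (@le_trans _ _ (2 ^+ q * m.+1%:R ^+ q * (n.+1%:R ^+ (2 * d + 2))^-1 * cnorm (c m n) ^+ 2)).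
  by rewrite ler_wpM2r// ler_pM ?powR_ge0.
have mm : 0 < m.+1%:R ^+ 2 :> R by rewrite exprn_gt0.
have nn2 : 0 < n.+1%:R ^+ 2 :> R by rewrite exprn_gt0.
have nd : 0 < n.+1%:R ^+ (2 * d) :> R by rewrite exprn_gt0.
have t0 : 0 <= 2 ^+ q :> R by rewrite exprn_ge0.
move: h3 mm nn2 nd; rewrite /wt [n.+1%:R ^+ (2 * d + 2)]exprD exprD.
move: (m.+1%:R ^+ q) (m.+1%:R ^+ 2) (n.+1%:R ^+ (2 * d)) (n.+1%:R ^+ 2).
move: (cnorm (c m n) ^+ 2) (C ^+ 2) t0 => e C2; move: (2 ^+ q) => t t0 X M2 N N2 h3 mm nn2 nd.
have h4 : X * e <= C2 * N / M2 by rewrite ler_pdivlMr// mulrAC.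
have i1 : 0 <= t * ((N)^-1 * N2^-1) by rewrite !mulr_ge0 ?invr_ge0 ?(ltW nd) ?(ltW nn2).
have -> : t * X * (N * N2)^-1 * e = t * (N^-1 * N2^-1) * (X * e) by rewrite invfM; ring.
apply: le_trans (ler_wpM2l i1 h4) _; rewrite le_eqVlt; apply/orP; left; apply/eqP.
by field; rewrite !gt_eqF.
Qed.

End WeightedMatrices.

(** * Multipliers characterised by their matrices *)

Section Multipliers.
Context {R : realType}.
Implicit Types (T : schwartz_space R -> R[i]).

Lemma fcoef_surj (a : nat -> nat -> R[i]) : rapid_mx a ->
  exists f : schwartz_space R, fcoef f = a.
Proof.
move=> ra; exists (to_schwartz (hermite_series a [::])).
rewrite to_schwartzK; last exact: is_schwartz_series.
by apply/funext => m; apply/funext => n; exact: fcoef_series.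
Qed.

Lemma left_multiplierP T : tempered_distribution T ->
  (forall f, in_schwartz (dist_twisted T f)) <-> row_growth (hermite_coef T).
Proof.
move=> tT; have [C [d [C0 HC]]] := hermite_coef_growth tT.
apply: iff_trans (left_multiplier_mx C0 HC); split=> [H a /fcoef_surj[f <-]|H f].
  exact/in_schwartz_twisted.
by apply/in_schwartz_twisted => //; apply: H; exact: rapid_fcoef_val.
Qed.

Lemma right_multiplierP T : tempered_distribution T ->
  (forall f, in_schwartz (twisted_dist f T)) <-> row_growth (transpose (hermite_coef T)).
Proof.
move=> tT; have [C [d [C0 HC]]] := hermite_coef_growth tT.
have HC' m n : cnorm (transpose (hermite_coef T) m n) <= C * nn m n ^+ d.
  by rewrite nnC; exact: HC.
apply: iff_trans (left_multiplier_mx C0 HC'); split=> [H a ra|H f].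
  have [f fa] := fcoef_surj (rapid_transpose ra).
  have /in_schwartz_twistedr := H f; rewrite fa => /(_ tT) /rapid_transpose.
  by rewrite -mmul_transpose.
apply/in_schwartz_twistedr => //; rewrite mmul_transpose; apply: rapid_transpose.
by apply: H; apply: rapid_transpose; exact: rapid_fcoef_val.
Qed.

End Multipliers.

Theorem theorem4 (R : realType) :
  left_multipliers R =
    \bigcap_(s in [set: R]) \bigcup_(t in [set: R]) G_space s t /\
  right_multipliers R =
    \bigcap_(t in [set: R]) \bigcup_(s in [set: R]) G_space s t.
Proof.
split; apply/seteqP; split=> T.
- move=> [tT /(left_multiplierP tT)/weighted_sum_row_growth H] s _.
  by have [t Ht] := H s; exists t.
(* Every [G_space] consists of tempered distributions; the instance 0 of the intersection is taken
   to extract this. *)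
- move=> H; have [t _ [tT _]] := H 0 I; split=> //.
  apply/(left_multiplierP tT)/weighted_sum_row_growth => s.
  by have [{}t _ [_ Ht]] := H s I; exists t.
- move=> [tT /(right_multiplierP tT)/weighted_sum_row_growth H] t _.
  by have [s] := H t; rewrite weighted_sum_transpose => Hs; exists s.
- move=> H; have [s _ [tT _]] := H 0 I; split=> //.
  apply/(right_multiplierP tT)/weighted_sum_row_growth => t.
  have [{}s _ [_ Hs]] := H t I; exists s.
  by rewrite weighted_sum_transpose.
Qed.
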